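(* Let $\zeta=e^{2\pi i/13}$, let $G=\langle S,T\rangle\subset \mathrm{GL}(6,\mathbb{C})$ and let $\Phi_{12},\Phi_{18},\Phi_{20},\Phi_{30}\in\mathbb{C}[z_1,\dots,z_6]$ and $x_1(z),\dots,x_6(z)$ be as defined in the context. Then, as polynomials in $z_1,\dots,z_6$, $\Phi_{12},\Phi_{18},\Phi_{20},\Phi_{30}$ are $G$-invariant, i.e. $\Phi_j(g\mathbf{z})=\Phi_j(\mathbf{z})$ for all $g\in G$ and $\mathbf{z}=(z_1,\dots,z_6)^T\in\mathbb{C}^6$. Moreover, writing $\Phi_j=\Phi_j(x_1(z),\dots,x_6(z))$ for $j=12,18,20,30$, the following identities hold for all $z$ in the upper half-plane $\mathbb{H}$: $$\Phi_{20}^3-\Phi_{30}^2=1728\,\Phi_{12}^5,\qquad \Phi_{20}^3-\Phi_{12}^2\Phi_{18}^2=1728\,\Phi_{12}^5.$$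
   Context: Let $\zeta=\exp(2\pi i/13)$. Let $S=-\frac{1}{\sqrt{13}}M$ where $M$ is the $6\times 6$ matrix with rows $(\zeta^{12}-\zeta,\ \zeta^{10}-\zeta^3,\ \zeta^4-\zeta^9,\ \zeta^5-\zeta^8,\ \zeta^2-\zeta^{11},\ \zeta^6-\zeta^7)$, $(\zeta^{10}-\zeta^3,\ \zeta^4-\zeta^9,\ \zeta^{12}-\zeta,\ \zeta^2-\zeta^{11},\ \zeta^6-\zeta^7,\ \zeta^5-\zeta^8)$, $(\zeta^4-\zeta^9,\ \zeta^{12}-\zeta,\ \zeta^{10}-\zeta^3,\ \zeta^6-\zeta^7,\ \zeta^5-\zeta^8,\ \zeta^2-\zeta^{11})$, $(\zeta^5-\zeta^8,\ \zeta^2-\zeta^{11},\ \zeta^6-\zeta^7,\ \zeta-\zeta^{12},\ \zeta^3-\zeta^{10},\ \zeta^9-\zeta^4)$, $(\zeta^2-\zeta^{11},\ \zeta^6-\zeta^7,\ \zeta^5-\zeta^8,\ \zeta^3-\zeta^{10},\ \zeta^9-\zeta^4,\ \zeta-\zeta^{12})$, $(\zeta^6-\zeta^7,\ \zeta^5-\zeta^8,\ \zeta^2-\zeta^{11},\ \zeta^9-\zeta^4,\ \zeta-\zeta^{12},\ \zeta^3-\zeta^{10})$, and $T=\mathrm{diag}(\zeta^7,\zeta^{11},\zeta^8,\zeta^6,\zeta^2,\zeta^5)$; let $G=\langle S,T\rangle$ (a group isomorphic to $\mathrm{PSL}(2,13)$), acting on $\mathbb{C}^6$ by matrix multiplication on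 column vectors $(z_1,\dots,z_6)^T$. Quadratic forms: $\mathbb{A}_0=z_1z_4+z_2z_5+z_3z_6$, $\mathbb{A}_1=z_1^2-2z_3z_4$, $\mathbb{A}_2=-z_5^2-2z_2z_4$, $\mathbb{A}_3=z_2^2-2z_1z_5$, $\mathbb{A}_4=z_3^2-2z_2z_6$, $\mathbb{A}_5=-z_4^2-2z_1z_6$, $\mathbb{A}_6=-z_6^2-2z_3z_5$. Set $w_\infty=13\mathbb{A}_0^2$ and, for $\nu=0,\dots,12$, $w_\nu=(\mathbb{A}_0+\zeta^{\nu}\mathbb{A}_1+\zeta^{4\nu}\mathbb{A}_2+\zeta^{9\nu}\mathbb{A}_3+\zeta^{3\nu}\mathbb{A}_4+\zeta^{12\nu}\mathbb{A}_5+\zeta^{10\nu}\mathbb{A}_6)^2$. Cubic forms: $\mathbb{D}_0=z_1z_2z_3$; $\mathbb{D}_1=2z_2z_3^2+z_2^2z_6-z_4^2z_5+z_1z_5z_6$; $\mathbb{D}_2=-z_6^3+z_2^2z_4-2z_2z_5^2+z_1z_4z_5+3z_3z_5z_6$; $\mathbb{D}_3=2z_1z_2^2+z_1^2z_5-z_4z_6^2+z_3z_4z_5$; $\mathbb{D}_4=-z_2^2z_3+z_1z_6^2-2z_4^2z_6-z_1z_3z_5$; $\mathbb{D}_5=-z_4^3+z_3^2z_5-2z_3z_6^2+z_2z_5z_6+3z_1z_4z_6$; $\mathbb{D}_6=-z_5^3+z_1^2z_6-2z_1z_4^2+z_3z_4z_6+3z_2z_4z_5$; $\mathbb{D}_7=-z_2^3+z_3z_4^2-z_1z_3z_6-3z_1z_2z_5+2z_1^2z_4$;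 $\mathbb{D}_8=-z_1^3+z_2z_6^2-z_2z_3z_5-3z_1z_3z_4+2z_3^2z_6$; $\mathbb{D}_9=2z_1^2z_3+z_3^2z_4-z_5^2z_6+z_2z_4z_6$; $\mathbb{D}_{10}=-z_1z_3^2+z_2z_4^2-2z_4z_5^2-z_1z_2z_6$; $\mathbb{D}_{11}=-z_3^3+z_1z_5^2-z_1z_2z_4-3z_2z_3z_6+2z_2^2z_5$; $\mathbb{D}_{12}=-z_1^2z_2+z_3z_5^2-2z_5z_6^2-z_2z_3z_4$; $\mathbb{D}_\infty=z_4z_5z_6$. Sextic forms: $\mathbb{G}_0=\mathbb{D}_0^2+\mathbb{D}_\infty^2$; $\mathbb{G}_1=-\mathbb{D}_7^2+2\mathbb{D}_0\mathbb{D}_1+10\mathbb{D}_\infty\mathbb{D}_1+2\mathbb{D}_2\mathbb{D}_{12}-2\mathbb{D}_3\mathbb{D}_{11}-4\mathbb{D}_4\mathbb{D}_{10}-2\mathbb{D}_9\mathbb{D}_5$; $\mathbb{G}_2=-2\mathbb{D}_1^2-4\mathbb{D}_0\mathbb{D}_2+6\mathbb{D}_\infty\mathbb{D}_2-2\mathbb{D}_4\mathbb{D}_{11}+2\mathbb{D}_5\mathbb{D}_{10}-2\mathbb{D}_6\mathbb{D}_9-2\mathbb{D}_7\mathbb{D}_8$; $\mathbb{G}_3=-\mathbb{D}_8^2+2\mathbb{D}_0\mathbb{D}_3+10\mathbb{D}_\infty\mathbb{D}_3+2\mathbb{D}_6\mathbb{D}_{10}-2\mathbb{D}_9\mathbb{D}_7-4\mathbb{D}_{12}\mathbb{D}_4-2\mathbb{D}_1\mathbb{D}_2$;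 $\mathbb{G}_4=-\mathbb{D}_2^2+10\mathbb{D}_0\mathbb{D}_4-2\mathbb{D}_\infty\mathbb{D}_4+2\mathbb{D}_5\mathbb{D}_{12}-2\mathbb{D}_9\mathbb{D}_8-4\mathbb{D}_1\mathbb{D}_3-2\mathbb{D}_{10}\mathbb{D}_7$; $\mathbb{G}_5=-2\mathbb{D}_9^2-4\mathbb{D}_0\mathbb{D}_5+6\mathbb{D}_\infty\mathbb{D}_5-2\mathbb{D}_{10}\mathbb{D}_8+2\mathbb{D}_6\mathbb{D}_{12}-2\mathbb{D}_2\mathbb{D}_3-2\mathbb{D}_{11}\mathbb{D}_7$; $\mathbb{G}_6=-2\mathbb{D}_3^2-4\mathbb{D}_0\mathbb{D}_6+6\mathbb{D}_\infty\mathbb{D}_6-2\mathbb{D}_{12}\mathbb{D}_7+2\mathbb{D}_2\mathbb{D}_4-2\mathbb{D}_5\mathbb{D}_1-2\mathbb{D}_8\mathbb{D}_{11}$; $\mathbb{G}_7=-2\mathbb{D}_{10}^2+6\mathbb{D}_0\mathbb{D}_7+4\mathbb{D}_\infty\mathbb{D}_7-2\mathbb{D}_1\mathbb{D}_6-2\mathbb{D}_2\mathbb{D}_5-2\mathbb{D}_8\mathbb{D}_{12}-2\mathbb{D}_9\mathbb{D}_{11}$; $\mathbb{G}_8=-2\mathbb{D}_4^2+6\mathbb{D}_0\mathbb{D}_8+4\mathbb{D}_\infty\mathbb{D}_8-2\mathbb{D}_3\mathbb{D}_5-2\mathbb{D}_6\mathbb{D}_2-2\mathbb{D}_{11}\mathbb{D}_{10}-2\mathbb{D}_1\mathbb{D}_7$;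 $\mathbb{G}_9=-\mathbb{D}_{11}^2+2\mathbb{D}_0\mathbb{D}_9+10\mathbb{D}_\infty\mathbb{D}_9+2\mathbb{D}_5\mathbb{D}_4-2\mathbb{D}_1\mathbb{D}_8-4\mathbb{D}_{10}\mathbb{D}_{12}-2\mathbb{D}_3\mathbb{D}_6$; $\mathbb{G}_{10}=-\mathbb{D}_5^2+10\mathbb{D}_0\mathbb{D}_{10}-2\mathbb{D}_\infty\mathbb{D}_{10}+2\mathbb{D}_6\mathbb{D}_4-2\mathbb{D}_3\mathbb{D}_7-4\mathbb{D}_9\mathbb{D}_1-2\mathbb{D}_{12}\mathbb{D}_{11}$; $\mathbb{G}_{11}=-2\mathbb{D}_{12}^2+6\mathbb{D}_0\mathbb{D}_{11}+4\mathbb{D}_\infty\mathbb{D}_{11}-2\mathbb{D}_9\mathbb{D}_2-2\mathbb{D}_5\mathbb{D}_6-2\mathbb{D}_7\mathbb{D}_4-2\mathbb{D}_3\mathbb{D}_8$; $\mathbb{G}_{12}=-\mathbb{D}_6^2+10\mathbb{D}_0\mathbb{D}_{12}-2\mathbb{D}_\infty\mathbb{D}_{12}+2\mathbb{D}_2\mathbb{D}_{10}-2\mathbb{D}_1\mathbb{D}_{11}-4\mathbb{D}_3\mathbb{D}_9-2\mathbb{D}_4\mathbb{D}_8$. Set $\delta_\infty=13^2\mathbb{G}_0$ and, for $\nu=0,\dots,12$, $\delta_\nu=-13\mathbb{G}_0+\sum_{k=1}^{12}\zeta^{k\nu}\mathbb{G}_k$. Define $\Phi_{12}=-\frac{1}{13\cdot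 52}\big(\sum_{\nu=0}^{12}\delta_\nu^2+\delta_\infty^2\big)$, $\Phi_{18}=\frac{1}{13\cdot 6}\big(\sum_{\nu=0}^{12}\delta_\nu^3+\delta_\infty^3\big)$, $\Phi_{20}=\frac{1}{13\cdot 25}\big(\sum_{\nu=0}^{12}w_\nu^5+w_\infty^5\big)$, $\Phi_{30}=-\frac{1}{13\cdot 1315}\big(\sum_{\nu=0}^{12}\delta_\nu^5+\delta_\infty^5\big)$. Modular functions: for $z\in\mathbb{H}=\{z:\mathrm{Im}\,z>0\}$ put $q=e^{2\pi iz}$ and $q^r=e^{2\pi i rz}$; $\eta(z)=q^{1/24}\prod_{n\ge1}(1-q^n)$ is the Dedekind eta function. The theta function with characteristic is $\theta\left[\begin{smallmatrix}\epsilon\\ \epsilon'\end{smallmatrix}\right](w,\tau)=\sum_{n\in\mathbb{Z}}\exp\{2\pi i[\frac12(n+\frac{\epsilon}{2})^2\tau+(n+\frac{\epsilon}{2})(w+\frac{\epsilon'}{2})]\}$. Define $a_1(z)=e^{-11\pi i/26}\theta\left[\begin{smallmatrix}11/13\\1\end{smallmatrix}\right](0,13z)$, $a_2(z)=e^{-7\pi i/26}\theta\left[\begin{smallmatrix}7/13\\1\end{smallmatrix}\right](0,13z)$, $a_3(z)=e^{-5\pi i/26}\theta\left[\begin{smallmatrix}5/13\\1\end{smallmatrix}\right](0,13z)$, $a_4(z)=-e^{-3\pi i/26}\theta\left[\begin{smallmatrix}3/13\\1\end{smallmatrix}\right](0,13z)$, $a_5(z)=e^{-9\pi i/26}\theta\left[\begin{smallmatrix}9/13\\1\end{smallmatrix}\right](0,13z)$,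 $a_6(z)=e^{-\pi i/26}\theta\left[\begin{smallmatrix}1/13\\1\end{smallmatrix}\right](0,13z)$; equivalently $a_1=q^{121/104}\sum_n(-1)^nq^{(13n^2+11n)/2}$, $a_2=q^{49/104}\sum_n(-1)^nq^{(13n^2+7n)/2}$, $a_3=q^{25/104}\sum_n(-1)^nq^{(13n^2+5n)/2}$, $a_4=-q^{9/104}\sum_n(-1)^nq^{(13n^2+3n)/2}$, $a_5=q^{81/104}\sum_n(-1)^nq^{(13n^2+9n)/2}$, $a_6=q^{1/104}\sum_n(-1)^nq^{(13n^2+n)/2}$. Finally $x_i(z)=\eta(z)a_i(z)$ for $1\le i\le 6$. *)

(* Defs.v *)
From HB Require Import structures.
From mathcomp Require Import all_boot all_order all_algebra.
From mathcomp Require Import all_classical all_reals all_analysis.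
From mathcomp Require Import complex.
(* The notations of mpoly are incompatible with those of MathComp-Analysis. *)
From mathcomp Require Import -(notations) mpoly.

Set Implicit Arguments.
Unset Strict Implicit.
Unset Printing Implicit Defensive.

Import Order.TTheory GRing.Theory Num.Theory.
Import numFieldNormedType.Exports.

Local Open Scope classical_set_scope.
Local Open Scope ring_scope.

(* The complex numbers, packed as a numClosedFieldType: this gives them the
   topology that MathComp-Analysis puts on every such field, which the bare type
   R[i] does not carry. *)
Definition Cx (R : realType) : numClosedFieldType := R[i].

Section Complex.
Variable R : realType.
Local Notation C := (Cx R).

Definition ofR (x : R) : C := x%:C%C.
Definition iC : C := 'i%C.

Definition cexp (z : C) : C :=
  ofR (expR (complex.Re z)) *
  (ofR (cos (complex.Im z)) + iC * ofR (sin (complex.Im z))).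

(* e^{2 pi i t}; thus q = e2pii z and q^r = e2pii (r z). *)
Definition e2pii (t : C) : C := cexp (2 * ofR pi * iC * t).

Definition zeta : C := e2pii 13^-1.

(* Sum over all integers, as the sum of the series over n >= 0 and of the series
   over n < 0; it is only used for absolutely convergent families. *)
Definition sumZ (f : int -> C) : C :=
  limn (series (fun n : nat => f n%:Z)) +
  limn (series (fun n : nat => f (- n.+1%:Z))).

End Complex.

Section Group.
Variable R : realType.
Local Notation C := (Cx R).
Local Notation zeta := (zeta R).

(* The pair (a, b) encodes the entry zeta^a - zeta^b. *)
Definition M_exponents : seq (seq (nat * nat)) :=
  [:: [:: (12, 1); (10, 3); (4, 9); (5, 8); (2, 11); (6, 7)];
      [:: (10, 3); (4, 9); (12, 1); (2, 11); (6, 7); (5, 8)];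
      [:: (4, 9); (12, 1); (10, 3); (6, 7); (5, 8); (2, 11)];
      [:: (5, 8); (2, 11); (6, 7); (1, 12); (3, 10); (9, 4)];
      [:: (2, 11); (6, 7); (5, 8); (3, 10); (9, 4); (1, 12)];
      [:: (6, 7); (5, 8); (2, 11); (9, 4); (1, 12); (3, 10)]]%N.

Definition Mmx : 'M[C]_6 :=
  \matrix_(i, j) let: (a, b) := nth (0, 0)%N (nth [::] M_exponents i) j in
                 zeta ^+ a - zeta ^+ b.

Definition Smx : 'M[C]_6 := - (ofR (Num.sqrt 13))^-1 *: Mmx.

Definition Tmx : 'M[C]_6 :=
  diag_mx (\row_j zeta ^+ nth 0%N [:: 7; 11; 8; 6; 2; 5]%N j).

(* The subgroup of GL(6, C) generated by S and T; both are invertible, so invmx is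
   a genuine inverse here. *)
Inductive inG : 'M[C]_6 -> Prop :=
| inG_S : inG Smx
| inG_T : inG Tmx
| inG_1 : inG 1%:M
| inG_mul g h : inG g -> inG h -> inG (g *m h)
| inG_inv g : inG g -> inG (invmx g).

End Group.

Section Forms.
Variable R : realType.
Local Notation C := (Cx R).
Local Notation zeta := (zeta R).

Definition poly6 := mpoly 6 C.

(* The value of p at the column vector v. *)
Definition peval (p : poly6) (v : 'cV[C]_6) : C :=
  meval (fun i => v i 0) p.

Definition Ginvariant (p : poly6) : Prop :=
  forall g, inG g -> forall v : 'cV[C]_6, peval p (g *m v) = peval p v.

Definition zvar (i : 'I_6) : poly6 := mpolyX C (mnm1 i).

Local Notation z1 := (zvar (inord 0)).
Local Notation z2 := (zvar (inord 1)).
Local Notation z3 := (zvar (inord 2)).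
Local Notation z4 := (zvar (inord 3)).
Local Notation z5 := (zvar (inord 4)).
Local Notation z6 := (zvar (inord 5)).

Definition formA0 : poly6 := z1 * z4 + z2 * z5 + z3 * z6.
Definition formA1 : poly6 := z1 ^+ 2 - 2 * z3 * z4.
Definition formA2 : poly6 := - z5 ^+ 2 - 2 * z2 * z4.
Definition formA3 : poly6 := z2 ^+ 2 - 2 * z1 * z5.
Definition formA4 : poly6 := z3 ^+ 2 - 2 * z2 * z6.
Definition formA5 : poly6 := - z4 ^+ 2 - 2 * z1 * z6.
Definition formA6 : poly6 := - z6 ^+ 2 - 2 * z3 * z5.

Definition formD0 : poly6 := z1 * z2 * z3.
Definition formD1 : poly6 :=
  2 * z2 * z3 ^+ 2 + z2 ^+ 2 * z6 - z4 ^+ 2 * z5 + z1 * z5 * z6.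
Definition formD2 : poly6 :=
  - z6 ^+ 3 + z2 ^+ 2 * z4 - 2 * z2 * z5 ^+ 2 + z1 * z4 * z5
  + 3 * z3 * z5 * z6.
Definition formD3 : poly6 :=
  2 * z1 * z2 ^+ 2 + z1 ^+ 2 * z5 - z4 * z6 ^+ 2 + z3 * z4 * z5.
Definition formD4 : poly6 :=
  - z2 ^+ 2 * z3 + z1 * z6 ^+ 2 - 2 * z4 ^+ 2 * z6 - z1 * z3 * z5.
Definition formD5 : poly6 :=
  - z4 ^+ 3 + z3 ^+ 2 * z5 - 2 * z3 * z6 ^+ 2 + z2 * z5 * z6
  + 3 * z1 * z4 * z6.
Definition formD6 : poly6 :=
  - z5 ^+ 3 + z1 ^+ 2 * z6 - 2 * z1 * z4 ^+ 2 + z3 * z4 * z6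
  + 3 * z2 * z4 * z5.
Definition formD7 : poly6 :=
  - z2 ^+ 3 + z3 * z4 ^+ 2 - z1 * z3 * z6 - 3 * z1 * z2 * z5
  + 2 * z1 ^+ 2 * z4.
Definition formD8 : poly6 :=
  - z1 ^+ 3 + z2 * z6 ^+ 2 - z2 * z3 * z5 - 3 * z1 * z3 * z4
  + 2 * z3 ^+ 2 * z6.
Definition formD9 : poly6 :=
  2 * z1 ^+ 2 * z3 + z3 ^+ 2 * z4 - z5 ^+ 2 * z6 + z2 * z4 * z6.
Definition formD10 : poly6 :=
  - z1 * z3 ^+ 2 + z2 * z4 ^+ 2 - 2 * z4 * z5 ^+ 2 - z1 * z2 * z6.
Definition formD11 : poly6 :=
  - z3 ^+ 3 + z1 * z5 ^+ 2 - z1 * z2 * z4 - 3 * z2 * z3 * z6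
  + 2 * z2 ^+ 2 * z5.
Definition formD12 : poly6 :=
  - z1 ^+ 2 * z2 + z3 * z5 ^+ 2 - 2 * z5 * z6 ^+ 2 - z2 * z3 * z4.
Definition formDinf : poly6 := z4 * z5 * z6.

Definition formG0 : poly6 := formD0 ^+ 2 + formDinf ^+ 2.
Definition formG1 : poly6 :=
  - formD7 ^+ 2 + 2 * formD0 * formD1 + 10 * formDinf * formD1
  + 2 * formD2 * formD12 - 2 * formD3 * formD11 - 4 * formD4 * formD10
  - 2 * formD9 * formD5.
Definition formG2 : poly6 :=
  - 2 * formD1 ^+ 2 - 4 * formD0 * formD2 + 6 * formDinf * formD2
  - 2 * formD4 * formD11 + 2 * formD5 * formD10 - 2 * formD6 * formD9
  - 2 * formD7 * formD8.
Definition formG3 : poly6 :=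
  - formD8 ^+ 2 + 2 * formD0 * formD3 + 10 * formDinf * formD3
  + 2 * formD6 * formD10 - 2 * formD9 * formD7 - 4 * formD12 * formD4
  - 2 * formD1 * formD2.
Definition formG4 : poly6 :=
  - formD2 ^+ 2 + 10 * formD0 * formD4 - 2 * formDinf * formD4
  + 2 * formD5 * formD12 - 2 * formD9 * formD8 - 4 * formD1 * formD3
  - 2 * formD10 * formD7.
Definition formG5 : poly6 :=
  - 2 * formD9 ^+ 2 - 4 * formD0 * formD5 + 6 * formDinf * formD5
  - 2 * formD10 * formD8 + 2 * formD6 * formD12 - 2 * formD2 * formD3
  - 2 * formD11 * formD7.
Definition formG6 : poly6 :=
  - 2 * formD3 ^+ 2 - 4 * formD0 * formD6 + 6 * formDinf * formD6
  - 2 * formD12 * formD7 + 2 * formD2 * formD4 - 2 * formD5 * formD1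
  - 2 * formD8 * formD11.
Definition formG7 : poly6 :=
  - 2 * formD10 ^+ 2 + 6 * formD0 * formD7 + 4 * formDinf * formD7
  - 2 * formD1 * formD6 - 2 * formD2 * formD5 - 2 * formD8 * formD12
  - 2 * formD9 * formD11.
Definition formG8 : poly6 :=
  - 2 * formD4 ^+ 2 + 6 * formD0 * formD8 + 4 * formDinf * formD8
  - 2 * formD3 * formD5 - 2 * formD6 * formD2 - 2 * formD11 * formD10
  - 2 * formD1 * formD7.
Definition formG9 : poly6 :=
  - formD11 ^+ 2 + 2 * formD0 * formD9 + 10 * formDinf * formD9
  + 2 * formD5 * formD4 - 2 * formD1 * formD8 - 4 * formD10 * formD12
  - 2 * formD3 * formD6.
Definition formG10 : poly6 :=
  - formD5 ^+ 2 + 10 * formD0 * formD10 - 2 * formDinf * formD10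
  + 2 * formD6 * formD4 - 2 * formD3 * formD7 - 4 * formD9 * formD1
  - 2 * formD12 * formD11.
Definition formG11 : poly6 :=
  - 2 * formD12 ^+ 2 + 6 * formD0 * formD11 + 4 * formDinf * formD11
  - 2 * formD9 * formD2 - 2 * formD5 * formD6 - 2 * formD7 * formD4
  - 2 * formD3 * formD8.
Definition formG12 : poly6 :=
  - formD6 ^+ 2 + 10 * formD0 * formD12 - 2 * formDinf * formD12
  + 2 * formD2 * formD10 - 2 * formD1 * formD11 - 4 * formD3 * formD9
  - 2 * formD4 * formD8.

Definition formG (k : nat) : poly6 :=
  nth 0 [:: formG0; formG1; formG2; formG3; formG4; formG5; formG6; formG7;
            formG8; formG9; formG10; formG11; formG12] k.

Definition w_inf : poly6 := 13 * formA0 ^+ 2.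

Definition w (nu : nat) : poly6 :=
  (formA0 + zeta ^+ nu *: formA1 + zeta ^+ (4 * nu) *: formA2
   + zeta ^+ (9 * nu) *: formA3 + zeta ^+ (3 * nu) *: formA4
   + zeta ^+ (12 * nu) *: formA5 + zeta ^+ (10 * nu) *: formA6) ^+ 2.

Definition delta_inf : poly6 := 13 ^+ 2 * formG0.

Definition delta (nu : nat) : poly6 :=
  - 13 * formG0 + \sum_(1 <= k < 13) zeta ^+ (k * nu) *: formG k.

Definition Phi12 : poly6 :=
  - (13 * 52)^-1 *: (\sum_(nu < 13) delta nu ^+ 2 + delta_inf ^+ 2).

Definition Phi18 : poly6 :=
  (13 * 6)^-1 *: (\sum_(nu < 13) delta nu ^+ 3 + delta_inf ^+ 3).

Definition Phi20 : poly6 :=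
  (13 * 25)^-1 *: (\sum_(nu < 13) w nu ^+ 5 + w_inf ^+ 5).

Definition Phi30 : poly6 :=
  - (13 * 1315)^-1 *: (\sum_(nu < 13) delta nu ^+ 5 + delta_inf ^+ 5).

End Forms.

Section ModularFunctions.
Variable R : realType.
Local Notation C := (Cx R).

Definition upper_half_plane : set C := [set z | 0 < complex.Im z].

Definition eta (z : C) : C :=
  e2pii (24^-1 * z) *
  limn (fun N => \prod_(1 <= n < N.+1) (1 - e2pii z ^+ n)).

Definition theta (eps eps' : R) (u tau : C) : C :=
  sumZ (fun n : int =>
    e2pii (2^-1 * (n%:~R + ofR eps / 2) ^+ 2 * tau +
           (n%:~R + ofR eps / 2) * (u + ofR eps' / 2))).

(* e^{- c pi i / 26} theta[c/13, 1](0, 13 z) *)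
Definition theta13 (c : R) (z : C) : C :=
  cexp (- ofR (c * pi / 26) * iC R) * theta (c / 13) 1 0 (13 * z).

Definition a1 (z : C) : C := theta13 11 z.
Definition a2 (z : C) : C := theta13 7 z.
Definition a3 (z : C) : C := theta13 5 z.
Definition a4 (z : C) : C := - theta13 3 z.
Definition a5 (z : C) : C := theta13 9 z.
Definition a6 (z : C) : C := theta13 1 z.

(* The column vector (x_1(z), ..., x_6(z)), where x_i = eta a_i. *)
Definition xvec (z : C) : 'cV[C]_6 :=
  \col_i (eta z * nth 0 [:: a1 z; a2 z; a3 z; a4 z; a5 z; a6 z] i).

End ModularFunctions.

(* Main.v *)
(* Up to sign the a_i are theta series e_r, r = 1..6, odd in r and with
   e_(13-r) = e_r. Rotating the lattice of summation of a product of two of them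
   shows that e_(i+j) e_(i-j) = O_i E_j - O_j E_i for other theta series O and E,
   so the e_r satisfy the Plücker relations, which define the modular curve X(13)
   (as an elliptic divisibility sequence of period 13). When no e_r vanishes, these
   relations express the e_r, up to a factor, by s = e_4/e_1, h and x, where s^13 is
   a unit of Z[h, 1/h, x] and x is cubic over Q(h), the function field of an
   intermediate curve of X_1(13) -> X_0(13). There the identities become
     A_0^3 = P (t^2 + 5t + 13), G_0^2 = P^2 (t^2 + 6t + 13),
     Phi_12 = P^2 t^5, Phi_18 = P^2 G_0 t E, Phi_20 = A_0 P^3 t^4 F,
     Phi_30 = P^4 G_0 t^6 E, with P = e_1 ... e_6 and t the Hauptmodul of X_0(13),
   E and F being the factors of E_6 and E_4 in Klein's formula for j; they are
   checked by computation. When some e_r vanishes, at most one does not, and the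
   point is fixed by T up to a factor, hence annihilates all four forms.
   The forms are power sums over the 14 cosets of the normalizer of <T>, which S
   permutes by the Bruhat relations M T^nu M = g T^c H T^c. *)

(* The obstacle is size: $\Phi_{30}$ has degree 30 in six variables and is never expanded. For the
   invariance no polynomial in $z_1,\dots,z_6$ of degree above 6 is computed. On the curve,
   $\delta_\nu$ is $\delta_0$ composed with $T^\nu$, so summing over $\nu$ is projecting to the part
   of $T$-weight 0: $\zeta$ drops out, and the computation takes place in $\mathbb Z[h,1/h,x]$ with
   $h$ and $x$ invariant under $T$. No $q$-expansion, valence formula or nonvanishing of theta
   constants enters. The only analytic inputs are absolute convergence and the product formula;
   everything else holds at each point subject to the three-term relations. The factor $\eta$ is
   harmless because both identities are homogeneous of degree 60. The finite verifications run in
   concrete data structures for rings. Their evaluations into the target field are proved to be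
   morphisms, so a verification at a generic point transfers to every point. *)
Require Import Defs.
From HB Require Import structures.
From Stdlib Require BinInt.
From mathcomp Require Import all_boot all_order all_algebra.
From mathcomp Require Import all_classical all_reals all_analysis.
From mathcomp Require Import complex.
From mathcomp Require Import -(notations) mpoly.
From mathcomp Require Import ssrZ zify ring lra.

Set Implicit Arguments.
Unset Strict Implicit.
Unset Printing Implicit Defensive.

Import Order.TTheory GRing.Theory Num.Theory.
Import numFieldNormedType.Exports.

Local Open Scope ring_scope.

(** * Computing in finitely presented rings *)

(* A ring given by its operations only. [req] need only be sound, and nothing
   is assumed of the operations: all that is used of such a ring is that some
   evaluation of it into a genuine ring is a morphism, see [evaluation]. *)
Record rops := ROps {
  rT :> Type; r0 : rT; r1 : rT; radd : rT -> rT -> rT;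
  rmul : rT -> rT -> rT; ropp : rT -> rT; req : rT -> rT -> bool }.

Record evaluation (A : rops) (F : comNzRingType) (f : A -> F) : Prop := Evaluation {
  eval0 : f (r0 A) = 0;
  eval1 : f (r1 A) = 1;
  evalD : forall a b, f (radd a b) = f a + f b;
  evalM : forall a b, f (rmul a b) = f a * f b;
  evalN : forall a, f (ropp a) = - f a;
  evalE : forall a b, req a b -> f a = f b }.

Definition rsub (A : rops) (a b : A) : A := radd a (ropp b).

Fixpoint rpow (A : rops) (a : A) n : A :=
  if n is n'.+1 then if n' is 0%N then a else rmul a (rpow a n') else r1 A.

Lemma evalB (A : rops) (F : comNzRingType) (f : A -> F) (hf : evaluation f) a b :
  f (rsub a b) = f a - f b.
Proof. by rewrite evalD // evalN. Qed.

Lemma evalX (A : rops) (F : comNzRingType) (f : A -> F) (hf : evaluation f) a n :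
  f (rpow a n) = f a ^+ n.
Proof.
elim: n => [|[|n] IHn]; rewrite ?eval1 ?expr1 //=.
by rewrite evalM // IHn -exprS.
Qed.

Lemma eval_eq0 (A : rops) (F : comNzRingType) (f : A -> F) (hf : evaluation f) a :
  req a (r0 A) -> f a = 0.
Proof. by move/(evalE hf) ->; rewrite eval0. Qed.

(** The forms are kept as syntax because each of them is read in several rings: polynomials over the
    complex numbers, values in a field, the generic point and the twisted algebra. *)
Inductive expr := EVar of nat | ENat of nat | EAdd of expr & expr
  | EMul of expr & expr | EOpp of expr | EPow of expr & nat.

Fixpoint eeval (F : nzRingType) (env : seq F) (e : expr) : F :=
  match e with
  | EVar n => env`_n
  | ENat n => n%:R
  | EAdd a b => eeval env a + eeval env b
  | EMul a b => eeval env a * eeval env b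
  | EOpp a => - eeval env a
  | EPow a n => eeval env a ^+ n
  end.

Fixpoint reval (A : rops) (env : seq A) (e : expr) : A :=
  match e with
  | EVar n => nth (r0 A) env n
  | ENat n => iter n (radd (r1 A)) (r0 A)
  | EAdd a b => radd (reval env a) (reval env b)
  | EMul a b => rmul (reval env a) (reval env b)
  | EOpp a => ropp (reval env a)
  | EPow a n => rpow (reval env a) n
  end.

Lemma reval_sound (A : rops) (F : comNzRingType) (f : A -> F) (hf : evaluation f)
    env e :
  f (reval env e) = eeval [seq f a | a <- env] e.
Proof.
elim: e => [n|n|a IHa b IHb|a IHa b IHb|a IHa|a IHa n] /=.
- have [lt_n|ge_n] := ltnP n (size env); first by rewrite (nth_map (r0 A)).
  by rewrite !nth_default ?size_map // eval0.
- by elim: n => [|n IHn]; rewrite ?eval0 //= evalD // eval1 // IHn -natr1 addrC.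
- by rewrite evalD // IHa IHb.
- by rewrite evalM // IHa IHb.
- by rewrite evalN // IHa.
- by rewrite evalX // IHa.
Qed.

Lemma eeval_morph (F F' : nzRingType) (f : {rmorphism F -> F'}) env e :
  f (eeval env e) = eeval [seq f a | a <- env] e.
Proof.
elim: e => [n|n|a IHa b IHb|a IHa b IHb|a IHa|a IHa n] /=.
- have [lt_n|ge_n] := ltnP n (size env); first by rewrite (nth_map 0).
  by rewrite !nth_default ?size_map // rmorph0.
- by rewrite rmorph_nat.
- by rewrite rmorphD IHa IHb.
- by rewrite rmorphM IHa IHb.
- by rewrite rmorphN IHa.
- by rewrite rmorphXn IHa.
Qed.

Definition Zops := ROps BinInt.Z0 (BinInt.Zpos BinNums.xH)
  BinInt.Z.add BinInt.Z.mul BinInt.Z.opp BinInt.Z.eqb.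

Definition Zeval (F : comNzRingType) (z : Zops) : F := (int_of_Z z)%:~R.

Lemma Zeval_evaluation (F : comNzRingType) : evaluation (@Zeval F).
Proof.
split=> // [a b|a b|a|a b /BinInt.Z.eqb_eq -> //]; rewrite /Zeval.
- by rewrite (rmorphD int_of_Z) rmorphD.
- by rewrite (rmorphM int_of_Z) rmorphM.
- by rewrite (rmorphN int_of_Z) rmorphN.
Qed.

Section Poly.
Variable A : rops.

Fixpoint padd (p q : seq A) : seq A :=
  match p, q with
  | [::], _ => q
  | _, [::] => p
  | a :: p', b :: q' => radd a b :: padd p' q'
  end.

Definition pscale (a : A) (q : seq A) := [seq rmul a b | b <- q].

Fixpoint pmul (p q : seq A) : seq A :=
  if p is a :: p' then
    if req a (r0 A) then r0 A :: pmul p' q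
    else padd (pscale a q) (r0 A :: pmul p' q)
  else [::].

Definition popp (p : seq A) := [seq ropp b | b <- p].

Definition pzero (p : seq A) := all (fun a => req a (r0 A)) p.

Definition polyops := ROps [::] [:: r1 A] padd pmul popp
  (fun p q => pzero (padd p (popp q))).

Variables (F : comNzRingType) (f : A -> F) (hf : evaluation f) (y : F).

Definition peval_at (p : seq A) : F := foldr (fun a acc => f a + y * acc) 0 p.

Lemma pevalD p q : peval_at (padd p q) = peval_at p + peval_at q.
Proof.
elim: p q => [|a p IHp] [|b q] /=; rewrite ?add0r ?addr0 //.
by rewrite evalD // IHp mulrDr addrACA.
Qed.

Lemma pevalZ a q : peval_at (pscale a q) = f a * peval_at q.
Proof.
elim: q => [|b q IHq] /=; first by rewrite mulr0.
by rewrite evalM // IHq mulrDr !(mulrCA y).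
Qed.

Lemma pevalM p q : peval_at (pmul p q) = peval_at p * peval_at q.
Proof.
elim: p => [|a p IHp] /=; first by rewrite mul0r.
rewrite mulrDl; case: ifP => [/(eval_eq0 hf) -> | _] /=.
  by rewrite eval0 // IHp mul0r mulrA.
by rewrite pevalD pevalZ /= eval0 // add0r IHp mulrA.
Qed.

Lemma pevalN p : peval_at (popp p) = - peval_at p.
Proof.
elim: p => [|a p IHp] /=; first by rewrite oppr0.
by rewrite evalN // IHp mulrN -opprD.
Qed.

Lemma pzeroP p : pzero p -> peval_at p = 0.
Proof.
elim: p => [|a p IHp] //= /andP[/(eval_eq0 hf) -> /IHp ->].
by rewrite mulr0 addr0.
Qed.

Lemma poly_evaluation : @evaluation polyops F peval_at.
Proof.
split=> // [|||p|p q /pzeroP]; rewrite /= ?eval1 ?mulr0 ?addr0 //.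
- exact: pevalD.
- exact: pevalM.
- exact: pevalN.
- by rewrite pevalD pevalN => /eqP; rewrite subr_eq0 => /eqP.
Qed.

Lemma peval_cat p q :
  peval_at (p ++ q) = peval_at p + y ^+ size p * peval_at q.
Proof.
elim: p => [|a p IHp] /=; first by rewrite add0r mul1r.
by rewrite IHp mulrDr addrA exprS mulrA.
Qed.

Lemma peval_shift n p : peval_at (ncons n (r0 A) p) = y ^+ n * peval_at p.
Proof.
elim: n => [|n IHn] /=; first by rewrite mul1r.
by rewrite eval0 // add0r IHn exprS mulrA.
Qed.

End Poly.

(* The pair [(n, p)] stands for [p(y) / y^n]. *)
Section Laurent.
Variable A : rops.

Definition rtrim (p : seq A) : seq A := foldr (fun a r =>
  if r is [::] then if req a (r0 A) then [::] else [:: a] else a :: r) [::] p.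

Fixpoint ltrim n (p : seq A) : nat * seq A :=
  match n, p with
  | n'.+1, a :: p' => if req a (r0 A) then ltrim n' p' else (n, p)
  | _, [::] => (0%N, [::])
  | _, _ => (n, p)
  end.

Definition ladd (p q : nat * seq A) :=
  if (p.1 <= q.1)%N then (q.1, padd (ncons (q.1 - p.1) (r0 A) p.2) q.2)
  else (p.1, padd p.2 (ncons (p.1 - q.1) (r0 A) q.2)).
Definition lmul (p q : nat * seq A) := ltrim (p.1 + q.1) (rtrim (pmul p.2 q.2)).
Definition lopp (p : nat * seq A) := (p.1, popp p.2).
Definition laurentops := @ROps (nat * seq A) (0%N, [::]) (0%N, [:: r1 A])
  ladd lmul lopp (fun p q => pzero (ladd p (lopp q)).2).

Variables (F : fieldType) (f : A -> F) (hf : evaluation f) (y : F) (y0 : y != 0).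

Definition leval (p : nat * seq A) : F := peval_at f y p.2 / y ^+ p.1.

Lemma rtrimE p : peval_at f y (rtrim p) = peval_at f y p.
Proof.
elim: p => //= a p <-; case: (rtrim p) => //=.
by case: ifP => //= /(eval_eq0 hf) ->; rewrite mulr0 addr0.
Qed.

Lemma ltrimE n p : leval (ltrim n p) = leval (n, p).
Proof.
elim: n p => [|n IHn] [|a p] //=; rewrite /leval ?mul0r //=.
case: ifP => //= /(eval_eq0 hf) ->; rewrite -/(leval _) IHn /leval /= add0r.
by rewrite exprS invfM mulrACA mulfV // mul1r.
Qed.

Lemma leval_shift n m p : (n <= m)%N ->
  peval_at f y (ncons (m - n) (r0 A) p) / y ^+ m = leval (n, p).
Proof.
move=> le_nm; rewrite peval_shift // /leval /= -{2}(subnK le_nm) exprD invfM.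
by rewrite mulrACA mulfV ?expf_neq0 // mul1r.
Qed.

Lemma levalD p q : leval (ladd p q) = leval p + leval q.
Proof.
case: p q => n p [m q]; rewrite /ladd /=; case: leqP => [le_nm|/ltnW le_mn].
  by rewrite {1}/leval /= pevalD // mulrDl leval_shift.
by rewrite {1}/leval /= pevalD // mulrDl leval_shift.
Qed.

Lemma levalN p : leval (lopp p) = - leval p.
Proof. by rewrite /leval pevalN // mulNr. Qed.

Lemma laurent_evaluation : @evaluation laurentops F leval.
Proof.
split=> [||p q|p q|p|p q /= eq_pq].
- by rewrite /leval /= mul0r.
- by rewrite /leval /= eval1 // mulr0 addr0 divr1.
- exact: levalD.
- rewrite /= ltrimE /leval /= rtrimE pevalM // exprD invfM.
  by rewrite mulrACA.
- exact: levalN.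
- apply/eqP; rewrite -subr_eq0 -levalN -levalD.
  by rewrite /leval (pzeroP hf y eq_pq) mul0r.
Qed.

End Laurent.

(* Polynomials in [y] modulo [y^3 = b y^2 + c y + d]. *)
Section Cubic.
Variables (A : rops) (b c d : A).

Definition cadd (p q : A * A * A) :=
  let: (p0, p1, p2) := p in let: (q0, q1, q2) := q in
  (radd p0 q0, radd p1 q1, radd p2 q2).
Definition cmul (p q : A * A * A) :=
  let: (p0, p1, p2) := p in let: (q0, q1, q2) := q in
  let t4 := rmul p2 q2 in
  let t3 := radd (radd (rmul p1 q2) (rmul p2 q1)) (rmul b t4) in
  (radd (rmul p0 q0) (rmul d t3),
   radd (radd (rmul p0 q1) (rmul p1 q0)) (radd (rmul d t4) (rmul c t3)),
   radd (radd (rmul p0 q2) (rmul p2 q0))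
     (radd (rmul p1 q1) (radd (rmul c t4) (rmul b t3)))).
Definition copp (p : A * A * A) :=
  let: (p0, p1, p2) := p in (ropp p0, ropp p1, ropp p2).
Definition ceq (p q : A * A * A) :=
  let: (p0, p1, p2) := p in let: (q0, q1, q2) := q in
  [&& req p0 q0, req p1 q1 & req p2 q2].
Definition cubicops := @ROps (A * A * A) (r0 A, r0 A, r0 A) (r1 A, r0 A, r0 A)
  cadd cmul copp ceq.

Variables (F : comNzRingType) (f : A -> F) (hf : evaluation f) (y : F).
Hypothesis hy : y ^+ 3 = f b * y ^+ 2 + f c * y + f d.

Definition ceval (p : A * A * A) : F :=
  let: (p0, p1, p2) := p in f p0 + f p1 * y + f p2 * y ^+ 2.

Lemma cubic_evaluation : @evaluation cubicops F ceval.
Proof.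
split=> [||[[p0 p1] p2] [[q0 q1] q2]|[[p0 p1] p2] [[q0 q1] q2]|[[p0 p1] p2]|
  [[p0 p1] p2] [[q0 q1] q2] /= /and3P[e0 e1 e2]] /=.
- by rewrite eval0 // !mul0r !addr0.
- by rewrite eval0 // eval1 // !mul0r !addr0.
- by rewrite !evalD //; ring.
- rewrite !(evalD hf, evalM hf).
  have hy4 : y ^+ 4 = f b * y ^+ 3 + f c * y ^+ 2 + f d * y.
    by rewrite exprS [in LHS]hy; ring.
  transitivity (f p0 * f q0 + (f p0 * f q1 + f p1 * f q0) * y
    + (f p0 * f q2 + f p2 * f q0 + f p1 * f q1) * y ^+ 2
    + (f p1 * f q2 + f p2 * f q1) * y ^+ 3 + f p2 * f q2 * y ^+ 4); last by ring.
  by rewrite hy4 hy; ring.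
- by rewrite !evalN //; ring.
- by rewrite (evalE hf e0) (evalE hf e1) (evalE hf e2).
Qed.

End Cubic.

(* The coordinate ring of the [n]-th roots of unity; the quotient by the sum of
   the powers of [y] is only taken in the equality test. *)
Section Cyclic.
Variables (A : rops) (n : nat).

(** One folding by $y^n=1$ is sound for lists of any length, and fully reduces a product of two
    lists of length at most [n]. *)
Definition ymul (p q : seq A) :=
  let r := pmul p q in padd (take n r) (drop n r).
(** A difference whose [n] coefficients all agree is a multiple of $1+y+\dots+y^{n-1}$. Adding [n]
    zeros pads it to length [n]. *)
Definition yeq (p q : seq A) :=
  let r := padd (padd p (popp q)) (nseq n (r0 A)) in
  (size r == n) && all (fun a => req a (head (r0 A) r)) r.
Definition cyclicops := ROps [::] [:: r1 A] (@padd A) ymul (@popp A) yeq.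

Variables (F : comNzRingType) (f : A -> F) (hf : evaluation f) (y : F).
Hypotheses (hyn : y ^+ n = 1) (hy : \sum_(i < n) y ^+ i = 0).

Lemma cyclic_evaluation : @evaluation cyclicops F (peval_at f y).
Proof.
split=> // [||p q|p|p q /andP[/eqP size_r eq_r]].
- by rewrite /= eval1 // mulr0 addr0.
- exact: pevalD.
- rewrite /= /ymul pevalD // -pevalM //; set r := pmul p q.
  have [le_rn|lt_nr] := leqP (size r) n.
    by rewrite take_oversize // drop_oversize // addr0.
  by rewrite -{3}(cat_take_drop n r) peval_cat size_takel ?hyn ?mul1r // ltnW.
- exact: pevalN.
apply/eqP; rewrite -subr_eq0 -pevalN // -pevalD //; apply/eqP.
move: size_r eq_r; set r' := padd p (popp q); set r := padd r' _ => size_r eq_r.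
have -> : peval_at f y r' = peval_at f y r.
  have e0 : peval_at f y (nseq n (r0 A)) = 0.
    by move: (peval_shift hf y n [::]); rewrite mulr0.
  by rewrite [RHS]pevalD // e0 addr0.
move: (head _ _) eq_r => a0 eq_r.
have -> : peval_at f y r = f a0 * \sum_(i < n) y ^+ i; last by rewrite hy mulr0.
rewrite -size_r; elim: r eq_r {size_r} => [|a r IHr] /=.
  by rewrite big_ord0 mulr0.
case/andP=> /(evalE hf) -> /IHr ->; rewrite big_ord_recl expr0 mulrDr mulr1.
by congr (_ + _); rewrite mulrCA mulr_sumr; under eq_bigr do rewrite -exprS.
Qed.

End Cyclic.

(** * The forms and the action of the group *)

Declare Scope expr_scope.
Delimit Scope expr_scope with X.
Bind Scope expr_scope with expr.
Definition expr_of_int (u : Number.int) : option expr :=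
  match u with
  | Number.IntDecimal (Decimal.Pos d) => Some (ENat (Nat.of_uint d))
  | Number.IntDecimal (Decimal.Neg d) => Some (EOpp (ENat (Nat.of_uint d)))
  | _ => None
  end.
Definition expr_to_int (e : expr) : option Number.int :=
  match e with
  | ENat n => Some (Number.IntDecimal (Decimal.Pos (Nat.to_uint n)))
  | EOpp (ENat n) => Some (Number.IntDecimal (Decimal.Neg (Nat.to_uint n)))
  | _ => None
  end.
Number Notation expr expr_of_int expr_to_int : expr_scope.
Notation "a + b" := (EAdd a b) : expr_scope.
Notation "a * b" := (EMul a b) : expr_scope.
Notation "- a" := (EOpp a) : expr_scope.
Notation "a - b" := (EAdd a (EOpp b)) : expr_scope.
Notation "a ^+ n" := (EPow a n) : expr_scope.

Section Forms.

(* Variable [0] is [zeta] and variable [i] is [z_i]. *)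
Local Notation zx := (EVar 0).
Local Notation z1 := (EVar 1).
Local Notation z2 := (EVar 2).
Local Notation z3 := (EVar 3).
Local Notation z4 := (EVar 4).
Local Notation z5 := (EVar 5).
Local Notation z6 := (EVar 6).
Definition Aforms : seq expr := [::
      z1 * z4 + z2 * z5 + z3 * z6;
      z1 ^+ 2 - 2 * z3 * z4;
      - z5 ^+ 2 - 2 * z2 * z4;
      z2 ^+ 2 - 2 * z1 * z5;
      z3 ^+ 2 - 2 * z2 * z6;
      - z4 ^+ 2 - 2 * z1 * z6;
      - z6 ^+ 2 - 2 * z3 * z5]%X.
Definition Dforms : seq expr := [::
      z1 * z2 * z3;
      2 * z2 * z3 ^+ 2 + z2 ^+ 2 * z6 - z4 ^+ 2 * z5 + z1 * z5 * z6;
      - z6 ^+ 3 + z2 ^+ 2 * z4 - 2 * z2 * z5 ^+ 2 + z1 * z4 * z5 + 3 * z3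
        * z5 * z6;
      2 * z1 * z2 ^+ 2 + z1 ^+ 2 * z5 - z4 * z6 ^+ 2 + z3 * z4 * z5;
      - z2 ^+ 2 * z3 + z1 * z6 ^+ 2 - 2 * z4 ^+ 2 * z6 - z1 * z3 * z5;
      - z4 ^+ 3 + z3 ^+ 2 * z5 - 2 * z3 * z6 ^+ 2 + z2 * z5 * z6 + 3 * z1
        * z4 * z6;
      - z5 ^+ 3 + z1 ^+ 2 * z6 - 2 * z1 * z4 ^+ 2 + z3 * z4 * z6 + 3 * z2
        * z4 * z5;
      - z2 ^+ 3 + z3 * z4 ^+ 2 - z1 * z3 * z6 - 3 * z1 * z2 * z5 + 2 * z1
        ^+ 2 * z4;
      - z1 ^+ 3 + z2 * z6 ^+ 2 - z2 * z3 * z5 - 3 * z1 * z3 * z4 + 2 * z3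
        ^+ 2 * z6;
      2 * z1 ^+ 2 * z3 + z3 ^+ 2 * z4 - z5 ^+ 2 * z6 + z2 * z4 * z6;
      - z1 * z3 ^+ 2 + z2 * z4 ^+ 2 - 2 * z4 * z5 ^+ 2 - z1 * z2 * z6;
      - z3 ^+ 3 + z1 * z5 ^+ 2 - z1 * z2 * z4 - 3 * z2 * z3 * z6 + 2 * z2
        ^+ 2 * z5;
      - z1 ^+ 2 * z2 + z3 * z5 ^+ 2 - 2 * z5 * z6 ^+ 2 - z2 * z3 * z4;
      z4 * z5 * z6]%X.

(* Variable [k] is [D_k], with [13] for infinity. *)
Local Notation d0 := (EVar 0).
Local Notation d1 := (EVar 1).
Local Notation d2 := (EVar 2).
Local Notation d3 := (EVar 3).
Local Notation d4 := (EVar 4).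
Local Notation d5 := (EVar 5).
Local Notation d6 := (EVar 6).
Local Notation d7 := (EVar 7).
Local Notation d8 := (EVar 8).
Local Notation d9 := (EVar 9).
Local Notation d10 := (EVar 10).
Local Notation d11 := (EVar 11).
Local Notation d12 := (EVar 12).
Local Notation dinf := (EVar 13).
Definition Gforms : seq expr := [::
      d0 ^+ 2 + dinf ^+ 2;
      - d7 ^+ 2 + 2 * d0 * d1 + 10 * dinf * d1 + 2 * d2 * d12 - 2 * d3 *
        d11 - 4 * d4 * d10 - 2 * d9 * d5;
      - 2 * d1 ^+ 2 - 4 * d0 * d2 + 6 * dinf * d2 - 2 * d4 * d11 + 2 * d5
        * d10 - 2 * d6 * d9 - 2 * d7 * d8;
      - d8 ^+ 2 + 2 * d0 * d3 + 10 * dinf * d3 + 2 * d6 * d10 - 2 * d9 *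
        d7 - 4 * d12 * d4 - 2 * d1 * d2;
      - d2 ^+ 2 + 10 * d0 * d4 - 2 * dinf * d4 + 2 * d5 * d12 - 2 * d9 *
        d8 - 4 * d1 * d3 - 2 * d10 * d7;
      - 2 * d9 ^+ 2 - 4 * d0 * d5 + 6 * dinf * d5 - 2 * d10 * d8 + 2 * d6
        * d12 - 2 * d2 * d3 - 2 * d11 * d7;
      - 2 * d3 ^+ 2 - 4 * d0 * d6 + 6 * dinf * d6 - 2 * d12 * d7 + 2 * d2
        * d4 - 2 * d5 * d1 - 2 * d8 * d11;
      - 2 * d10 ^+ 2 + 6 * d0 * d7 + 4 * dinf * d7 - 2 * d1 * d6 - 2 * d2
        * d5 - 2 * d8 * d12 - 2 * d9 * d11;
      - 2 * d4 ^+ 2 + 6 * d0 * d8 + 4 * dinf * d8 - 2 * d3 * d5 - 2 * d6 *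
        d2 - 2 * d11 * d10 - 2 * d1 * d7;
      - d11 ^+ 2 + 2 * d0 * d9 + 10 * dinf * d9 + 2 * d5 * d4 - 2 * d1 *
        d8 - 4 * d10 * d12 - 2 * d3 * d6;
      - d5 ^+ 2 + 10 * d0 * d10 - 2 * dinf * d10 + 2 * d6 * d4 - 2 * d3 *
        d7 - 4 * d9 * d1 - 2 * d12 * d11;
      - 2 * d12 ^+ 2 + 6 * d0 * d11 + 4 * dinf * d11 - 2 * d9 * d2 - 2 *
        d5 * d6 - 2 * d7 * d4 - 2 * d3 * d8;
      - d6 ^+ 2 + 10 * d0 * d12 - 2 * dinf * d12 + 2 * d2 * d10 - 2 * d1 *
        d11 - 4 * d3 * d9 - 2 * d4 * d8]%X.

Definition Mentries : seq (seq (nat * nat)) :=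
  [:: [:: (12, 1); (10, 3); (4, 9); (5, 8); (2, 11); (6, 7)];
      [:: (10, 3); (4, 9); (12, 1); (2, 11); (6, 7); (5, 8)];
      [:: (4, 9); (12, 1); (10, 3); (6, 7); (5, 8); (2, 11)];
      [:: (5, 8); (2, 11); (6, 7); (1, 12); (3, 10); (9, 4)];
      [:: (2, 11); (6, 7); (5, 8); (3, 10); (9, 4); (1, 12)];
      [:: (6, 7); (5, 8); (2, 11); (9, 4); (1, 12); (3, 10)]]%N.

Definition Mex : seq expr := [seq foldr (fun je acc =>
  (zx ^+ je.2.1 - zx ^+ je.2.2) * EVar je.1 + acc)%X (ENat 0) (zip (iota 1 6) r)
  | r <- Mentries].

Definition Tweights := [:: 7; 11; 8; 6; 2; 5]%N.
Definition Tex (nu : nat) : seq expr :=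
  [seq (zx ^+ (nu * iw.2 %% 13) * EVar iw.1)%X | iw <- zip (iota 1 6) Tweights].

(* The normalizer of [<T>] acts by signed permutations: up to sign these are the
   powers of an element of order 6, listed here by the residue [nu] for which
   they occur in [M T^nu M = g T^c H_nu M T^c], [c = - 1 / nu], [g] being the
   Gauss sum. *)
Definition Hperm (nu : nat) : seq (nat * bool) := nth [::] [:: [::];
  [:: (1, true); (2, true); (3, true); (4, true); (5, true); (6, true)];
  [:: (6, false); (4, false); (5, false); (3, true); (1, true); (2, true)];
  [:: (3, true); (1, true); (2, true); (6, true); (4, true); (5, true)];
  [:: (2, false); (3, false); (1, false); (5, false); (6, false); (4, false)];
  [:: (4, false); (5, false); (6, false); (1, true); (2, true); (3, true)];
  [:: (5, false); (6, false); (4, false); (2, true); (3, true); (1, true)];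
  [:: (5, true); (6, true); (4, true); (2, false); (3, false); (1, false)];
  [:: (4, true); (5, true); (6, true); (1, false); (2, false); (3, false)];
  [:: (2, true); (3, true); (1, true); (5, true); (6, true); (4, true)];
  [:: (3, false); (1, false); (2, false); (6, false); (4, false); (5, false)];
  [:: (6, true); (4, true); (5, true); (3, false); (1, false); (2, false)];
  [:: (1, false); (2, false); (3, false); (4, false); (5, false); (6, false)]]%N nu.
Definition Hex (nu : nat) : seq expr :=
  [seq if jb.2 then (- EVar jb.1)%X else EVar jb.1 | jb <- Hperm nu].
Definition Hindex (nu : nat) : nat :=
  nth 0 [:: 0; 12; 6; 4; 3; 5; 2; 11; 8; 10; 9; 7; 1]%N nu.

Definition gauss : expr :=
  foldr (fun k acc => zx ^+ (k ^ 2 %% 13) + acc)%X (ENat 0) (iota 0 13).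
Definition scaleex (c : expr) : seq expr := [seq (c * EVar i)%X | i <- iota 1 6].

(** Entry 0, which holds $\zeta$, is carried along. Nested actions compose outwards:
    [eact (eact env Mex) (Tex nu)] is the vector $T^\nu Mz$. *)
Definition eact (F : nzRingType) (env : seq F) (l : seq expr) : seq F :=
  env`_0 :: [seq eeval env e | e <- l].
Definition ract (A : rops) (env : seq A) (l : seq expr) : seq A :=
  nth (r0 A) env 0 :: [seq reval env e | e <- l].

Definition Dvals (F : nzRingType) (env : seq F) := [seq eeval env e | e <- Dforms].
Definition Aval (F : nzRingType) (env : seq F) k := eeval env (nth (ENat 0) Aforms k).
Definition Gval (F : nzRingType) (env : seq F) k :=
  eeval (Dvals env) (nth (ENat 0) Gforms k).

Lemma ract_sound (A : rops) (F : comNzRingType) (f : A -> F) (hf : evaluation f)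
    env l :
  [seq f a | a <- ract env l] = eact [seq f a | a <- env] l.
Proof.
rewrite /ract /eact /=; congr (_ :: _).
  by case: env => [|a env] //=; rewrite eval0.
by rewrite -map_comp; apply: eq_map => e /=; rewrite reval_sound.
Qed.

(** $\mathbb Z[\zeta][z_1]\cdots[z_6]$ as nested coefficient lists, $z_1$ innermost and $z_6$
    outermost; [zenv] is the tuple of its generators. *)
Definition zring := iter 6 polyops (cyclicops Zops 13).
Definition zenv : seq zring :=
  let c (a : cyclicops Zops 13) := [:: a] in
  let y (A : rops) : polyops A := [:: r0 A; r1 A] in
  let k (A : rops) (a : A) : polyops A := [:: a] in
  [:: k _ (k _ (k _ (k _ (k _ (k _ ([:: r0 Zops; r1 Zops] : cyclicops Zops 13))))));
      k _ (k _ (k _ (k _ (k _ (y _))))); k _ (k _ (k _ (k _ (y _))));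
      k _ (k _ (k _ (y _))); k _ (k _ (y _)); k _ (y _); y _ ].

Definition zcheck (l r : seq zring) :=
  (size l == size r) && all2 (@req zring) l r.

Section Soundness.
Variables (F : comNzRingType) (zeta : F).
Hypotheses (zeta13 : zeta ^+ 13 = 1) (zeta0 : \sum_(i < 13) zeta ^+ i = 0).

Lemma zring_evaluation (a1 a2 a3 a4 a5 a6 : F) :
  exists2 f : zring -> F, evaluation f &
    [seq f a | a <- zenv] = [:: zeta; a1; a2; a3; a4; a5; a6].
Proof.
have hf := cyclic_evaluation (Zeval_evaluation F) zeta13 zeta0.
have {}hf := poly_evaluation (poly_evaluation (poly_evaluation hf a1) a2) a3.
have {}hf := poly_evaluation (poly_evaluation (poly_evaluation hf a4) a5) a6.
apply: ex_intro2 (hf : @evaluation zring F _) _.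
by rewrite /= /Zeval /= !(mulr0, mulr1, addr0, add0r).
Qed.

(* An identity between values of forms follows from its verification on the
   generic point [zenv]. The ring of that point is hidden in the conclusion, to
   keep it from being unfolded. *)
Lemma generic_point (l r : forall A : rops, seq A -> seq A) (z : seq F) :
  size z = 6%N -> zcheck (l _ zenv) (r _ zenv) ->
  exists (A : rops) (f : A -> F) (env : seq A), [/\ evaluation f,
    [seq f a | a <- env] = zeta :: z &
    [seq f a | a <- l A env] = [seq f a | a <- r A env]].
Proof.
case: z => [|a1 [|a2 [|a3 [|a4 [|a5 [|a6 [|]]]]]]] // _.
have [f hf fE] := zring_evaluation a1 a2 a3 a4 a5 a6.
move=> lr; exists zring, f, zenv; split=> //.
move: (l _ _) (r _ _) lr => {}l {}r /andP[/eqP].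
elim: l r => [|x l IH] [|y r] //=.
by case=> /IH{}IH /andP[/(evalE hf) -> /IH ->].
Qed.

Lemma generic_point1 (l r : forall A : rops, seq A -> A) (z : seq F) :
  size z = 6%N -> req (l _ zenv) (r _ zenv) ->
  exists (A : rops) (f : A -> F) (env : seq A), [/\ evaluation f,
    [seq f a | a <- env] = zeta :: z & f (l A env) = f (r A env)].
Proof.
move=> z6 lr; have [|A [f [env [hf fE [e]]]]] :=
  @generic_point (fun A env => [:: l A env]) (fun A env => [:: r A env]) z z6.
  exact: introT andP (conj (eqxx _) (introT andP (conj lr isT))).
by exists A, f, env.
Qed.

Definition bruhat_lhs nu (A : rops) (env : seq A) :=
  ract (ract (ract env Mex) (Tex nu)) Mex.
Definition bruhat_rhs nu (A : rops) (env : seq A) :=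
  ract (ract (ract (ract (ract env (Tex (Hindex nu))) Mex) (Hex nu))
    (scaleex gauss)) (Tex (Hindex nu)).

Lemma bruhat_check :
  all (fun nu => zcheck (bruhat_lhs nu zenv) (bruhat_rhs nu zenv)) (iota 1 12).
Proof. by vm_cast_no_check (erefl true). Qed.

(** The analogue in dimension six of $wu^\nu w=u^c h_\nu w u^c$ in $\mathrm{SL}_2(\mathbb F_{13})$,
    where $u$ is the standard unipotent element, $w$ the Weyl element, $c=-1/\nu$ and
    $h_\nu=\mathrm{diag}(1/\nu,\nu)$. Here $T$ stands for $u$, $-M/g$ for $w$ and $-H_\nu$ for
    $h_\nu$. *)
Lemma bruhat nu (z : seq F) : size z = 6%N -> (0 < nu < 13)%N ->
  eact (eact (eact (zeta :: z) Mex) (Tex nu)) Mex =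
  eact (eact (eact (eact (eact (zeta :: z) (Tex (Hindex nu))) Mex) (Hex nu))
    (scaleex gauss)) (Tex (Hindex nu)).
Proof.
move=> z6 nu13; have nuP : nu \in iota 1 12 by rewrite mem_iota.
have [A [f [env [hf fE e]]]] := generic_point z6 (allP bruhat_check _ nuP).
by move: e; rewrite /bruhat_lhs /bruhat_rhs !(ract_sound hf) fE.
Qed.

Lemma M_square_check :
  zcheck (ract (ract zenv Mex) Mex) (ract zenv (scaleex (- 13)%X)).
Proof. by vm_cast_no_check (erefl true). Qed.

Lemma M_square (z : seq F) : size z = 6%N ->
  eact (eact (zeta :: z) Mex) Mex = eact (zeta :: z) (scaleex (- 13)%X).
Proof.
move=> z6; have [A [f [env [hf fE e]]]] := @generic_point
  (fun A env => ract (ract env Mex) Mex) (fun A env => ract env _) z z6 M_square_check.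
by move: e; rewrite !(ract_sound hf) fE.
Qed.

(* [2 i] times sums of three sines: the differences of two pairs of cubic periods. *)
Definition sigma : expr :=
  (zx ^+ 1 - zx ^+ 12 + zx ^+ 3 - zx ^+ 10 + zx ^+ 9 - zx ^+ 4)%X.
Definition tau : expr :=
  (zx ^+ 2 - zx ^+ 11 + zx ^+ 6 - zx ^+ 7 + zx ^+ 5 - zx ^+ 8)%X.
Definition Dreal : expr :=
  (2 * d0 + d1 + d2 + d3 - d4 + d5 + d6 + d9 - d10 - d12 - 3 * dinf)%X.
Definition Dimag : expr :=
  (- 3 * d0 + d1 + d3 + d4 + d7 + d8 + d9 + d10 + d11 + d12 - 2 * dinf)%X.
Definition Asum : expr := foldr (fun e acc => e + acc)%X (ENat 0) Aforms.

Definition rDvals (A : rops) (env : seq A) := [seq reval env e | e <- Dforms].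

Lemma rDvals_sound (A : rops) (f : A -> F) (hf : evaluation f) env :
  [seq f a | a <- rDvals env] = Dvals [seq f a | a <- env].
Proof. by rewrite -map_comp; apply: eq_map => e /=; rewrite reval_sound. Qed.

Lemma periods_check :
  [&& req (reval (rDvals (ract zenv Mex)) d0)
        (radd (rmul (reval zenv sigma) (reval (rDvals zenv) Dreal))
          (rmul (reval zenv tau) (reval (rDvals zenv) Dimag))),
      req (reval (rDvals (ract zenv Mex)) dinf)
        (rsub (rmul (reval zenv sigma) (reval (rDvals zenv) Dimag))
          (rmul (reval zenv tau) (reval (rDvals zenv) Dreal))),
      req (reval zenv (sigma ^+ 2 + tau ^+ 2)%X) (reval zenv (- 13)%X),
      req (reval zenv (gauss ^+ 2)%X) (reval zenv 13%X) &
      req (reval (ract zenv Mex) (nth (ENat 0) Aforms 0))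
        (reval zenv (gauss * Asum)%X)].
Proof. by vm_cast_no_check (erefl true). Qed.

(** * The images of $\mathbb A_0$, $\mathbb D_0$, $\mathbb D_\infty$ and $\mathbb G_0$ under $M$ *)

Section Periods.
Variable z : seq F.
Hypothesis z6 : size z = 6%N.
Local Notation v := (eeval (zeta :: z)).
Local Notation u := (eeval (Dvals (zeta :: z))).
Local Notation Mz := (eact (zeta :: z) Mex).

Lemma D0_M : (Dvals Mz)`_0 = v sigma * u Dreal + v tau * u Dimag.
Proof.
case/and5P: periods_check => chk _ _ _ _.
have [A [f [env [hf fE e]]]] := @generic_point1
  (fun A env => reval (rDvals (ract env Mex)) d0)
  (fun A env => radd (rmul (reval env sigma) (reval (rDvals env) Dreal))
          (rmul (reval env tau) (reval (rDvals env) Dimag))) z z6 chk.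
move: e; rewrite (reval_sound hf) (evalD hf) !(evalM hf) !(reval_sound hf) !(rDvals_sound hf).
by rewrite (ract_sound hf) fE.
Qed.

Lemma Dinf_M : (Dvals Mz)`_13 = v sigma * u Dimag - v tau * u Dreal.
Proof.
case/and5P: periods_check => _ chk _ _ _.
have [A [f [env [hf fE e]]]] := @generic_point1
  (fun A env => reval (rDvals (ract env Mex)) dinf)
  (fun A env => rsub (rmul (reval env sigma) (reval (rDvals env) Dimag))
          (rmul (reval env tau) (reval (rDvals env) Dreal))) z z6 chk.
move: e; rewrite (reval_sound hf) (evalB hf) !(evalM hf) !(reval_sound hf) !(rDvals_sound hf).
by rewrite (ract_sound hf) fE.
Qed.

Lemma sigma_tau : v sigma ^+ 2 + v tau ^+ 2 = - 13%:R.
Proof.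
case/and5P: periods_check => _ _ chk _ _.
have [A [f [env [hf fE e]]]] := @generic_point1 (fun A env => reval env _)
  (fun A env => reval env _) z z6 chk.
by move: e; rewrite !(reval_sound hf) fE.
Qed.

Lemma gauss2 : v gauss ^+ 2 = 13%:R.
Proof.
case/and5P: periods_check => _ _ _ chk _.
have [A [f [env [hf fE e]]]] := @generic_point1 (fun A env => reval env _)
  (fun A env => reval env _) z z6 chk.
by move: e; rewrite !(reval_sound hf) fE.
Qed.

Lemma A0_M : Aval Mz 0 = v gauss * v Asum.
Proof.
case/and5P: periods_check => _ _ _ _ chk.
have [A [f [env [hf fE e]]]] := @generic_point1
  (fun A env => reval (ract env Mex) _) (fun A env => reval env _) z z6 chk.
by move: e; rewrite !(reval_sound hf) (ract_sound hf) fE.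
Qed.

(** The pair $(\mathbb D_0,\mathbb D_\infty)$ is moved to the similarity with coefficients
    $\sigma,\tau$ applied to [(Dreal, Dimag)], so the two-square identity gives the factor
    $\sigma^2+\tau^2=-13$. That the sum of the squares of [Dreal] and [Dimag] is $-\delta_0$ holds
    already with the $\mathbb D_k$ as independent variables; no sextic is expanded. *)
Lemma G0_M : Gval Mz 0 = 13%:R * (- 13%:R * Gval (zeta :: z) 0 +
  \sum_(1 <= k < 13) Gval (zeta :: z) k).
Proof.
transitivity ((Dvals Mz)`_0 ^+ 2 + (Dvals Mz)`_13 ^+ 2) => //.
rewrite D0_M Dinf_M.
have -> (s t a b : F) : (s * a + t * b) ^+ 2 + (s * b - t * a) ^+ 2 =
    (s ^+ 2 + t ^+ 2) * (a ^+ 2 + b ^+ 2) by ring.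
rewrite sigma_tau 12?big_nat_recl // big_geq // /Gval.
by move: (Dvals _) => D; cbn [eeval nth Gforms Dreal Dimag]; ring.
Qed.

End Periods.

(** ** Weights *)

(* The weight modulo [m] of a form, the variables having weights [w]; for [m = 0]
   this is the degree. *)
Fixpoint weight (m : nat) (w : seq nat) (e : expr) : option nat :=
  match e with
  | EVar i => Some (nth 0%N w i)
  | ENat _ => Some 0%N
  | EAdd a b =>
      if weight m w a is Some p then
        if weight m w b is Some q then
          if p == q %[mod m] then Some p else None
        else None
      else None
  | EMul a b =>
      if weight m w a is Some p then
        if weight m w b is Some q then Some (p + q)%N else None
      else None
  | EOpp a => weight m w a
  | EPow a n => if weight m w a is Some p then Some (p * n)%N else None
  end.

Definition weighted (c : F) (w : seq nat) (env env' : seq F) :=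
  forall i, env'`_i = c ^+ nth 0%N w i * env`_i.

Lemma expr_modn (c : F) m p : c ^+ m = 1 -> c ^+ (p %% m) = c ^+ p.
Proof. by move=> cm; rewrite [in RHS](divn_eq p m) exprD mulnC exprM cm expr1n mul1r. Qed.

Lemma weightP (c : F) m w env env' e p :
  c ^+ m = 1 -> weighted c w env env' -> weight m w e = Some p ->
  eeval env' e = c ^+ p * eeval env e.
Proof.
move=> cm wE.
elim: e p => [i|n|a IHa b IHb|a IHa b IHb|a IHa|a IHa n] p /=.
- by case=> <-; rewrite wE.
- by case=> <-; rewrite mul1r.
- case: (weight m w a) IHa => // q /(_ q erefl) ->.
  case: (weight m w b) IHb => // r /(_ r erefl) ->.
  case: eqP => // qr [<-]; rewrite mulrDr; congr (_ + _ * _).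
  by rewrite -(expr_modn r cm) -qr expr_modn.
- case: (weight m w a) IHa => // q /(_ q erefl) ->.
  case: (weight m w b) IHb => // r /(_ r erefl) -> [<-].
  by rewrite exprD mulrACA.
- by move=> /IHa ->; rewrite mulrN.
- case: (weight m w a) IHa => // q /(_ q erefl) -> [<-].
  by rewrite exprMn exprM.
Qed.

End Soundness.

End Forms.

(** ** The two orbits of 14 forms *)

Section Orbits.
Variables (F : fieldType) (zeta : F).
Hypotheses (zeta13 : zeta ^+ 13 = 1) (zeta0 : \sum_(i < 13) zeta ^+ i = 0).
Hypothesis nz13 : 13%:R != 0 :> F.

Definition zact (z : seq F) (l : seq expr) := [seq eeval (zeta :: z) e | e <- l].

Definition wform nu (z : seq F) : F :=
  (Aval (zeta :: z) 0 + zeta ^+ nu * Aval (zeta :: z) 1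
   + zeta ^+ (4 * nu) * Aval (zeta :: z) 2 + zeta ^+ (9 * nu) * Aval (zeta :: z) 3
   + zeta ^+ (3 * nu) * Aval (zeta :: z) 4 + zeta ^+ (12 * nu) * Aval (zeta :: z) 5
   + zeta ^+ (10 * nu) * Aval (zeta :: z) 6) ^+ 2.
Definition winf (z : seq F) : F := 13%:R * Aval (zeta :: z) 0 ^+ 2.
Definition deltaform nu (z : seq F) : F := - 13%:R * Gval (zeta :: z) 0
  + \sum_(1 <= k < 13) zeta ^+ (k * nu) * Gval (zeta :: z) k.
Definition deltainf (z : seq F) : F := 13%:R ^+ 2 * Gval (zeta :: z) 0.

Definition psum (q : nat -> seq F -> F) (Q : seq F -> F) k z :=
  \sum_(nu <- iota 0 13) q nu z ^+ k + Q z ^+ k.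

Lemma size_zact z l : size (zact z l) = size l.
Proof. by rewrite size_map. Qed.

Lemma zact_scale z c : size z = 6%N ->
  zact z (scaleex c) = [seq eeval (zeta :: z) c * a | a <- z].
Proof. by case: z => [|a1 [|a2 [|a3 [|a4 [|a5 [|a6 [|]]]]]]]. Qed.

Lemma zact_bruhat nu z (c := Hindex nu) : size z = 6%N -> (0 < nu < 13)%N ->
  zact (zact (zact z Mex) (Tex nu)) Mex =
  zact (zact (zact (zact (zact z (Tex c)) Mex) (Hex nu)) (scaleex gauss)) (Tex c).
Proof. by move=> z6 nu13; have /(congr1 behead) := bruhat zeta13 zeta0 z6 nu13; apply. Qed.

Lemma zact_M_square z : size z = 6%N ->
  zact (zact z Mex) Mex = zact z (scaleex (- 13)%X).
Proof. by move=> z6; have /(congr1 behead) := M_square zeta13 zeta0 z6; apply. Qed.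

(* The [q nu] and [Q] are the images under the cosets of a form [Q] invariant
   under the normalizer of [<T>]; [S] permutes them by the Bruhat relations. *)
Section PowerSums.
Variables (m : nat) (Q : seq F -> F) (q : nat -> seq F -> F).
Hypotheses
  (Q_M : forall z, size z = 6%N -> Q (zact z Mex) = 13%:R ^+ m * q 0%N z)
  (Q_T : forall z mu, size z = 6%N -> Q (zact z (Tex mu)) = Q z)
  (q_T : forall z mu nu, size z = 6%N ->
    q nu (zact z (Tex mu)) = q ((nu + mu) %% 13)%N z)
  (Q_H : forall z nu, size z = 6%N -> (0 < nu < 13)%N -> Q (zact z (Hex nu)) = Q z)
  (Q_scale : forall c z, size z = 6%N -> Q [seq c * a | a <- z] = c ^+ (2 * m) * Q z)
  (q_scale : forall c nu z, size z = 6%N -> q nu [seq c * a | a <- z] = c ^+ (2 * m) * q nu z).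

Lemma psum_T k z : size z = 6%N ->
  psum q Q k (zact z (Tex 1)) = psum q Q k z.
Proof.
move=> z6; rewrite /psum Q_T //; congr (_ + _).
under eq_bigr do rewrite q_T //.
rewrite -(big_map (fun nu => (nu + 1) %% 13)%N xpredT (fun nu => q nu z ^+ k)).
exact: perm_big.
Qed.

(** Up to the factor $13^m$, $q_\nu\circ M=q_0\circ T^\nu M$ is $Q\circ MT^\nu M$. The Bruhat
    relation turns this into $g^{2m}\,Q\circ MT^c$, since $Q$ absorbs $T^c$ and $H_\nu$; and
    $g^{2m}=13^m$ cancels the factor introduced. *)
Lemma q_M nu z : size z = 6%N -> (0 < nu < 13)%N ->
  q nu (zact z Mex) = 13%:R ^+ m * q (Hindex nu) z.
Proof.
move=> z6 nu13; apply: (mulfI (expf_neq0 m nz13)).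
have -> : q nu (zact z Mex) = q 0%N (zact (zact z Mex) (Tex nu)).
  by rewrite q_T ?size_zact // add0n modn_small //; case/andP: nu13.
rewrite -Q_M ?size_zact //.
have sH : size (Hex nu) = 6%N by move: nu nu13; do 13?case.
have cH : (Hindex nu < 13)%N by move: nu nu13 {sH}; do 13?case.
rewrite zact_bruhat // Q_T ?size_zact // zact_scale ?size_zact // Q_scale ?size_zact // exprM.
rewrite gauss2 ?size_zact // Q_H ?size_zact // Q_M ?size_zact // q_T // add0n.
by rewrite modn_small.
Qed.

Lemma q0_M z : size z = 6%N -> q 0%N (zact z Mex) = 13%:R ^+ m * Q z.
Proof.
move=> z6; apply: (mulfI (expf_neq0 m nz13)).
rewrite -Q_M ?size_zact //.
by rewrite zact_M_square // zact_scale // Q_scale //= exprM sqrrN expr2 exprMn mulrA.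
Qed.

(** $M$ exchanges $Q$ and $q_0$ and sends $q_\nu$ to $q_{-1/\nu}$, a permutation of the 14 forms in
    which every member gains the same factor $13^m$. *)
Lemma psum_M k z : size z = 6%N ->
  psum q Q k (zact z Mex) = 13%:R ^+ (m * k) * psum q Q k z.
Proof.
move=> z6; rewrite /psum Q_M // -[iota 0 13]/(0%N :: iota 1 12) [in LHS]big_cons.
rewrite [in RHS]big_cons q0_M //.
rewrite (eq_big_seq (fun nu => 13%:R ^+ (m * k) * q (Hindex nu) z ^+ k)); last first.
  by move=> nu; rewrite mem_iota => nu13; rewrite q_M // exprMn exprM.
rewrite -mulr_sumr -(big_map Hindex xpredT (fun nu => q nu z ^+ k)).
have -> : \sum_(nu <- map Hindex (iota 1 12)) q nu z ^+ k =
  \sum_(nu <- iota 1 12) q nu z ^+ k by exact: perm_big.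
by rewrite !exprMn -!exprM; ring.
Qed.

Lemma psum_scale c k z : size z = 6%N ->
  psum q Q k [seq c * a | a <- z] = c ^+ (2 * m * k) * psum q Q k z.
Proof.
move=> z6; rewrite /psum Q_scale // exprMn -exprM mulrDr mulr_sumr; congr (_ + _).
by under eq_bigr do rewrite q_scale // exprMn -exprM.
Qed.

Lemma psum_S c k z : size z = 6%N -> c ^+ 2 * 13%:R = 1 ->
  psum q Q k [seq c * a | a <- zact z Mex] = psum q Q k z.
Proof.
move=> z6 c13; rewrite psum_scale ?size_zact // psum_M // mulrA -mulnA exprM -exprMn c13.
by rewrite expr1n mul1r.
Qed.

End PowerSums.

Lemma weighted_T z mu : size z = 6%N ->
  weighted (zeta ^+ mu) (0%N :: Tweights) (zeta :: z) (zeta :: zact z (Tex mu)).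
Proof.
move=> z6 [|[|[|[|[|[|[|i]]]]]]]; rewrite /= ?mul1r // -?exprM.
all: try by rewrite expr_modn.
by rewrite [z`__]nth_default ?nth_nil ?mulr0 // z6.
Qed.

Lemma weighted_scale z c : size z = 6%N ->
  weighted c (0%N :: nseq 6 1%N) (zeta :: z) (zeta :: [seq c * a | a <- z]).
Proof.
move=> z6 [|[|[|[|[|[|[|i]]]]]]]; rewrite /= ?mul1r // ?expr1.
all: try by rewrite (nth_map 0) ?z6.
by rewrite !nth_default ?mulr0 // ?size_map z6.
Qed.

(* The weight of [A_k] under [T]. *)
Definition Aweight k : nat := nth 0%N [:: 0; 1; 4; 9; 3; 12; 10]%N k.

Definition has_weight m w p e := if weight m w e is Some q then q == p %[mod m] else false.

Lemma has_weightP (c : F) m w env env' e p : c ^+ m = 1 ->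
  weighted c w env env' -> has_weight m w p e ->
  eeval env' e = c ^+ p * eeval env e.
Proof.
rewrite /has_weight => cm wE; case eq_q: (weight m w e) => [q|] // /eqP qp.
by rewrite (weightP cm wE eq_q) -(expr_modn q cm) qp expr_modn.
Qed.

Lemma weighted_Dvals (c : F) m w env env' (wD : seq nat) : c ^+ m = 1 ->
  weighted c w env env' -> all2 (has_weight m w) wD Dforms ->
  weighted c wD (Dvals env) (Dvals env').
Proof.
move=> cm wE; rewrite /Dvals; elim: Dforms wD => [|e l IH] [|p wD] //=.
  by move=> _ i; rewrite !nth_nil mulr0.
by case/andP=> he /IH{}IH [|i] //=; apply: has_weightP he.
Qed.

Lemma zetaX13 mu : (zeta ^+ mu) ^+ 13 = 1.
Proof. by rewrite exprAC zeta13 expr1n. Qed.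

Lemma Aval_T z mu k : size z = 6%N -> (k < 7)%N ->
  Aval (zeta :: zact z (Tex mu)) k = zeta ^+ (Aweight k * mu) * Aval (zeta :: z) k.
Proof.
move=> z6 k7; rewrite mulnC exprM.
apply: (has_weightP (zetaX13 mu) (weighted_T mu z6)).
by move: k k7; do 7?case.
Qed.

Lemma Aval_scale z c k : size z = 6%N -> (k < 7)%N ->
  Aval (zeta :: [seq c * a | a <- z]) k = c ^+ 2 * Aval (zeta :: z) k.
Proof.
move=> z6 k7; apply: (@has_weightP _ 0) (weighted_scale c z6) _ => //.
by move: k k7; do 7?case.
Qed.

Lemma Gval_T z mu k : size z = 6%N -> (k < 13)%N ->
  Gval (zeta :: zact z (Tex mu)) k = zeta ^+ (k * mu) * Gval (zeta :: z) k.
Proof.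
move=> z6 k13; rewrite mulnC exprM.
(* $\mathbb D_k$ has $T$-weight $k$ and $\mathbb D_\infty$, the last entry, has weight 0; hence
   $\mathbb G_k$ has weight $k$. *)
apply: (has_weightP (zetaX13 mu)
  (weighted_Dvals (wD := rcons (iota 0 13) 0%N) (zetaX13 mu) (weighted_T mu z6) _)) => //.
by move: k k13; do 13?case.
Qed.

Lemma Gval_scale z c k : size z = 6%N -> (k < 13)%N ->
  Gval (zeta :: [seq c * a | a <- z]) k = c ^+ 6 * Gval (zeta :: z) k.
Proof.
move=> z6 k13; apply: (@has_weightP c 0 (nseq 14 3)) => //.
  exact: (@weighted_Dvals c 0) (weighted_scale c z6) _.
by move: k k13; do 13?case.
Qed.

(** For $\nu$ a nonresidue modulo 13, $H_\nu$ changes the sign of $\mathbb A_0$ and exchanges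
    $\mathbb D_0$ and $\mathbb D_\infty$ up to sign. Hence it is $\mathbb A_0^2$ and $\mathbb
    D_0^2+\mathbb D_\infty^2$ that are invariant under the normalizer. *)
Lemma H_check : all (fun nu => req (reval (ract zenv (Hex nu)) (nth (ENat 0) Aforms 0 ^+ 2)%X)
    (reval zenv (nth (ENat 0) Aforms 0 ^+ 2)%X) &&
  req (reval (rDvals (ract zenv (Hex nu))) (nth (ENat 0) Gforms 0))
    (reval (rDvals zenv) (nth (ENat 0) Gforms 0))) (iota 1 12).
Proof. by vm_cast_no_check (erefl true). Qed.

Lemma A0_H z nu : size z = 6%N -> (0 < nu < 13)%N ->
  Aval (zeta :: zact z (Hex nu)) 0 ^+ 2 = Aval (zeta :: z) 0 ^+ 2.
Proof.
move=> z6 nu13; have nuP : nu \in iota 1 12 by rewrite mem_iota.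
have /andP[chk _] := allP H_check _ nuP.
have [A [f [env [hf fE e]]]] := @generic_point1 _ _ zeta13 zeta0
  (fun A env => reval (ract env _) _) (fun A env => reval env _) z z6 chk.
by move: e; rewrite !(reval_sound hf) (ract_sound hf) fE.
Qed.

Lemma G0_H z nu : size z = 6%N -> (0 < nu < 13)%N ->
  Gval (zeta :: zact z (Hex nu)) 0 = Gval (zeta :: z) 0.
Proof.
move=> z6 nu13; have nuP : nu \in iota 1 12 by rewrite mem_iota.
have /andP[_ chk] := allP H_check _ nuP.
have [A [f [env [hf fE e]]]] := @generic_point1 _ _ zeta13 zeta0
  (fun A env => reval (rDvals (ract env _)) _) (fun A env => reval (rDvals env) _)
  z z6 chk.
by move: e; rewrite !(reval_sound hf) !(rDvals_sound hf) (ract_sound hf) fE.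
Qed.

Definition wpsum := psum wform winf.
Definition deltapsum := psum deltaform deltainf.

Lemma zeta_addn_mod a nu mu : zeta ^+ (a * ((nu + mu) %% 13)) =
  zeta ^+ (a * nu) * zeta ^+ (a * mu).
Proof.
rewrite -exprD -mulnDr -[in RHS](expr_modn _ zeta13) -modnMmr.
by rewrite expr_modn.
Qed.

Lemma winf_M z : size z = 6%N -> winf (zact z Mex) = 13%:R ^+ 2 * wform 0 z.
Proof.
move=> z6; rewrite /winf A0_M // exprMn gauss2 // mulrA -expr2; congr (_ * _).
by rewrite /wform !muln0 expr0 /Asum /Aval /=; congr (_ ^+ 2); ring.
Qed.

Lemma wform_T z mu nu : size z = 6%N ->
  wform nu (zact z (Tex mu)) = wform ((nu + mu) %% 13) z.
Proof.
move=> z6; rewrite /wform; congr (_ ^+ 2).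
have := zeta_addn_mod 1 nu mu; rewrite !mul1n => ->.
by rewrite !zeta_addn_mod !Aval_T // /Aweight /= mul0n mul1n expr0 mul1r !mulrA.
Qed.

Lemma winf_T z mu : size z = 6%N -> winf (zact z (Tex mu)) = winf z.
Proof. by move=> z6; rewrite /winf Aval_T // mul0n expr0 mul1r. Qed.

Lemma wform_scale c nu z : size z = 6%N ->
  wform nu [seq c * a | a <- z] = c ^+ (2 * 2) * wform nu z.
Proof. by move=> z6; rewrite /wform !Aval_scale //; ring. Qed.

Lemma winf_scale c z : size z = 6%N ->
  winf [seq c * a | a <- z] = c ^+ (2 * 2) * winf z.
Proof. by move=> z6; rewrite /winf !Aval_scale //; ring. Qed.

Lemma deltainf_M z : size z = 6%N ->
  deltainf (zact z Mex) = 13%:R ^+ 3 * deltaform 0 z.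
Proof.
move=> z6; rewrite /deltainf (G0_M zeta13 zeta0) // mulrA -exprSr; congr (_ * (_ + _)).
by under [RHS]eq_bigr do rewrite muln0 expr0 mul1r.
Qed.

Lemma deltaform_T z mu nu : size z = 6%N ->
  deltaform nu (zact z (Tex mu)) = deltaform ((nu + mu) %% 13) z.
Proof.
move=> z6; rewrite /deltaform Gval_T // mul0n expr0 mul1r; congr (_ + _).
by apply: eq_big_nat => k /andP[_ k13]; rewrite Gval_T // zeta_addn_mod mulrA.
Qed.

Lemma deltainf_T z mu : size z = 6%N -> deltainf (zact z (Tex mu)) = deltainf z.
Proof. by move=> z6; rewrite /deltainf Gval_T // mul0n expr0 mul1r. Qed.

Lemma deltaform_scale c nu z : size z = 6%N ->
  deltaform nu [seq c * a | a <- z] = c ^+ (2 * 3) * deltaform nu z.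
Proof.
move=> z6; rewrite /deltaform Gval_scale // [RHS]mulrDr mulr_sumr mulrCA.
by congr (_ + _); apply: eq_big_nat => k /andP[_ k13]; rewrite Gval_scale // mulrCA.
Qed.

Lemma deltainf_scale c z : size z = 6%N ->
  deltainf [seq c * a | a <- z] = c ^+ (2 * 3) * deltainf z.
Proof. by move=> z6; rewrite /deltainf Gval_scale // mulrCA. Qed.

End Orbits.

(** * Power sums on the curve *)

(* Elements [sum_k p_k m_k] of the algebra graded by [Z/13] with basis [m_0 = 1],
   ..., [m_12] and structure constants [m_k m_l = u_kl m_(k+l)]. *)
Section TwistedAlgebra.
Variables (A : rops) (u : seq (seq A)).

Definition at13 (p : seq A) k := nth (r0 A) p k.
Definition tmono (a b : A) k l : A :=
  if req a (r0 A) then r0 A else if req b (r0 A) then r0 A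
  else rmul (rmul a (nth (r0 A) (nth [::] u k) l)) b.
Definition sub13 r k := ((r + 13 - k) %% 13)%N.
Definition tmul_at r (p q : seq A) : A := foldr (fun k acc =>
  radd (tmono (at13 p k) (at13 q (sub13 r k)) k (sub13 r k)) acc)
  (r0 A) (iota 0 13).
Definition tmul (p q : seq A) := mkseq (fun r => tmul_at r p q) 13.
Definition tsqr (p : seq A) := mkseq (fun r => foldr (fun k acc =>
  let l := sub13 r k in
  if (l < k)%N then acc else
  let c := tmono (at13 p k) (at13 p l) k l in
  radd (if k == l then c else radd c c) acc) (r0 A) (iota 0 13)) 13.
Definition teq (p q : seq A) := all (fun k => req (at13 p k) (at13 q k)) (iota 0 13).
Definition twistops :=
  @ROps (seq A) [::] [:: r1 A] (@padd A) tmul (@popp A) teq.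

Variables (F : numFieldType) (f : A -> F) (hf : evaluation f).
Variables (m : nat -> F) (m0 : m 0%N = 1).
Hypothesis hu : forall k l, (k < 13)%N -> (l < 13)%N ->
  f (nth (r0 A) (nth [::] u k) l) * m ((k + l) %% 13)%N = m k * m l.

Section Eval.
Variables (c : F) (c13 : c ^+ 13 = 1).

(** As $c^{13}=1$, replacing $m_k$ by $c^k m_k$ respects the structure constants. The choice
    $c=\zeta^\nu$ realises the action of $T^\nu$. *)
Definition teval (p : seq A) : F :=
  \sum_(k <- iota 0 13) f (at13 p k) * (c ^+ k * m k).

Lemma at13D p q k : f (at13 (padd p q) k) = f (at13 p k) + f (at13 q k).
Proof.
rewrite /at13; elim: p q k => [|a p IHp] [|b q] k /=.
all: rewrite ?nth_nil ?eval0 ?addr0 ?add0r //.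
by case: k => [|k] /=; rewrite ?evalD ?IHp.
Qed.

Lemma at13N p k : f (at13 (popp p) k) = - f (at13 p k).
Proof.
rewrite /at13; elim: p k => [|a p IHp] k /=; rewrite ?nth_nil ?eval0 ?oppr0 //.
by case: k => [|k] /=; rewrite ?evalN ?IHp.
Qed.

Lemma tmonoE a b k l : (k < 13)%N -> (l < 13)%N ->
  f (tmono a b k l) * (c ^+ ((k + l) %% 13) * m ((k + l) %% 13)) =
  (f a * (c ^+ k * m k)) * (f b * (c ^+ l * m l)).
Proof.
move=> k13 l13; rewrite /tmono; case: ifP => [/(eval_eq0 hf) ->|_].
  by rewrite eval0 // !mul0r.
case: ifP => [/(eval_eq0 hf) ->|_]; first by rewrite eval0 // !mul0r mulr0.
rewrite !(evalM hf) expr_modn // mulrACA exprD.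
transitivity (c ^+ k * c ^+ l * f a * f b *
  (f (nth (r0 A) (nth [::] u k) l) * m ((k + l) %% 13)%N)); first by ring.
by rewrite hu //; ring.
Qed.

Lemma sub13K k r : (k < 13)%N -> (r < 13)%N -> ((k + sub13 r k) %% 13)%N = r.
Proof.
move=> k13 r13; rewrite /sub13 modnDmr addnBA; last by rewrite ltnW // ltn_addl.
by rewrite addnC addnK modnDr modn_small.
Qed.

Lemma big_sub13 (g : nat -> F) k : (k < 13)%N ->
  \sum_(r <- iota 0 13) g (sub13 r k) = \sum_(l <- iota 0 13) g l.
Proof.
move=> k13; rewrite -(big_map (sub13^~ k) xpredT); apply: perm_big.
by move: k k13; do 13?case.
Qed.

Lemma big_iota13 (g1 g2 : nat -> F) : (forall k, (k < 13)%N -> g1 k = g2 k) ->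
  \sum_(k <- iota 0 13) g1 k = \sum_(k <- iota 0 13) g2 k.
Proof. by move=> g12; apply: eq_big_seq => k; rewrite mem_iota => /g12. Qed.

Lemma tevalE g : teval (mkseq g 13) =
  \sum_(r <- iota 0 13) f (g r) * (c ^+ r * m r).
Proof. by apply: big_iota13 => r r13; rewrite /at13 nth_mkseq. Qed.

Lemma tevalM p q : teval (tmul p q) = teval p * teval q.
Proof.
pose t k l := (f (at13 p k) * (c ^+ k * m k)) * (f (at13 q l) * (c ^+ l * m l)).
rewrite tevalE; transitivity (\sum_(k <- iota 0 13) \sum_(l <- iota 0 13) t k l).
  transitivity (\sum_(r <- iota 0 13) \sum_(k <- iota 0 13) t k (sub13 r k)).
    apply: big_iota13 => r r13.
    have -> : f (tmul_at r p q) = \sum_(k <- iota 0 13)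
        f (tmono (at13 p k) (at13 q (sub13 r k)) k (sub13 r k)).
      rewrite /tmul_at; elim: (iota 0 13) => [|k s IH]; first by rewrite big_nil eval0.
      by rewrite big_cons -IH -evalD.
    rewrite mulr_suml; apply: big_iota13 => k k13.
    rewrite -[in LHS](sub13K k13 r13) /t -tmonoE ?ltn_pmod //.
    by rewrite sub13K // (sub13K k13).
  rewrite exchange_big; apply: big_iota13 => k k13 /=.
  exact: (big_sub13 (t k)).
by rewrite /teval mulr_suml; apply: eq_bigr => k _; rewrite mulr_sumr.
Qed.

(** [tsqr] visits only the pairs $k\le l$ and doubles the off-diagonal ones. This family has the
    same symmetrisation as the full one, and 2 is invertible. *)
Lemma sum_symmetric (t g : nat -> nat -> F) s :
  (forall k l, t k l + t l k = g k l + g l k) ->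
  \sum_(k <- s) \sum_(l <- s) t k l = \sum_(k <- s) \sum_(l <- s) g k l.
Proof.
move=> tg; have twice (h : nat -> nat -> F) :
    (\sum_(k <- s) \sum_(l <- s) h k l) * 2%:R =
    \sum_(k <- s) \sum_(l <- s) (h k l + h l k).
  rewrite mulr_natr mulr2n [X in _ + X]exchange_big -big_split /=.
  by apply: eq_bigr => k _; rewrite -big_split.
have nz2 : 2%:R != 0 :> F by rewrite pnatr_eq0.
apply: (mulIf nz2); rewrite !twice.
by apply: eq_bigr => k _; apply: eq_bigr => l _.
Qed.

Lemma tevalS p : teval (tsqr p) = teval p ^+ 2.
Proof.
pose t k l := (f (at13 p k) * (c ^+ k * m k)) * (f (at13 p l) * (c ^+ l * m l)).
pose g k l := if (l < k)%N then 0 else if k == l then t k l else t k l + t k l.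
transitivity (\sum_(k <- iota 0 13) \sum_(l <- iota 0 13) t k l); last first.
  by rewrite expr2 /teval mulr_suml; apply: eq_bigr => k _; rewrite mulr_sumr.
rewrite (@sum_symmetric t g) => [|k l]; last first.
  have tC : t l k = t k l by rewrite /t mulrC.
  rewrite /g [l == k]eq_sym tC; by case: ltngtP => [_|_|->]; rewrite ?addr0 ?add0r.
rewrite tevalE.
transitivity (\sum_(r <- iota 0 13) \sum_(k <- iota 0 13) g k (sub13 r k)).
  apply: big_iota13 => r r13.
  pose a k := let l := sub13 r k in let b := tmono (at13 p k) (at13 p l) k l in
    if (l < k)%N then r0 A else if k == l then b else radd b b.
  transitivity ((\sum_(k <- iota 0 13) f (a k)) * (c ^+ r * m r)).
    congr (_ * _); elim: (iota 0 13) => [|k s IH]; first by rewrite big_nil eval0.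
    rewrite big_cons -IH /a /=; case: ifP => _; first by rewrite eval0 // add0r.
    by rewrite -evalD.
  rewrite mulr_suml; apply: big_iota13 => k k13; rewrite /a /g /=.
  have tE : f (tmono (at13 p k) (at13 p (sub13 r k)) k (sub13 r k)) *
      (c ^+ r * m r) = t k (sub13 r k).
    by rewrite /t -tmonoE ?ltn_pmod // sub13K.
  case: ifP => _; first by rewrite eval0 // mul0r.
  by case: ifP => _; rewrite ?evalD // ?mulrDl tE.
by rewrite exchange_big; apply: big_iota13 => k k13 /=; exact: (big_sub13 (g k)).
Qed.

Lemma twist_evaluation : @evaluation twistops F teval.
Proof.
split=> [||p q|p q|p|p q /allP pq].
- by rewrite /teval big1_seq // => k _; rewrite /at13 nth_nil eval0 // mul0r.
- rewrite /teval -[iota 0 13]/(0%N :: iota 1 12) big_cons big1_seq => [|k].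
    by rewrite /= eval1 // m0 !mulr1 addr0.
  by rewrite mem_iota /=; case: k => // k _; rewrite /at13 /= nth_nil eval0 // mul0r.
- rewrite /teval -big_split /=; apply: eq_bigr => k _.
  by rewrite at13D mulrDl.
- exact: tevalM.
- rewrite /teval -sumrN; apply: eq_bigr => k _.
  by rewrite /= at13N mulNr.
- by apply: eq_big_seq => k /pq /(evalE hf) ->.
Qed.

Definition single k (a : A) : seq A := ncons k (r0 A) [:: a].

Lemma teval_single k a : (k < 13)%N -> teval (single k a) = f a * (c ^+ k * m k).
Proof.
move=> k13; rewrite /teval (bigD1_seq k) ?mem_iota ?iota_uniq //= big1_seq.
  by rewrite addr0 /at13 nth_ncons ltnn subnn.
move=> l /andP[lk _]; rewrite /at13 nth_ncons.
case: ltnP => kl; first by rewrite eval0 // mul0r.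
have : (0 < l - k)%N by rewrite subn_gt0 ltn_neqAle eq_sym lk.
by case: (l - k)%N => // n _; rewrite /= nth_nil eval0 // mul0r.
Qed.

Definition scalar (p : seq A) := all (fun k => req (at13 p k) (r0 A)) (iota 1 12).

Lemma teval_scalar p : scalar p -> teval p = f (at13 p 0).
Proof.
move=> /allP p0; rewrite /teval -[iota 0 13]/(0%N :: iota 1 12) big_cons.
rewrite big1_seq => [|k /andP[_ /p0/(eval_eq0 hf) ->]]; last by rewrite mul0r.
by rewrite m0 !mulr1 addr0.
Qed.

End Eval.

(** Orthogonality of the characters of $\mathbb Z/13$: only the component of degree 0 survives, and
    $\zeta$ does not occur in it. *)
Lemma sum_teval (zeta : F) p : zeta ^+ 13 = 1 -> \sum_(i < 13) zeta ^+ i = 0 ->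
  \sum_(nu <- iota 0 13) teval (zeta ^+ nu) p = 13%:R * f (at13 p 0).
Proof.
move=> zeta13 zeta0.
pose g k := \sum_(nu <- iota 0 13) f (at13 p k) * ((zeta ^+ nu) ^+ k * m k).
transitivity (\sum_(k <- iota 0 13) g k); first by rewrite exchange_big.
rewrite -[iota 0 13]/(0%N :: iota 1 12) big_cons big1_seq => [|k /andP[_]].
  rewrite addr0 /g (eq_bigr (fun=> f (at13 p 0))) => [|nu _]; last first.
    by rewrite m0 !mulr1.
  by rewrite big_const_seq iter_addr_0 mulr_natl.
rewrite mem_iota => /andP[k0 k13].
transitivity (f (at13 p k) * m k * \sum_(nu <- iota 0 13) zeta ^+ (k * nu %% 13)).
  rewrite mulr_sumr; apply: eq_bigr => nu _.
  by rewrite expr_modn // mulnC exprM; ring.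
rewrite -(big_map (fun nu => k * nu %% 13)%N xpredT (fun n => zeta ^+ n)).
rewrite (perm_big (iota 0 13)) /=; last by move: k k0 k13 {g}; do 13?case.
rewrite -[X in _ * X]/(\sum_(i <- iota 0 13) zeta ^+ i).
by rewrite -[iota 0 13]/(index_iota 0 13) big_mkord zeta0 mulr0.
Qed.

End TwistedAlgebra.
Arguments single : simpl never.

(** * The forms at a homogeneous point of the twisted algebra *)

Section TwistedForms.
Variables (A : rops) (u : seq (seq A)) (zs : seq A).
Local Notation R := (twistops u).

(** Each coordinate is homogeneous, its degree being its $T$-weight, so that a form of $T$-weight
    $k$ takes a value of degree $k$. The leading 1 fills the place of $\zeta$. *)
Definition tpoint : seq R := (r1 R : R) :: [seq single wa.1 wa.2 | wa <- zip Tweights zs].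
Definition tAvals : seq R := [seq reval tpoint e | e <- Aforms].
Definition tGvals : seq R := [seq reval (rDvals tpoint) e | e <- Gforms].
Definition talpha : R := reval tAvals
  (foldr (fun k acc => EVar k + acc)%X (ENat 0) (iota 0 7)).
Definition tdelta : R := reval tGvals
  (- 13 * EVar 0 + foldr (fun k acc => EVar k + acc) 0 (iota 1 12))%X.
Definition tdelta2 : R := tsqr u tdelta.
Definition tdelta4 : R := tsqr u tdelta2.
Definition tw : R := tsqr u talpha.
Definition tw2 : R := tsqr u tw.
Definition talpha5 : R := tmul u tw2 talpha.
(** The degree 0 components of $\delta^2$, $\delta^3$, $\delta^5$ and $w^5=\alpha^{10}$. For the
    last three, the final product is computed in degree 0 only. *)
Definition kdelta2 : A := at13 tdelta2 0.
Definition kdelta3 : A := tmul_at u 0 tdelta2 tdelta.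
Definition kdelta5 : A := tmul_at u 0 tdelta4 tdelta.
Definition kw5 : A := tmul_at u 0 talpha5 talpha5.
Definition kA0 : A := at13 (nth (r0 R) tAvals 0) 0.
Definition kG0 : A := at13 (nth (r0 R) tGvals 0) 0.

(* All values at once, so that a computation shares the intermediate results. *)
Definition twisted_values : seq A :=
  let Av := tAvals in let Gv := tGvals in
  let alpha := reval Av (foldr (fun k acc => EVar k + acc)%X (ENat 0) (iota 0 7)) in
  let delta := reval Gv
    (- 13 * EVar 0 + foldr (fun k acc => EVar k + acc) 0 (iota 1 12))%X in
  let delta2 := tsqr u delta : R in
  let alpha4 := tsqr u (tsqr u alpha) : R in
  let alpha5 := tmul u alpha4 alpha : R in
  [:: at13 (nth (r0 R) Av 0) 0; at13 (nth (r0 R) Gv 0) 0; at13 delta2 0;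
      tmul_at u 0 delta2 delta; tmul_at u 0 (tsqr u delta2) delta;
      tmul_at u 0 alpha5 alpha5].

Lemma twisted_valuesE :
  twisted_values = [:: kA0; kG0; kdelta2; kdelta3; kdelta5; kw5].
Proof.
by rewrite /kw5 /kdelta5 /kdelta3 /kdelta2 /tdelta4 /talpha5 /tw2 /tw /tdelta2 /tdelta /talpha;
  reflexivity.
Qed.

Variables (F : numFieldType) (f : A -> F) (hf : evaluation f).
Variables (m : nat -> F) (m0 : m 0%N = 1).
Hypothesis hu : forall k l, (k < 13)%N -> (l < 13)%N ->
  f (nth (r0 A) (nth [::] u k) l) * m ((k + l) %% 13)%N = m k * m l.
Variable zeta : F.
Hypotheses (zeta13 : zeta ^+ 13 = 1) (zeta0 : \sum_(i < 13) zeta ^+ i = 0).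
Hypothesis size_zs : size zs = 6%N.

Local Notation ev c := (@teval A F f m c).
Local Notation z := [seq ev 1 p | p <- behead tpoint].

Lemma ev_hom c : c ^+ 13 = 1 -> @evaluation R F (ev c).
Proof. exact: twist_evaluation. Qed.

Lemma size_z : size z = 6%N.
Proof. by rewrite /= !size_map size_zip size_zs. Qed.

Lemma ev_point nu : [seq ev (zeta ^+ nu) p | p <- behead tpoint] = zact zeta z (Tex nu).
Proof.
rewrite /tpoint.
case: zs size_zs => [|a1 [|a2 [|a3 [|a4 [|a5 [|a6 [|]]]]]]] // _.
rewrite /zact /= !teval_single // !expr1n.
by do !congr cons; rewrite expr_modn // mul1r exprM; ring.
Qed.

(* The forms do not involve variable [0]. *)
Lemma Gval_head c c' (l : seq F) k : (k < 13)%N -> Gval (c :: l) k = Gval (c' :: l) k.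
Proof. by move: k; do 13?case. Qed.
Lemma Aval_head c c' (l : seq F) k : (k < 7)%N -> Aval (c :: l) k = Aval (c' :: l) k.
Proof. by move: k; do 7?case. Qed.

Lemma ev_tpoint c : c ^+ 13 = 1 ->
  [seq ev c p | p <- tpoint] = 1 :: [seq ev c p | p <- behead tpoint].
Proof. by move=> c13; rewrite /= (eval1 (ev_hom c13)). Qed.

Lemma ev_Gvals c : c ^+ 13 = 1 ->
  [seq ev c p | p <- tGvals] =
  [seq eeval (Dvals (1 :: [seq ev c p | p <- behead tpoint])) e | e <- Gforms].
Proof.
move=> c13; rewrite -map_comp; apply: eq_map => e /=.
by rewrite (reval_sound (ev_hom c13)) (rDvals_sound (ev_hom c13)) ev_tpoint.
Qed.

Lemma ev_Avals c : c ^+ 13 = 1 ->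
  [seq ev c p | p <- tAvals] =
  [seq eeval (1 :: [seq ev c p | p <- behead tpoint]) e | e <- Aforms].
Proof.
move=> c13; rewrite -map_comp; apply: eq_map => e /=.
by rewrite (reval_sound (ev_hom c13)) ev_tpoint.
Qed.

(** Evaluating at $\zeta^\nu$ replaces $z$ by $T^\nu z$, and $\delta_0(T^\nu z)=\delta_\nu(z)$. Thus
    one element carries all thirteen forms. *)
Lemma ev_delta nu : ev (zeta ^+ nu) tdelta = deltaform zeta (nu %% 13) z.
Proof.
have c13 := zetaX13 zeta13 nu.
rewrite -[in RHS](add0n nu) -(deltaform_T zeta13 _ _ size_z) -ev_point.
rewrite (reval_sound (ev_hom c13)) ev_Gvals //; move: [seq _ | p <- behead _] => l.
rewrite /deltaform 12?big_nat_recl // big_geq // !muln0 expr0 !mul1r.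
by rewrite !(Gval_head zeta 1).
Qed.

Lemma ev_w nu : ev (zeta ^+ nu) tw = wform zeta (nu %% 13) z.
Proof.
have c13 := zetaX13 zeta13 nu.
rewrite -[in RHS](add0n nu) -(wform_T zeta13 _ _ size_z) -ev_point.
rewrite tevalS // (reval_sound (ev_hom c13)) ev_Avals //.
move: [seq _ | p <- behead _] => l; rewrite /wform !muln0 expr0 !mul1r; congr (_ ^+ 2).
by rewrite !(Aval_head zeta 1) // /Aval /= addr0 !addrA.
Qed.

Hypotheses (scalarA0 : scalar (nth (r0 R) tAvals 0))
  (scalarG0 : scalar (nth (r0 R) tGvals 0)).

Lemma kG0E : f kG0 = Gval (zeta :: z) 0.
Proof.
rewrite /kG0 -(teval_scalar hf m0 1 scalarG0) (Gval_head zeta 1) //.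
rewrite (reval_sound (ev_hom (expr1n _ _))) (rDvals_sound (ev_hom (expr1n _ _))).
by rewrite ev_tpoint ?expr1n.
Qed.

Lemma kA0E : f kA0 = Aval (zeta :: z) 0.
Proof.
rewrite /kA0 -(teval_scalar hf m0 1 scalarA0) (Aval_head zeta 1) //.
by rewrite (reval_sound (ev_hom (expr1n _ _))) ev_tpoint ?expr1n.
Qed.

Lemma psum_twist q Q (y : F) (p : seq A) k :
  (forall nu, ev (zeta ^+ nu) p = q (nu %% 13)%N z ^+ k) -> Q z = y ->
  psum q Q k z = 13%:R * f (at13 p 0) + y ^+ k.
Proof.
move=> pE <-; rewrite -(sum_teval f m0 _ zeta13 zeta0) /psum; congr (_ + _).
by apply: big_iota13 => nu nu13; rewrite pE modn_small.
Qed.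

Lemma deltapsum2 : deltapsum zeta 2 z = 13%:R * f kdelta2 + (13%:R ^+ 2 * f kG0) ^+ 2.
Proof.
apply: psum_twist => [nu|]; last by rewrite kG0E.
by rewrite tevalS ?zetaX13 // ev_delta.
Qed.

Lemma deltapsum3 : deltapsum zeta 3 z = 13%:R * f kdelta3 + (13%:R ^+ 2 * f kG0) ^+ 3.
Proof.
rewrite -[kdelta3]/(at13 (tmul u tdelta2 tdelta) 0).
apply: psum_twist => [nu|]; last by rewrite kG0E.
by rewrite tevalM ?zetaX13 // tevalS ?zetaX13 // ev_delta -exprSr.
Qed.

Lemma deltapsum5 : deltapsum zeta 5 z = 13%:R * f kdelta5 + (13%:R ^+ 2 * f kG0) ^+ 5.
Proof.
rewrite -[kdelta5]/(at13 (tmul u tdelta4 tdelta) 0).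
apply: psum_twist => [nu|]; last by rewrite kG0E.
by rewrite tevalM ?zetaX13 // !tevalS ?zetaX13 // ev_delta -exprM -exprSr.
Qed.

Lemma wpsum5 : wpsum zeta 5 z = 13%:R * f kw5 + (13%:R * f kA0 ^+ 2) ^+ 5.
Proof.
rewrite -[kw5]/(at13 (tmul u talpha5 talpha5) 0).
apply: psum_twist => [nu|]; last by rewrite kA0E.
have w2E : ev (zeta ^+ nu) tw2 = ev (zeta ^+ nu) tw ^+ 2 by apply/tevalS/zetaX13.
have wE : ev (zeta ^+ nu) tw = ev (zeta ^+ nu) talpha ^+ 2 by apply/tevalS/zetaX13.
have alg (a b : F) : b = a ^+ 2 -> (b ^+ 2 * a) * (b ^+ 2 * a) = b ^+ 5.
  by move=> ->; ring.
rewrite -ev_w -(alg _ _ wE) -w2E.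
by rewrite (tevalM hf hu (zetaX13 zeta13 nu)) (tevalM hf hu (zetaX13 zeta13 nu)).
Qed.

End TwistedForms.

(** ** The function field of the curve *)

(** $\mathbb Z[h,1/h][x]$ modulo $(1+x)(x-h)(1+xh)=xh$. The leading coefficient in $x$ is $h$, so
    the relation can be solved for $x^3$. *)
Definition Kring : rops :=
  let L := laurentops Zops in
  let n1 : Zops := ropp (r1 Zops) in let p1 : Zops := r1 Zops in
  cubicops (A := L) (1%N, [:: n1; n1; p1]) (1%N, [:: n1; radd p1 p1; p1]) (r1 L).

Definition kL (p : nat * seq int) : laurentops Zops := (p.1, map Z_of_int p.2).
Definition kel (p q r : nat * seq int) : Kring := (kL p, kL q, kL r).

(* The units [x], [1 + x], [h], [x - h], [1 + x + x h]. *)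
Definition kunits : seq Kring := [::
  kel (0%N, [::]) (0%N, [:: 1]) (0%N, [::]);
  kel (0%N, [:: 1]) (0%N, [:: 1]) (0%N, [::]);
  kel (0%N, [:: 0; 1]) (0%N, [::]) (0%N, [::]);
  kel (0%N, [:: 0; -1]) (0%N, [:: 1]) (0%N, [::]);
  kel (0%N, [:: 1]) (0%N, [:: 1; 1]) (0%N, [::])].
Definition kunits_inv : seq Kring := [::
  kel (1%N, [:: 1; -2; -1]) (1%N, [:: 1; 1; -1]) (0%N, [:: 1]);
  kel (0%N, [:: 2]) (1%N, [:: -1; 0; 1]) (0%N, [:: -1]);
  kel (1%N, [:: 1]) (0%N, [::]) (0%N, [::]);
  kel (2%N, [:: 1; -1]) (2%N, [:: 1; 1]) (1%N, [:: 1]);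
  kel (1%N, [:: 1; 4; 3; 1]) (2%N, [:: -1; -2; -1; 1; 1]) (1%N, [:: -1; -2; -1])].
Definition kunit i := nth (r0 Kring) kunits i.
Definition kunit_inv i := nth (r0 Kring) kunits_inv i.

Definition kpow i (n : int) : Kring :=
  match n with Posz k => rpow (kunit i) k | Negz k => rpow (kunit_inv i) k.+1 end.
Definition kmono (n : seq int) : Kring :=
  foldr (fun i acc => rmul (kpow i n`_i) acc) (r1 Kring) (iota 0 5).

(* The basis consists of [s^k], with [s = e4/e1], corrected by units to have small
   orders at the cusps; [s^13] is the unit with exponents [sigma_exp]. *)
Definition basis_exp : seq (seq int) := [::
  [:: 0; 0; 0; 0; 0]; [:: 1; -1; 0; 0; 0]; [:: 0; 0; 0; 1; 0];
  [:: -1; -1; -1; 2; 1]; [:: 0; -2; -1; 2; 1]; [:: 0; -2; -1; 3; 1];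
  [:: 0; -2; -1; 3; 1]; [:: 1; -2; -2; 4; 1]; [:: 1; -2; -2; 4; 1];
  [:: 1; -2; -2; 5; 1]; [:: 2; -3; -2; 5; 1]; [:: 1; -4; -3; 6; 2];
  [:: 0; -3; -3; 7; 2]].
Definition sigma_exp : seq int := [:: -1; 4; 3; -7; -2].

(** The exponents of $m_km_l/m_{k+l}$; when $k+l$ passes 13, the power $s^{13}$ contributes as
    well. *)
Definition cocycle_exp k l : seq int := mkseq (fun i =>
  (nth [::] basis_exp k)`_i + (nth [::] basis_exp l)`_i
  + (if (k + l < 13)%N then 0 else sigma_exp`_i)
  - (nth [::] basis_exp ((k + l) %% 13))`_i) 5.
Definition cocycle : seq (seq Kring) :=
  mkseq (fun k => mkseq (fun l => kmono (cocycle_exp k l)) 13) 13.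
(** The coefficients of $e_1,e_3,e_4,-e_5,e_2,e_6$, divided by a common factor, on
    $m_7,m_{11},m_8,m_6,m_2,m_5$. *)
Definition kpoint : seq Kring :=
  [:: kunit 2; rmul (kunit 1) (kunit 2); kunit 2; ropp (kunit 0); kunit 0; kunit 1].

(** $\mathbb D_0\mathbb D_\infty=z_1\cdots z_6$, and $z_4=-e_5$ accounts for the sign. *)
Definition kP : Kring := at13 (reval (rDvals (tpoint cocycle kpoint))
  (- EVar 0 * EVar 13)%X) 0.
(* The Hauptmodul [(eta(z)/eta(13z))^2] of X_0(13). *)
Definition kt : Kring := kel (1%N, [:: 1; -3; -1]) (0%N, [::]) (0%N, [::])%N.

Section Claims.
Local Open Scope expr_scope.
Local Notation P := (EVar 0).
Local Notation t := (EVar 1).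
Local Notation A0 := (EVar 2).
Local Notation G0 := (EVar 3).
(** With [e4poly] and [e6poly] written $F$ and $E$, Klein's formula is $j=(t^2+5t+13)F^3/t^{13}$ and
    $j-1728=(t^2+6t+13)E^2/t^{13}$. *)
Definition e4poly : expr := t ^+ 4 + 19 * 13 * t ^+ 3 + 20 * 13 ^+ 2 * t ^+ 2
  + 7 * 13 ^+ 3 * t + 13 ^+ 4.
Definition e6poly : expr := t ^+ 6 - 38 * 13 * t ^+ 5 - 122 * 13 ^+ 2 * t ^+ 4
  - 108 * 13 ^+ 3 * t ^+ 3 - 46 * 13 ^+ 4 * t ^+ 2 - 10 * 13 ^+ 5 * t - 13 ^+ 6.
(** In the last four pairs the left side is a power sum as expressed by [deltapsum2], [deltapsum3],
    [deltapsum5] and [wpsum5]. The constants normalising the $\Phi_j$ are multiplied out, as the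
    coefficients are integral. *)
Definition claims : seq (expr * expr) := [::
  (A0 ^+ 3, P * (t ^+ 2 + 5 * t + 13));
  (G0 ^+ 2, P ^+ 2 * (t ^+ 2 + 6 * t + 13));
  (13 * EVar 4 + (13 ^+ 2 * G0) ^+ 2, - (13 * 52) * (P ^+ 2 * t ^+ 5));
  (13 * EVar 5 + (13 ^+ 2 * G0) ^+ 3, 13 * 6 * (P ^+ 2 * G0 * t * e6poly));
  (13 * EVar 6 + (13 ^+ 2 * G0) ^+ 5,
    - (13 * 1315) * (P ^+ 4 * G0 * t ^+ 6 * e6poly));
  (13 * EVar 7 + (13 * A0 ^+ 2) ^+ 5, 13 * 25 * (P ^+ 3 * A0 * t ^+ 4 * e4poly))].
End Claims.

Definition kvals : seq Kring := [:: kP, kt & twisted_values cocycle kpoint].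

Lemma kring_check : [&& all (fun i => req (rmul (kunit i) (kunit_inv i)) (r1 Kring)) (iota 0 5),
  scalar (nth [::] (tAvals cocycle kpoint) 0),
  scalar (nth [::] (tGvals cocycle kpoint) 0) &
  all (fun c => req (reval kvals c.1) (reval kvals c.2)) claims].
Proof. by vm_cast_no_check (erefl true). Qed.

(** * Specialising the function field at a point *)

Section FunctionField.
Variables (F : numFieldType) (h x : F).
Hypotheses (h0 : h != 0)
  (cubic : h * x ^+ 3 + (1 + h - h ^+ 2) * x ^+ 2 + (1 - 2%:R * h - h ^+ 2) * x - h = 0).

Definition keval : Kring -> F := @ceval (laurentops Zops) F (leval (@Zeval F) h) x.

Arguments keval : simpl never.

Lemma keval_evaluation : evaluation keval.
Proof.
apply: cubic_evaluation (laurent_evaluation (Zeval_evaluation F) h0) _ _.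
rewrite /leval /= /Zeval /= !expr1 !(mulr0, addr0, divr1).
rewrite -[BinPos.Pos.to_nat BinNums.xH]/1%N.
rewrite -[BinPos.Pos.to_nat (BinNums.xO BinNums.xH)]/2%N -[(Negz 0)%:~R]/(- 1 : F) -!pmulrn.
apply: (mulfI h0); apply/eqP; rewrite -subr_eq0 -cubic; apply/eqP.
by field.
Qed.

Lemma keval_kel p q r : keval (kel p q r) =
  (\sum_(i < size p.2) (p.2`_i)%:~R * h ^+ i) / h ^+ p.1 +
  (\sum_(i < size q.2) (q.2`_i)%:~R * h ^+ i) / h ^+ q.1 * x +
  (\sum_(i < size r.2) (r.2`_i)%:~R * h ^+ i) / h ^+ r.1 * x ^+ 2.
Proof.
have pE (l : seq int) : peval_at (@Zeval F) h (map Z_of_int l) =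
    \sum_(i < size l) (l`_i)%:~R * h ^+ i.
  elim: l => [|a l IH] /=; first by rewrite big_ord0.
  rewrite IH big_ord_recl /Zeval Z_of_intK mulr1 mulr_sumr; congr (_ + _).
  by apply: eq_bigr => i _; rewrite mulrCA exprS.
by rewrite /keval /leval /= !pE.
Qed.

Definition unitval : seq F := [:: x; 1 + x; h; x - h; 1 + x + x * h].

Lemma keval_kunit i : (i < 5)%N -> keval (kunit i) = unitval`_i.
Proof.
move: i; do 5?[case=> [_|]]; rewrite ?/(kunit _) //= keval_kel /=.
all: by rewrite !big_ord_recl !big_ord0 /= ?expr0 ?expr1 ?divr1; ring.
Qed.

(** The verified products with the candidate inverses yield the nonvanishing too; $h\ne0$ and the
    cubic relation suffice for all five units. *)
Lemma keval_kunit_inv i : (i < 5)%N ->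
  unitval`_i != 0 /\ keval (kunit_inv i) = (unitval`_i)^-1.
Proof.
move=> i5; have iP : i \in iota 0 5 by rewrite mem_iota.
case/and4P: kring_check => /allP/(_ i iP) /(evalE keval_evaluation) + _ _ _.
rewrite (evalM keval_evaluation) (eval1 keval_evaluation) keval_kunit // => u1.
have u0 : unitval`_i != 0.
  by apply: contraPneq u1 => ->; rewrite mul0r => /esym/eqP; rewrite oner_eq0.
by split=> //; apply: (mulfI u0); rewrite u1 mulfV.
Qed.

Definition monoval (n : seq int) : F :=
  unitval`_0 ^ n`_0 * (unitval`_1 ^ n`_1 * (unitval`_2 ^ n`_2 *
  (unitval`_3 ^ n`_3 * (unitval`_4 ^ n`_4 * 1)))).

Lemma keval_kmono n : keval (kmono n) = monoval n.
Proof.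
have kE i k : (i < 5)%N -> keval (kpow i k) = unitval`_i ^ k.
  move=> i5; have hf := keval_evaluation; case: k => k; rewrite /kpow evalX //.
    by rewrite keval_kunit.
  by have [_ ->] := keval_kunit_inv i5; rewrite exprVn.
by rewrite /kmono /= !(evalM keval_evaluation) !kE // (eval1 keval_evaluation).
Qed.

Lemma monovalD n n' k : (forall i, (i < 5)%N -> k`_i = n`_i + n'`_i) ->
  monoval k = monoval n * monoval n'.
Proof.
move=> kE; rewrite /monoval !kE // !expfzDr; try by have [] := @keval_kunit_inv 0 isT.
all: try by have [] := @keval_kunit_inv 1 isT.
all: try by have [] := @keval_kunit_inv 2 isT.
all: try by have [] := @keval_kunit_inv 3 isT.
all: try by have [] := @keval_kunit_inv 4 isT.
by ring.
Qed.

Variable s : F.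
Hypothesis s13 : s ^+ 13 = monoval sigma_exp.
Definition basis k : F := s ^+ k * monoval (nth [::] basis_exp k).

Lemma basis0 : basis 0 = 1.
Proof. by rewrite /basis /monoval /= !expr0z !mul1r. Qed.

Lemma basisM k l : (k < 13)%N -> (l < 13)%N ->
  keval (nth (r0 Kring) (nth [::] cocycle k) l) * basis ((k + l) %% 13) =
  basis k * basis l.
Proof.
move=> k13 l13; rewrite /cocycle !nth_mkseq // keval_kmono /basis.
set b := fun j => nth [::] basis_exp j; set kl := ((k + l) %% 13)%N.
pose n := mkseq (fun i => (b k)`_i + (b l)`_i) 5.
have nE : monoval n = monoval (b k) * monoval (b l).
  by apply: monovalD => i i5; rewrite nth_mkseq.
transitivity (s ^+ (k + l) * monoval n); last by rewrite exprD nE; ring.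
rewrite mulrCA; have [lt_kl|ge_kl] := ltnP (k + l) 13.
  rewrite /kl modn_small //; congr (_ * _); apply/esym/monovalD => i i5.
  by rewrite !nth_mkseq // lt_kl modn_small // addr0 subrK.
have klE : (k + l = 13 + kl)%N.
  suff -> : kl = (k + l - 13)%N by rewrite subnKC.
  rewrite /kl -[in LHS](subnK ge_kl) modnDr modn_small // ltn_subLR //.
  by rewrite (leq_trans (_ : _ < 13 + l)%N) ?ltn_add2r ?leq_add2l // ltnW.
have klP : (k + l < 13)%N = false by rewrite ltnNge ge_kl.
have -> : monoval (cocycle_exp k l) * monoval (b kl) = monoval sigma_exp * monoval n.
  pose ns := mkseq (fun i => sigma_exp`_i + n`_i) 5.
  transitivity (monoval ns); last by apply: monovalD => i i5; rewrite nth_mkseq.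
  apply/esym/monovalD => i i5; rewrite !nth_mkseq // klP subrK.
  by rewrite addrC.
by rewrite klE exprD s13; ring.
Qed.

Variable zeta : F.
Hypotheses (zeta13 : zeta ^+ 13 = 1) (zeta0 : \sum_(i < 13) zeta ^+ i = 0).

Local Notation c := cocycle.
Definition curve_point : seq F :=
  [seq teval keval basis 1 p | p <- behead (tpoint c kpoint)].

Definition Phi12val z := - (13%:R * 52%:R)^-1 * deltapsum zeta 2 z.
Definition Phi18val z := (13%:R * 6%:R)^-1 * deltapsum zeta 3 z.
Definition Phi20val z := (13%:R * 25%:R)^-1 * wpsum zeta 5 z.
Definition Phi30val z := - (13%:R * 1315%:R)^-1 * deltapsum zeta 5 z.

Definition Phi_relations z :=
  Phi20val z ^+ 3 - Phi30val z ^+ 2 = 1728%:R * Phi12val z ^+ 5 /\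
  Phi20val z ^+ 3 - Phi12val z ^+ 2 * Phi18val z ^+ 2 = 1728%:R * Phi12val z ^+ 5.

(* [gamma_2^3 - (j - 1728) = 1728], multiplied by [t^13]. *)
Lemma gamma_identity (P t A0 G0 E4 E6 : F) :
  A0 ^+ 3 = P * (t ^+ 2 + 5%:R * t + 13%:R) ->
  G0 ^+ 2 = P ^+ 2 * (t ^+ 2 + 6%:R * t + 13%:R) ->
  (t ^+ 2 + 5%:R * t + 13%:R) * E4 ^+ 3 - (t ^+ 2 + 6%:R * t + 13%:R) * E6 ^+ 2 =
    1728%:R * t ^+ 13 ->
  (P ^+ 3 * A0 * t ^+ 4 * E4) ^+ 3 - (P ^+ 4 * G0 * t ^+ 6 * E6) ^+ 2 =
  1728%:R * (P ^+ 2 * t ^+ 5) ^+ 5.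
Proof.
move=> hA hG hE.
have -> : (P ^+ 3 * A0 * t ^+ 4 * E4) ^+ 3 =
  P ^+ 9 * t ^+ 12 * E4 ^+ 3 * A0 ^+ 3 by ring.
have -> : (P ^+ 4 * G0 * t ^+ 6 * E6) ^+ 2 =
  P ^+ 8 * t ^+ 12 * E6 ^+ 2 * G0 ^+ 2 by ring.
have -> : 1728%:R * (P ^+ 2 * t ^+ 5) ^+ 5 =
  P ^+ 10 * t ^+ 12 * (1728%:R * t ^+ 13) by ring.
by rewrite hA hG -hE; ring.
Qed.

Lemma relations_of_claims z (P t A0 G0 d2 d3 d5 w5 : F) :
  deltapsum zeta 2 z = 13%:R * d2 + (13%:R ^+ 2 * G0) ^+ 2 ->
  deltapsum zeta 3 z = 13%:R * d3 + (13%:R ^+ 2 * G0) ^+ 3 ->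
  deltapsum zeta 5 z = 13%:R * d5 + (13%:R ^+ 2 * G0) ^+ 5 ->
  wpsum zeta 5 z = 13%:R * w5 + (13%:R * A0 ^+ 2) ^+ 5 ->
  (forall i (cl := nth (ENat 0, ENat 0) claims i), (i < 6)%N ->
    eeval [:: P; t; A0; G0; d2; d3; d5; w5] cl.1 =
    eeval [:: P; t; A0; G0; d2; d3; d5; w5] cl.2) ->
  Phi_relations z.
Proof.
set K := [:: P; t; A0; G0; d2; d3; d5; w5] => e2 e3 e5 e10 claimP.
pose E4 := eeval K e4poly; pose E6 := eeval K e6poly.
have eA : A0 ^+ 3 = P * (t ^+ 2 + 5%:R * t + 13%:R) by exact: claimP 0%N isT.
have eG : G0 ^+ 2 = P ^+ 2 * (t ^+ 2 + 6%:R * t + 13%:R) by exact: claimP 1%N isT.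
have E2 : deltapsum zeta 2 z = - (13%:R * 52%:R) * (P ^+ 2 * t ^+ 5).
  by rewrite e2; exact: claimP 2%N isT.
have E3 : deltapsum zeta 3 z = 13%:R * 6%:R * (P ^+ 2 * G0 * t * E6).
  by rewrite e3; exact: claimP 3%N isT.
have E5 : deltapsum zeta 5 z = - (13%:R * 1315%:R) * (P ^+ 4 * G0 * t ^+ 6 * E6).
  by rewrite e5; exact: claimP 4%N isT.
have E10 : wpsum zeta 5 z = 13%:R * 25%:R * (P ^+ 3 * A0 * t ^+ 4 * E4).
  by rewrite e10; exact: claimP 5%N isT.
have nz n m : (0 < n)%N -> (0 < m)%N -> n%:R * m%:R != 0 :> F.
  by rewrite -natrM pnatr_eq0 -lt0n muln_gt0 => -> ->.
have p12 : Phi12val z = P ^+ 2 * t ^+ 5.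
  by rewrite /Phi12val E2 mulNr mulrN mulNr opprK mulKf ?nz.
have p18 : Phi18val z = P ^+ 2 * G0 * t * E6 by rewrite /Phi18val E3 mulKf ?nz.
have p20 : Phi20val z = P ^+ 3 * A0 * t ^+ 4 * E4.
  by rewrite /Phi20val E10 mulKf ?nz.
have p30 : Phi30val z = P ^+ 4 * G0 * t ^+ 6 * E6.
  by rewrite /Phi30val E5 mulNr mulrN mulNr opprK mulKf ?nz.
have gE : (t ^+ 2 + 5%:R * t + 13%:R) * E4 ^+ 3 -
    (t ^+ 2 + 6%:R * t + 13%:R) * E6 ^+ 2 = 1728%:R * t ^+ 13.
  by rewrite /E4 /E6 /K; cbn [eeval e4poly e6poly nth]; ring.
have main := gamma_identity eA eG gE.
rewrite /Phi_relations p12 p18 p20 p30; split=> //.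
(* On the curve $\Phi_{12}\Phi_{18}=\Phi_{30}$, so the second identity is the first one. *)
by rewrite -main; ring.
Qed.

Lemma curve_point_relations : Phi_relations curve_point.
Proof.
have hf := keval_evaluation.
case/and4P: kring_check => _ sA sG chk.
have size6 : size kpoint = 6%N by [].
have e2 := deltapsum2 hf basis0 basisM zeta13 zeta0 size6 sG.
have e3 := deltapsum3 hf basis0 basisM zeta13 zeta0 size6 sG.
have e5 := deltapsum5 hf basis0 basisM zeta13 zeta0 size6 sG.
have e10 := wpsum5 hf basis0 basisM zeta13 zeta0 size6 sA.
apply: (relations_of_claims (P := keval kP) (t := keval kt) e2 e3 e5 e10) => i cl i6.
have KE : [seq keval a | a <- kvals] = [:: keval kP; keval kt; keval (kA0 c kpoint);
    keval (kG0 c kpoint); keval (kdelta2 c kpoint); keval (kdelta3 c kpoint);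
    keval (kdelta5 c kpoint); keval (kw5 c kpoint)].
  by rewrite /kvals twisted_valuesE 8!map_cons.
rewrite -KE -(reval_sound hf kvals cl.1) -(reval_sound hf kvals cl.2).
exact: evalE hf _ _ (all_nthP (ENat 0, ENat 0) chk i i6).
Qed.

End FunctionField.

(** ** Points satisfying the three-term relations *)

Section ThreeTerm.
Variables (F : numFieldType) (e O E : int -> F).
Hypotheses (e_prod : forall i j, e (i + j) * e (i - j) = O i * E j - O j * E i)
  (e_opp : forall r, e (- r) = - e r) (e_refl : forall r, e (13 - r) = e r).

(* The Plücker relation between the minors of a matrix with two rows. *)
Lemma three_term i j k l :
  e (i + j) * e (i - j) * (e (k + l) * e (k - l))
  - e (i + k) * e (i - k) * (e (j + l) * e (j - l))
  + e (i + l) * e (i - l) * (e (j + k) * e (j - k)) = 0.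
Proof. by rewrite !e_prod; ring. Qed.

Let em1 : e (- 1) = - e 1 := e_opp 1.
Let em2 : e (- 2) = - e 2 := e_opp 2.
Let em3 : e (- 3) = - e 3 := e_opp 3.
Let em4 : e (- 4) = - e 4 := e_opp 4.
Let em5 : e (- 5) = - e 5 := e_opp 5.
Let em6 : e (- 6) = - e 6 := e_opp 6.
Let e7 : e 7 = e 6 := e_refl 6.
Let e8 : e 8 = e 5 := e_refl 5.
Let e9 : e 9 = e 4 := e_refl 4.
Let e10 : e 10 = e 3 := e_refl 3.
Let e11 : e 11 = e 2 := e_refl 2.
Let eE := (em1, em2, em3, em4, em5, em6, e7, e8, e9, e10, e11).

(** The digits in the names are the quadruple given to [three_term]; oddness and the symmetry under
    $r\mapsto13-r$ bring all indices back to $1,\dots,6$. *)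
Lemma rel1235 : e 1 * e 2 * e 3 * e 5 - e 2 * e 3 * e 4 * e 6 + e 1 * e 4 * e 5 * e 6 = 0.
Proof.
rewrite -(three_term 1 2 3 5 : e 3 * e (- 1) * (e 8 * e (- 2))
    - e 4 * e (- 2) * (e 7 * e (- 3))
    + e 6 * e (- 4) * (e 5 * e (- 1)) = 0).
by rewrite !eE; ring.
Qed.

Lemma rel0356 : e 1 * e 2 * e 3 ^+ 2 - e 3 * e 4 * e 5 ^+ 2 + e 2 * e 5 * e 6 ^+ 2 = 0.
Proof.
rewrite -(three_term 0 3 5 6 : e 3 * e (- 3) * (e 11 * e (- 1))
    - e 5 * e (- 5) * (e 9 * e (- 3))
    + e 6 * e (- 6) * (e 8 * e (- 2)) = 0).
by rewrite !eE; ring.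
Qed.

Lemma rel0124 : e 1 ^+ 2 * e 2 * e 6 - e 2 ^+ 2 * e 3 * e 5 + e 1 * e 3 * e 4 ^+ 2 = 0.
Proof.
rewrite -(three_term 0 1 2 4 : e 1 * e (- 1) * (e 6 * e (- 2))
    - e 2 * e (- 2) * (e 5 * e (- 3))
    + e 4 * e (- 4) * (e 3 * e (- 1)) = 0).
by rewrite !eE; ring.
Qed.

Lemma rel0234 : e 1 * e 2 ^+ 2 * e 6 - e 2 * e 3 ^+ 2 * e 6 + e 1 * e 4 ^+ 2 * e 5 = 0.
Proof.
rewrite -(three_term 0 2 3 4 : e 2 * e (- 2) * (e 7 * e (- 1))
    - e 3 * e (- 3) * (e 6 * e (- 2))
    + e 4 * e (- 4) * (e 5 * e (- 1)) = 0).
by rewrite !eE; ring.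
Qed.

(** This relation and the following ones serve to locate the zeros of [e]. *)
Lemma rel0134 : e 1 ^+ 3 * e 6 - e 3 ^+ 3 * e 5 + e 2 * e 4 ^+ 3 = 0.
Proof.
rewrite -(three_term 0 1 3 4 : e 1 * e (- 1) * (e 7 * e (- 1))
    - e 3 * e (- 3) * (e 5 * e (- 3))
    + e 4 * e (- 4) * (e 4 * e (- 2)) = 0).
by rewrite !eE; ring.
Qed.

Lemma rel0256 : e 1 * e 2 ^+ 3 - e 4 * e 5 ^+ 3 + e 3 * e 6 ^+ 3 = 0.
Proof.
rewrite -(three_term 0 2 5 6 : e 2 * e (- 2) * (e 11 * e (- 1))
    - e 5 * e (- 5) * (e 8 * e (- 4))
    + e 6 * e (- 6) * (e 7 * e (- 3)) = 0).
by rewrite !eE; ring.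
Qed.

Lemma rel0123 : e 1 ^+ 3 * e 5 - e 2 ^+ 3 * e 4 + e 1 * e 3 ^+ 3 = 0.
Proof.
rewrite -(three_term 0 1 2 3 : e 1 * e (- 1) * (e 5 * e (- 1))
    - e 2 * e (- 2) * (e 4 * e (- 2))
    + e 3 * e (- 3) * (e 3 * e (- 1)) = 0).
by rewrite !eE; ring.
Qed.

Lemma rel0145 : e 1 ^+ 3 * e 4 - e 4 ^+ 3 * e 6 + e 3 * e 5 ^+ 3 = 0.
Proof.
rewrite -(three_term 0 1 4 5 : e 1 * e (- 1) * (e 9 * e (- 1))
    - e 4 * e (- 4) * (e 6 * e (- 4))
    + e 5 * e (- 5) * (e 5 * e (- 3)) = 0).
by rewrite !eE; ring.
Qed.

Lemma rel0246 : e 2 ^+ 3 * e 3 - e 4 ^+ 3 * e 5 + e 2 * e 6 ^+ 3 = 0.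
Proof.
rewrite -(three_term 0 2 4 6 : e 2 * e (- 2) * (e 10 * e (- 2))
    - e 4 * e (- 4) * (e 8 * e (- 4))
    + e 6 * e (- 6) * (e 6 * e (- 2)) = 0).
by rewrite !eE; ring.
Qed.

Lemma rel0156 : e 1 ^+ 3 * e 2 - e 5 ^+ 3 * e 6 + e 4 * e 6 ^+ 3 = 0.
Proof.
rewrite -(three_term 0 1 5 6 : e 1 * e (- 1) * (e 11 * e (- 1))
    - e 5 * e (- 5) * (e 7 * e (- 5))
    + e 6 * e (- 6) * (e 6 * e (- 4)) = 0).
by rewrite !eE; ring.
Qed.

Lemma rel0235 : e 2 ^+ 3 * e 5 - e 3 ^+ 3 * e 6 + e 1 * e 5 ^+ 3 = 0.
Proof.
rewrite -(three_term 0 2 3 5 : e 2 * e (- 2) * (e 8 * e (- 2))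
    - e 3 * e (- 3) * (e 7 * e (- 3))
    + e 5 * e (- 5) * (e 5 * e (- 1)) = 0).
by rewrite !eE; ring.
Qed.

Lemma rel0346 : e 2 * e 3 ^+ 3 - e 3 * e 4 ^+ 3 + e 1 * e 6 ^+ 3 = 0.
Proof.
rewrite -(three_term 0 3 4 6 : e 3 * e (- 3) * (e 10 * e (- 2))
    - e 4 * e (- 4) * (e 9 * e (- 3))
    + e 6 * e (- 6) * (e 7 * e (- 1)) = 0).
by rewrite !eE; ring.
Qed.

(** The order of $a_1,\dots,a_6$: their characteristics $11,7,5,3,9,1$ are the numbers $13-2r$, and
    $a_4$ carries a sign. *)
Definition theta_vec : seq F := [:: e 1; e 3; e 4; - e 5; e 2; e 6].

Variable zeta : F.
Hypotheses (zeta13 : zeta ^+ 13 = 1) (zeta0 : \sum_(i < 13) zeta ^+ i = 0).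

(** Every term has degree $60=3\cdot20=2\cdot30=5\cdot12=2(12+18)$. *)
Lemma Phi_scale (a : F) z : size z = 6%N ->
  Phi_relations zeta z -> Phi_relations zeta [seq a * b | b <- z].
Proof.
move=> z6; have [w5 d2 d3 d5] : [/\
    wpsum zeta 5 [seq a * b | b <- z] = a ^+ 20 * wpsum zeta 5 z,
    deltapsum zeta 2 [seq a * b | b <- z] = a ^+ 12 * deltapsum zeta 2 z,
    deltapsum zeta 3 [seq a * b | b <- z] = a ^+ 18 * deltapsum zeta 3 z &
    deltapsum zeta 5 [seq a * b | b <- z] = a ^+ 30 * deltapsum zeta 5 z].
  split.
  - exact: (psum_scale (m := 2) (@winf_scale _ zeta) (@wform_scale _ zeta)).
  - exact: (psum_scale (m := 3) (@deltainf_scale _ zeta) (@deltaform_scale _ zeta)).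
  - exact: (psum_scale (m := 3) (@deltainf_scale _ zeta) (@deltaform_scale _ zeta)).
  - exact: (psum_scale (m := 3) (@deltainf_scale _ zeta) (@deltaform_scale _ zeta)).
rewrite /Phi_relations /Phi12val /Phi18val /Phi20val /Phi30val w5 d2 d3 d5.
set p12 := _ * deltapsum _ 2 z; set p18 := _ * deltapsum _ 3 z.
set p20 := _ * wpsum _ 5 z; set p30 := _ * deltapsum _ 5 z => -[h1 h2].
rewrite !(mulrCA _ (a ^+ _)) -/p12 -/p18 -/p20 -/p30; split.
  transitivity (a ^+ 60 * (p20 ^+ 3 - p30 ^+ 2)); first by ring.
  by rewrite h1; ring.
transitivity (a ^+ 60 * (p20 ^+ 3 - p12 ^+ 2 * p18 ^+ 2)); first by ring.
by rewrite h2; ring.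
Qed.

Lemma zeta_neq1 n : (n %% 13 != 0)%N -> zeta ^+ n != 1.
Proof.
move=> n13; apply/eqP => zn; have z1 : zeta = 1.
  (* The inverses modulo 13: $\zeta^n=1$ would force $\zeta=1$, and then the powers would sum to
     13. *)
  pose k := nth 0%N [:: 0; 1; 7; 9; 10; 8; 11; 2; 5; 3; 4; 6; 12]%N (n %% 13).
  have <- : zeta ^+ (n %% 13 * k %% 13) = zeta.
    rewrite -[RHS]expr1; congr (_ ^+ _); rewrite /k.
    by move: (n %% 13)%N (ltn_pmod n (isT : (0 < 13)%N)) n13; do 13?case.
  by rewrite expr_modn // exprM expr_modn // zn expr1n.
have := zeta0; rewrite z1; under eq_bigr do rewrite expr1n.
by move/eqP; rewrite sumr_const card_ord pnatr_eq0.
Qed.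

(* The cusps fixed by [T]. *)
Lemma Phi_coordinate_point z i0 : size z = 6%N -> (i0 < 6)%N ->
  (forall i, i != i0 -> z`_i = 0) -> Phi_relations zeta z.
Proof.
move=> z6 i06 zi; pose c := zeta ^+ nth 0%N Tweights i0.
have Tz : zact zeta z (Tex 1) = [seq c * a | a <- z].
  move: z6 zi; case: z => [|a1 [|a2 [|a3 [|a4 [|a5 [|a6 [|]]]]]]] // _ zi.
  have eT i : zeta ^+ nth 0%N Tweights i * [:: a1; a2; a3; a4; a5; a6]`_i =
      c * [:: a1; a2; a3; a4; a5; a6]`_i.
    by case: (eqVneq i i0) => [->|/zi ->] //; rewrite !mulr0.
  rewrite /zact /=; do !congr cons.
  - exact: (eT 0%N).
  - exact: (eT 1%N).
  - exact: (eT 2%N).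
  - exact: (eT 3%N).
  - exact: (eT 4%N).
  - exact: (eT 5%N).
(* $T$ multiplies the point by [c], so the value of a $T$-invariant form of degree $n$ is fixed by
   $c^n\ne1$. None of the degrees 12, 18, 20, 30 is divisible by 13. *)
have fixed0 (a : F) n : c ^+ n * a = a -> (n %% 13 != 0)%N -> a = 0.
  move=> ca n13; apply/eqP; rewrite -[_ == 0]orFb.
  have <- : (c ^+ n - 1 == 0) = false.
    apply/negbTE; rewrite subr_eq0 /c -exprM zeta_neq1 //.
    rewrite -/(dvdn 13 _) Euclid_dvdM // negb_or (n13 : ~~ (13 %| n)%N) andbT.
    by move: i0 i06 {zi c Tz ca}; do 6?case.
  by rewrite -mulf_eq0 mulrBl mul1r ca subrr.
have w5 : wpsum zeta 5 z = 0.
  apply: (fixed0 _ (2 * 2 * 5)%N) => //.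
  rewrite -(psum_scale (@winf_scale _ zeta) (@wform_scale _ zeta)) // -Tz.
  exact: (psum_T (@winf_T _ _ zeta13) (@wform_T _ _ zeta13)).
have d k : ((2 * 3 * k) %% 13 != 0)%N -> deltapsum zeta k z = 0.
  apply: fixed0; rewrite -(psum_scale (@deltainf_scale _ zeta) (@deltaform_scale _ zeta)) // -Tz.
  exact: (psum_T (@deltainf_T _ _ zeta13) (@deltaform_T _ _ zeta13)).
rewrite /Phi_relations /Phi12val /Phi18val /Phi20val /Phi30val w5 !d //.
by rewrite !mulr0 !expr0n /= !mulr0 subrr.
Qed.

Lemma Phi_generic_point : (forall i, (0 < i < 7)%N -> e i%:Z != 0) ->
  Phi_relations zeta theta_vec.
Proof.
move=> nz.
have n1 : e 1 != 0 := nz 1%N isT. have n2 : e 2 != 0 := nz 2%N isT.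
have n3 : e 3 != 0 := nz 3%N isT. have n4 : e 4 != 0 := nz 4%N isT.
have n5 : e 5 != 0 := nz 5%N isT. have n6 : e 6 != 0 := nz 6%N isT.
(* Both quotients have $T$-weight 0 modulo 13, and $h=-\mathbb D_0/\mathbb D_\infty$. They are
   chosen so that three-term relations make $1+x$, $x-h$, $1+xh$ and $1+x+xh$ monomials in the
   $e_r$. *)
pose h := e 1 * e 3 * e 4 / (e 2 * e 5 * e 6).
pose x := e 2 * e 3 / (e 4 * e 6).
have hn0 : h != 0 by rewrite !(mulf_neq0, invr_neq0).
have xE1 : 1 + x = e 2 * e 3 / (e 1 * e 5).
  apply/eqP; rewrite -subr_eq0; apply/eqP.
  transitivity ((e 1 * e 2 * e 3 * e 5 - e 2 * e 3 * e 4 * e 6 + e 1 * e 4 * e 5 * e 6)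
    / (e 1 * e 4 * e 5 * e 6)); last by rewrite rel1235 mul0r.
  by rewrite /x; field; rewrite n1 n4 n5 n6.
have xE3 : x - h = e 1 ^+ 2 / (e 4 * e 5).
  apply/eqP; rewrite -subr_eq0; apply/eqP.
  transitivity (- (e 1 ^+ 2 * e 2 * e 6 - e 2 ^+ 2 * e 3 * e 5 + e 1 * e 3 * e 4 ^+ 2)
    / (e 2 * e 4 * e 5 * e 6)); last by rewrite rel0124 oppr0 mul0r.
  by rewrite /x /h; field; rewrite n2 n4 n5 n6.
have xhE : 1 + x * h = e 3 * e 4 * e 5 / (e 2 * e 6 ^+ 2).
  apply/eqP; rewrite -subr_eq0; apply/eqP.
  transitivity ((e 1 * e 2 * e 3 ^+ 2 - e 3 * e 4 * e 5 ^+ 2 + e 2 * e 5 * e 6 ^+ 2)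
    / (e 2 * e 5 * e 6 ^+ 2)); last by rewrite rel0356 mul0r.
  by rewrite /x /h; field; rewrite n2 n4 n5 n6.
have xE4 : 1 + x + x * h = e 3 ^+ 3 / (e 1 * e 4 * e 6).
  have -> : 1 + x + x * h = (1 + x * h) + x by ring.
  rewrite xhE; apply/eqP; rewrite -subr_eq0; apply/eqP.
  transitivity (e 3 * (e 1 * e 2 ^+ 2 * e 6 - e 2 * e 3 ^+ 2 * e 6 + e 1 * e 4 ^+ 2 * e 5)
    / (e 1 * e 2 * e 4 * e 6 ^+ 2)); last by rewrite rel0234 mulr0 mul0r.
  by rewrite /x; field; rewrite n1 n2 n4 n6.
have cubic : h * x ^+ 3 + (1 + h - h ^+ 2) * x ^+ 2 + (1 - 2%:R * h - h ^+ 2) * x - h = 0.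
  (* As monomials, the product of the three factors and $xh$ are both $e_1e_3^2/(e_5e_6^2)$. *)
  transitivity ((1 + x) * (x - h) * (1 + x * h) - x * h); first by ring.
  rewrite xE1 xE3 xhE /x /h; field.
  by rewrite n1 n2 n4 n5 n6.
have uE : unitval h x = [:: e 2 * e 3 / (e 4 * e 6); e 2 * e 3 / (e 1 * e 5);
    e 1 * e 3 * e 4 / (e 2 * e 5 * e 6); e 1 ^+ 2 / (e 4 * e 5);
    e 3 ^+ 3 / (e 1 * e 4 * e 6)] by rewrite /unitval xE4 xE3 xE1.
pose s := e 4 / e 1.
(* All five units being monomials in the $e_r$, this is a count of exponents. *)
have s13 : s ^+ 13 = monoval h x sigma_exp.
  rewrite /monoval uE /s /exprz /=; field.
  by rewrite n1 n2 n3 n4 n5 n6.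
have main := curve_point_relations hn0 cubic s13 zeta13 zeta0.
pose b k := basis h x s k.
(* The common factor is read off at the coordinate $e_2$, which is $x\,m_2$ in [kpoint]. *)
pose a := e 2 / (b 2%N * x).
suff -> : theta_vec = [seq a * y | y <- curve_point h x s].
  by apply: Phi_scale main; rewrite /curve_point size_z.
have hf := keval_evaluation hn0 cubic.
have kE i : (i < 5)%N -> keval h x (kunit i) = (unitval h x)`_i by exact: keval_kunit.
rewrite /curve_point /tpoint /kpoint /Tweights; cbn [behead map zip fst snd].
rewrite !teval_single // !expr1n !mul1r.
rewrite (evalN hf) (evalM hf) !kE // /a /b /basis /monoval uE /theta_vec /s /x.
rewrite /exprz /=; congr [:: _; _; _; _; _; _]; field.
all: by rewrite ?n1 ?n2 ?n3 ?n4 ?n5 ?n6.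
Qed.

(** What a vanishing sum of three terms says about zeros: it never has exactly one nonzero term. *)
Definition not_alone (b1 b2 b3 : bool) := [&& b1 ==> b2 || b3, b2 ==> b1 || b3 & b3 ==> b1 || b2].

Lemma not_aloneP (a b c : F) : a - b + c = 0 -> not_alone (a != 0) (b != 0) (c != 0).
Proof.
move=> abc; apply/and3P; split; apply/implyP; apply: contraNT.
- by rewrite negb_or !negbK => /andP[/eqP b0 /eqP c0]; rewrite -abc b0 c0 subr0 addr0.
- rewrite negb_or !negbK => /andP[/eqP a0 /eqP c0].
  by move: abc; rewrite a0 c0 sub0r addr0 => /eqP; rewrite oppr_eq0.
- by rewrite negb_or !negbK => /andP[/eqP a0 /eqP b0]; rewrite -abc a0 b0 subr0 add0r.
Qed.

(** Each term of the twelve relations is a monomial, so their zero patterns are Boolean constraints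
    on which $e_r$ vanish; the 64 cases are examined. *)
Lemma zero_pattern : [&& e 1 != 0, e 2 != 0, e 3 != 0, e 4 != 0, e 5 != 0 & e 6 != 0] ||
  has (fun i0 => all (fun i => (i == i0) || (theta_vec`_i == 0)) (iota 0 6)) (iota 0 6).
Proof.
have expn (a : F) n : (a ^+ n.+1 == 0) = (a == 0) by rewrite expf_eq0.
have := not_aloneP rel1235.
have := not_aloneP rel0356.
have := not_aloneP rel0124.
have := not_aloneP rel0234.
have := not_aloneP rel0134.
have := not_aloneP rel0256.
have := not_aloneP rel0123.
have := not_aloneP rel0145.
have := not_aloneP rel0246.
have := not_aloneP rel0156.
have := not_aloneP rel0235.
have := not_aloneP rel0346.
rewrite /= !oppr_eq0 !(mulf_eq0, expn, negb_or).
by case: (e 1 == 0); case: (e 2 == 0); case: (e 3 == 0); case: (e 4 == 0);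
  case: (e 5 == 0); case: (e 6 == 0).
Qed.

Lemma Phi_theta_vec : Phi_relations zeta theta_vec.
Proof.
case/orP: zero_pattern => [/and5P[n1 n2 n3 n4 /andP[n5 n6]]|/hasP[i0]].
  by apply: Phi_generic_point => -[|[|[|[|[|[|[|i]]]]]]].
rewrite mem_iota => i06 /allP zi; apply: (@Phi_coordinate_point _ i0) => // i ii0.
case: (ltnP i 6) => [i6|i6]; last by rewrite nth_default.
by have := zi i; rewrite mem_iota i6 (negbTE ii0) => /(_ isT)/eqP.
Qed.

End ThreeTerm.

(** * Unconditional sums *)

Section Hsum.
Variable K : numFieldType.
Implicit Types T : choiceType.

(** Convergence along the net of finite subsets, given as duplicate-free lists. It is insensitive to
    the order of summation, as the rotation of the lattice requires. *)
Definition hsum T (f : T -> K) (s : K) := forall eps, 0 < eps ->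
  exists A : seq T, forall B, uniq B -> {subset A <= B} ->
    `|\sum_(i <- B) f i - s| < eps.

Lemma hsum_unique T (f : T -> K) s t : hsum f s -> hsum f t -> s = t.
Proof.
move=> fs ft; apply/eqP; rewrite -subr_eq0 -normr_eq0; apply/negPn/negP => st.
have d0 : 0 < `|s - t| / 2%:R by rewrite divr_gt0 // lt_neqAle eq_sym st normr_ge0.
have [A hA] := fs _ d0; have [A' hA'] := ft _ d0.
pose B := undup (A ++ A').
have Bu : uniq B := undup_uniq _.
have /(hA B Bu) h1 : {subset A <= B} by move=> a aA; rewrite mem_undup mem_cat aA.
have /(hA' B Bu) h2 : {subset A' <= B} by move=> a aA; rewrite mem_undup mem_cat aA orbT.
have : `|s - t| < `|s - t| / 2%:R + `|s - t| / 2%:R.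
  apply: le_lt_trans (ltrD h1 h2); rewrite distrC.
  have -> : t - s = (\sum_(i <- B) f i - s) - (\sum_(i <- B) f i - t) by ring.
  exact: ler_normB.
by rewrite -splitr ltxx.
Qed.

Lemma hsumD T (f g : T -> K) s t : hsum f s -> hsum g t ->
  hsum (fun i => f i + g i) (s + t).
Proof.
move=> fs gt eps e0; have d0 : 0 < eps / 2%:R by rewrite divr_gt0.
have [A hA] := fs _ d0; have [A' hA'] := gt _ d0.
exists (A ++ A') => B Bu AB; rewrite big_split /= opprD addrACA [eps]splitr.
apply: le_lt_trans (ler_normD _ _) (ltrD (hA B Bu _) (hA' B Bu _)).
- by move=> a aA; rewrite AB // mem_cat aA.
- by move=> a aA; rewrite AB // mem_cat aA orbT.
Qed.

Lemma hsumZ T (f : T -> K) s c : hsum f s -> hsum (fun i => c * f i) (c * s).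
Proof.
move=> fs eps e0; have c0 : 0 < `|c| + 1 by rewrite ltr_wpDl.
have [A hA] := fs _ (divr_gt0 e0 c0); exists A => B Bu AB.
rewrite -mulr_sumr -mulrBr normrM.
apply: le_lt_trans (_ : _ <= (`|c| + 1) * `|\sum_(i <- B) f i - s|) _.
  by rewrite ler_wpM2r // lerDl.
by rewrite mulrC -ltr_pdivlMr //; exact: hA.
Qed.

Lemma eq_hsum T (f g : T -> K) s : f =1 g -> hsum f s -> hsum g s.
Proof.
move=> fg fs eps /fs[A hA]; exists A => B Bu AB.
by under eq_bigr do rewrite -fg; exact: hA.
Qed.

Lemma hsum_reindex T T' (g : T' -> T) (f : T -> K) s :
  injective g -> (forall y, exists x, g x = y) ->
  hsum f s -> hsum (f \o g) s.
Proof.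
move=> g_inj g_surj fs eps /fs[A hA].
have [A' A'E] : exists A', map g A' = A.
  elim: (A) => [|a l [A' <-]]; first by exists [::].
  by have [x <-] := g_surj a; exists (x :: A').
exists A' => B Bu AB; rewrite -(big_map g xpredT f); apply: hA.
  by rewrite map_inj_uniq.
by move=> a; rewrite -A'E => /mapP[x /AB xB ->]; apply: map_f.
Qed.

Definition lefts T T' (B : seq (T + T')) := pmap (fun x => if x is inl a then Some a else None) B.
Definition rights T T' (B : seq (T + T')) := pmap (fun x => if x is inr a then Some a else None) B.

Lemma hsum_sum T T' (f : T + T' -> K) s t :
  hsum (fun i => f (inl i)) s -> hsum (fun i => f (inr i)) t -> hsum f (s + t).
Proof.
move=> fs ft eps e0; have d0 : 0 < eps / 2%:R by rewrite divr_gt0.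
have [A hA] := fs _ d0; have [A' hA'] := ft _ d0.
exists (map inl A ++ map inr A') => B Bu AB.
have BE : \sum_(i <- B) f i =
    \sum_(i <- lefts B) f (inl i) + \sum_(i <- rights B) f (inr i).
  elim: (B) => [|[a|a] l IH] /=; rewrite ?big_nil ?addr0 // !big_cons IH.
    by rewrite addrA.
  by rewrite addrCA.
have inlB a : (a \in lefts B) = (inl a \in B).
  by elim: (B) => [|[b|b] l IH] //=; rewrite !inE IH.
have inrB a : (a \in rights B) = (inr a \in B).
  by elim: (B) => [|[b|b] l IH] //=; rewrite !inE IH.
have lu : uniq (lefts B).
  elim: (B) Bu inlB => [|[b|b] l IH] //= /andP[bl lu] inlB.
    have inl' a : (a \in lefts l) = (inl a \in l).
      by elim: (l) => [|[c|c] r IHr] //=; rewrite !inE IHr.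
    by rewrite inl' bl IH.
  by apply: IH => // a; elim: (l) => [|[c|c] r IHr] //=; rewrite !inE IHr.
have ru : uniq (rights B).
  elim: (B) Bu inrB => [|[b|b] l IH] //= /andP[bl ru] inrB.
    by apply: IH => // a; elim: (l) => [|[c|c] r IHr] //=; rewrite !inE IHr.
  have inr' a : (a \in rights l) = (inr a \in l).
    by elim: (l) => [|[c|c] r IHr] //=; rewrite !inE IHr.
  by rewrite inr' bl IH.
rewrite BE opprD addrACA [eps]splitr.
apply: le_lt_trans (ler_normD _ _) (ltrD (hA _ lu _) (hA' _ ru _)).
- by move=> a aA; rewrite inlB AB // mem_cat map_f.
- by move=> a aA; rewrite inrB AB // mem_cat map_f ?orbT.
Qed.

Lemma sum_subset T (f : T -> K) (X B : seq T) : uniq X -> uniq B -> {subset B <= X} ->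
  \sum_(i <- X) f i = \sum_(i <- B) f i + \sum_(i <- X | i \notin B) f i.
Proof.
move=> Xu Bu BX; rewrite (bigID (mem B)) /=; congr (_ + _).
rewrite -big_filter; apply: perm_big; apply: uniq_perm => //.
  exact: filter_uniq.
by move=> a; rewrite mem_filter; case aB: (a \in B); rewrite //= BX.
Qed.

Lemma mulr_near (s t eps : K) : 0 < eps -> exists2 d, 0 < d &
  forall a b, `|a - s| < d -> `|b - t| < d -> `|a * b - s * t| < eps.
Proof.
move=> e0; pose c := `|s| + `|t| + 1.
have c0 : 0 < c by rewrite ltr_wpDl // addr_ge0.
have [d d0 [d1 dc]] : exists2 d, 0 < d & d <= 1 /\ d * c <= eps.
  (* This one choice gives both $d\le1$ and $dc\le\varepsilon$. *)
  exists (eps / (eps + c)); first by rewrite divr_gt0 // addr_gt0.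
  have ec : 0 < eps + c by rewrite addr_gt0.
  rewrite ler_pdivrMr // mul1r lerDl ltW //; split=> //.
  by rewrite mulrAC ler_pdivrMr // ler_pM2l // lerDr ltW.
exists d => // a b ad bd.
have -> : a * b - s * t = (a - s) * b + s * (b - t) by ring.
apply: le_lt_trans (ler_normD _ _) _; rewrite !normrM.
have bt : `|b| < `|t| + 1.
  have -> : b = t + (b - t) by ring.
  apply: le_lt_trans (ler_normD _ _) _; rewrite ltrD2l.
  exact: lt_le_trans bd d1.
apply: lt_le_trans dc.
have -> : d * c = d * (`|t| + 1) + `|s| * d by rewrite /c; ring.
apply: ltr_leD; first by rewrite ltr_pM.
by rewrite ler_wpM2l // ltW.
Qed.

Lemma ler_sum_subset T (f : T -> K) (X B : seq T) : (forall i, 0 <= f i) ->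
  uniq X -> uniq B -> {subset B <= X} -> \sum_(i <- B) f i <= \sum_(i <- X) f i.
Proof.
move=> f0 Xu Bu BX; rewrite (sum_subset _ Xu Bu BX) lerDl.
exact: sumr_ge0.
Qed.

(** A finite set containing $A\times A'$ lies in a rectangle $P\times Q$, whose sum is a product
    close to $st$. What the rectangle has in excess lies outside $A\times A'$, so it is bounded by
    the difference of two products of sums of absolute values, both close to $s't'$. *)
Lemma hsum_prod T T' (f : T -> K) (g : T' -> K) s t s' t' :
  hsum f s -> hsum g t -> hsum (fun i => `|f i|) s' -> hsum (fun i => `|g i|) t' ->
  hsum (fun p => f p.1 * g p.2) (s * t).
Proof.
move=> fs gt fs' gt' eps e0; have eps3 : 0 < eps / 3%:R by rewrite divr_gt0.
have [d d0 hd] := mulr_near s t eps3; have [d' d'0 hd'] := mulr_near s' t' eps3.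
have [A1 hA1] := fs _ d0; have [A2 hA2] := fs' _ d'0.
have [A1' hA1'] := gt _ d0; have [A2' hA2'] := gt' _ d'0.
pose A := undup (A1 ++ A2); pose A' := undup (A1' ++ A2').
have Au : uniq A := undup_uniq _; have A'u : uniq A' := undup_uniq _.
have A1A : {subset A1 <= A} by move=> a aA; rewrite mem_undup mem_cat aA.
have A2A : {subset A2 <= A} by move=> a aA; rewrite mem_undup mem_cat aA orbT.
have A1A' : {subset A1' <= A'} by move=> a aA; rewrite mem_undup mem_cat aA.
have A2A' : {subset A2' <= A'} by move=> a aA; rewrite mem_undup mem_cat aA orbT.
pose pr (P : seq T) (Q : seq T') := [seq (p, q) | p <- P, q <- Q].
have pr_uniq P Q : uniq P -> uniq Q -> uniq (pr P Q).
  by move=> Pu Qu; apply: allpairs_uniq => // -[a b] [c e] _ _.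
exists (pr A A') => B Bu AB.
pose P := undup (A ++ map fst B); pose Q := undup (A' ++ map snd B).
have Pu : uniq P := undup_uniq _; have Qu : uniq Q := undup_uniq _.
have AP : {subset A <= P} by move=> a aA; rewrite mem_undup mem_cat aA.
have AQ : {subset A' <= Q} by move=> a aA; rewrite mem_undup mem_cat aA.
have BX : {subset B <= pr P Q}.
  case=> a b ab; apply/allpairsP; exists (a, b); split=> //=.
    by rewrite mem_undup mem_cat (map_f fst ab) orbT.
  by rewrite mem_undup mem_cat (map_f snd ab) orbT.
have prE (u : T -> K) (v : T' -> K) P' Q' :
    \sum_(i <- pr P' Q') u i.1 * v i.2 = (\sum_(i <- P') u i) * (\sum_(i <- Q') v i).
  by rewrite /pr big_allpairs mulr_suml; apply: eq_bigr => i _; rewrite mulr_sumr.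
have XB := sum_subset (fun i => f i.1 * g i.2) (pr_uniq _ _ Pu Qu) Bu BX.
have XB' := sum_subset (fun i => `|f i.1| * `|g i.2|) (pr_uniq _ _ Pu Qu) Bu BX.
rewrite (prE f g) in XB.
rewrite (prE (fun i => `|f i|) (fun i => `|g i|)) in XB'.
have near1 : `|(\sum_(i <- P) f i) * (\sum_(i <- Q) g i) - s * t| < eps / 3%:R.
  apply: hd; [apply: hA1 => // a /A1A/AP // | apply: hA1' => // a /A1A'/AQ //].
have near2 : `|(\sum_(i <- P) `|f i|) * (\sum_(i <- Q) `|g i|) - s' * t'| < eps / 3%:R.
  apply: hd'; [apply: hA2 => // a /A2A/AP // | apply: hA2' => // a /A2A'/AQ //].
have near3 : `|(\sum_(i <- A) `|f i|) * (\sum_(i <- A') `|g i|) - s' * t'| < eps / 3%:R.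
  by apply: hd'; [apply: hA2 | apply: hA2'].
have rest : \sum_(i <- pr P Q | i \notin B) `|f i.1| * `|g i.2| < eps / 3%:R + eps / 3%:R.
  apply: le_lt_trans (ltrD near2 near3).
  have -> : \sum_(i <- pr P Q | i \notin B) `|f i.1| * `|g i.2| =
    (\sum_(i <- P) `|f i|) * (\sum_(i <- Q) `|g i|) - \sum_(i <- B) `|f i.1| * `|g i.2|.
    by rewrite XB' [X in X - _]addrC addrK.
  have le_AB : (\sum_(i <- A) `|f i|) * (\sum_(i <- A') `|g i|) <=
      \sum_(i <- B) `|f i.1| * `|g i.2|.
    rewrite -(prE (fun i => `|f i|) (fun i => `|g i|)).
    have fg0 (i : T * T') : 0 <= `|f i.1| * `|g i.2| by rewrite mulr_ge0.
    exact: ler_sum_subset fg0 Bu (pr_uniq _ _ Au A'u) AB.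
  apply: le_trans (_ : _ <= (\sum_(i <- P) `|f i|) * (\sum_(i <- Q) `|g i|) -
    (\sum_(i <- A) `|f i|) * (\sum_(i <- A') `|g i|)) _; first by rewrite lerD2l lerN2.
  set p := _ * _; set q := _ * _.
  (* The order of [K] may be partial, so a difference must be known to be real before it is compared
     with its norm. *)
  have pq : p - q \is Num.real.
    by apply: rpredB; apply: ger0_real; apply: mulr_ge0; apply: sumr_ge0.
  apply: le_trans (real_ler_norm pq) _.
  have -> : p - q = (p - s' * t') - (q - s' * t') by ring.
  exact: ler_normB.
have -> : \sum_(i <- B) f i.1 * g i.2 - s * t =
  ((\sum_(i <- P) f i) * (\sum_(i <- Q) g i) - s * t) -
  \sum_(i <- pr P Q | i \notin B) f i.1 * g i.2 by rewrite XB; ring.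
apply: le_lt_trans (ler_normB _ _) _.
have -> : eps = eps / 3%:R + (eps / 3%:R + eps / 3%:R) by field.
apply: ltrD near1 _; apply: le_lt_trans (ler_norm_sum _ _ _) _.
by under eq_bigr do rewrite normrM.
Qed.

End Hsum.

Local Open Scope classical_set_scope.
Local Open Scope ring_scope.

(** * Absolutely convergent sums of complex numbers *)

Section AbsoluteConvergence.
Variable R : realType.
Local Notation C := (Cx R).

Lemma ofRD (x y : R) : ofR (x + y) = ofR x + ofR y.
Proof. exact: (rmorphD (real_complex R)). Qed.
Lemma ofRM (x y : R) : ofR (x * y) = ofR x * ofR y.
Proof. exact: (rmorphM (real_complex R)). Qed.
Lemma ofRN (x : R) : ofR (- x) = - ofR x.
Proof. exact: (rmorphN (real_complex R)). Qed.
Lemma ofRV (x : R) : ofR x^-1 = (ofR x)^-1.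
Proof. exact: (fmorphV (real_complex R)). Qed.
Lemma ofR_nat n : ofR n%:R = n%:R :> C.
Proof. exact: (rmorph_nat (real_complex R)). Qed.
Lemma ofR_int (n : int) : ofR n%:~R = n%:~R :> C.
Proof. exact: (rmorph_int (real_complex R)). Qed.
Lemma ofR_sum (I : Type) (r : seq I) (f : I -> R) :
  ofR (\sum_(i <- r) f i) = \sum_(i <- r) ofR (f i).
Proof. exact: (rmorph_sum (real_complex R)). Qed.
Lemma ofR_ltr (x y : R) : (ofR x < ofR y) = (x < y).
Proof. exact: ltcR. Qed.

Definition mag (z : C) : R := complex.Re `|z|.

Lemma magE z : `|z| = ofR (mag z).
Proof. by rewrite /ofR /mag RRe_real // normr_real. Qed.

Lemma mag_sqrt (z : C) : mag z = Num.sqrt (complex.Re z ^+ 2 + complex.Im z ^+ 2).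
Proof. by rewrite /mag (normc_def (z : R[i])). Qed.

Lemma mag_ge0 z : 0 <= mag z.
Proof. by rewrite mag_sqrt sqrtr_ge0. Qed.

Lemma mag_ofR (x : R) : mag (ofR x) = `|x|.
Proof. by rewrite mag_sqrt /= expr0n /= addr0 sqrtr_sqr. Qed.

Lemma magM (z w : C) : mag (z * w) = mag z * mag w.
Proof. by apply: (@complexI R); rewrite -[LHS]magE normrM !magE -ofRM. Qed.

Lemma Re_mag (z : C) : 0 <= complex.Re z + mag z.
Proof.
have : `|complex.Re z| <= mag z.
  by rewrite mag_sqrt -sqrtr_sqr ler_wsqrtr // lerDl sqr_ge0.
by rewrite ler_norml -[X in X <= _]add0r lerBlDr => /andP[].
Qed.

Lemma Im_mag (z : C) : 0 <= complex.Im z + mag z.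
Proof.
have : `|complex.Im z| <= mag z.
  by rewrite mag_sqrt -sqrtr_sqr ler_wsqrtr // lerDr sqr_ge0.
by rewrite ler_norml -[X in X <= _]add0r lerBlDr => /andP[].
Qed.

Definition bounded_sums (T : choiceType) (f : T -> R) :=
  exists M, forall B : seq T, uniq B -> \sum_(i <- B) f i <= M.

Lemma hsum_nneg (T : choiceType) (f : T -> R) :
  (forall i, 0 <= f i) -> bounded_sums f -> exists s, hsum (fun i => ofR (f i) : C) s.
Proof.
move=> f0 [M hM].
pose S := [set x | exists2 B : seq T, uniq B & x = \sum_(i <- B) f i].
have supS : has_sup S.
  split; first by exists 0, [::]; rewrite // big_nil.
  by exists M => _ [B Bu ->]; exact: hM.
exists (ofR (sup S)) => eps e0.
have [e e_gt0 ->] : exists2 e : R, 0 < e & eps = ofR e.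
  move: e0; case: eps => a b; rewrite ltcE /= => /andP[/eqP -> a0].
  by exists a.
have [_ [A Au ->] hA] := sup_adherent e_gt0 supS.
exists A => B Bu AB; rewrite -ofR_sum -ofRN -ofRD magE mag_ofR ofR_ltr.
have le1 : \sum_(i <- B) f i <= sup S by apply: ub_le_sup; [case: supS|exists B].
have le2 := ler_sum_subset f0 Bu Au AB.
by rewrite distrC ger0_norm ?subr_ge0 //; lra.
Qed.

(** The nonnegative families $\mathrm{Re} f+|f|$, $\mathrm{Im} f+|f|$ and $|f|$ are summable, and
    [f] is a linear combination of them. *)
Lemma hsum_exists (T : choiceType) (f : T -> C) : bounded_sums (fun i => mag (f i)) ->
  (exists s, hsum f s) /\ (exists s, hsum (fun i => `|f i|) s).
Proof.
move=> [M hM]; have mag_ex : exists s, hsum (fun i => ofR (mag (f i)) : C) s.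
  by apply: hsum_nneg; [move=> i; exact: mag_ge0 | exists M].
have part (g : T -> R) : (forall i, 0 <= g i + mag (f i)) -> (forall i, g i <= mag (f i)) ->
    exists s, hsum (fun i => ofR (g i + mag (f i)) : C) s.
  move=> g0 gm; apply: hsum_nneg => //; exists (M + M) => B Bu.
  apply: le_trans (lerD (hM B Bu) (hM B Bu)); rewrite -big_split /=.
  by apply: ler_sum => i _; rewrite lerD2r.
have [s1 h1] : exists s, hsum (fun i => ofR (complex.Re (f i) + mag (f i)) : C) s.
  apply: part => i; first exact: Re_mag.
  by have := Re_mag (- f i); rewrite raddfN /= /mag normrN; lra.
have [s2 h2] : exists s, hsum (fun i => ofR (complex.Im (f i) + mag (f i)) : C) s.
  apply: part => i; first exact: Im_mag.
  by have := Im_mag (- f i); rewrite raddfN /= /mag normrN; lra.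
have [s0 h0] := mag_ex.
split; last by exists s0; apply: eq_hsum h0 => i; rewrite magE.
exists ((s1 + -1 * s0) + iC R * (s2 + -1 * s0)).
apply: eq_hsum (hsumD (hsumD h1 (hsumZ (-1) h0)) (hsumZ (iC R) (hsumD h2 (hsumZ (-1) h0)))).
move=> i /=; rewrite !ofRD [RHS](complexE (f i : R[i])) -/(ofR _) -/(ofR (complex.Im _)).
by rewrite /iC; ring.
Qed.

Lemma hsum_series (f : nat -> C) s : hsum f s -> limn (series f) = s.
Proof.
move=> fs; apply: cvg_lim; first exact: norm_hausdorff.
apply/cvgrPdist_lt => eps e0; have [A hA] := fs _ e0.
have [N hN] : exists N, forall a, a \in A -> (a < N)%N.
  elim: (A) => [|b l [N hN]]; first by exists 0%N.
  exists (maxn b.+1 N) => a; rewrite inE leq_max => /orP[/eqP ->|/hN ->].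
    by rewrite leqnn.
  by rewrite orbT.
exists N => // n /= Nn; rewrite distrC /series /=.
apply: hA; first exact: iota_uniq.
by move=> a aA; rewrite mem_index_iota; apply: leq_trans (hN a aA) Nn.
Qed.

Lemma bounded_sums_inj (T T' : choiceType) (g : T' -> T) (f : T -> R) :
  injective g -> bounded_sums f -> bounded_sums (f \o g).
Proof.
move=> g_inj [M hM]; exists M => B Bu.
by rewrite -(big_map g xpredT f); apply: hM; rewrite map_inj_uniq.
Qed.

(** The integers are the disjoint union of the $n$ and the $-n-1$ for $n\ge0$; on each half the
    unconditional sum is the limit of the series. *)
Lemma hsum_sumZ (f : int -> C) : bounded_sums (fun i => mag (f i)) -> hsum f (sumZ f).
Proof.
move=> fb; have [[s fs] _] := hsum_exists fb.
pose g1 := fun n : nat => n%:Z; pose g2 := fun n : nat => (- n.+1%:Z)%R.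
have g1_inj : injective g1 by move=> m n [].
have g2_inj : injective g2 by move=> m n /oppr_inj[].
have [[s1 h1] _] := hsum_exists (bounded_sums_inj g1_inj fb : bounded_sums (fun i => mag (f (g1 i)))).
have [[s2 h2] _] := hsum_exists (bounded_sums_inj g2_inj fb : bounded_sums (fun i => mag (f (g2 i)))).
suff <- : s1 + s2 = sumZ f.
  pose g (x : nat + nat) := match x with inl n => g1 n | inr n => g2 n end.
  have fg := @hsum_sum _ _ _ (f \o g) s1 s2 h1 h2.
  have <- // : s = s1 + s2.
  apply: hsum_unique fg; apply: hsum_reindex fs.
    by move=> [m|m] [n|n] //= => [/g1_inj -> | /g2_inj ->].
  by move=> [n|n]; [exists (inl n) | exists (inr n); rewrite /= /g2 NegzE].
by rewrite /sumZ (hsum_series h1) (hsum_series h2).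
Qed.

End AbsoluteConvergence.

(** * Theta series and their product formula *)

Section Theta.
Variable R : realType.
Local Notation C := (Cx R).

Lemma cexpD (a b : C) : cexp (a + b) = cexp a * cexp b.
Proof.
case: a b => [a1 a2] [b1 b2]; rewrite /cexp /= expRD cosD sinD.
have i2 : iC R * iC R = -1 by rewrite -expr2; exact: (sqr_i R).
rewrite !(ofRD, ofRM, ofRN).
transitivity (ofR (expR a1) * ofR (expR b1) *
  ((ofR (cos a2) * ofR (cos b2) + (iC R * iC R) * (ofR (sin a2) * ofR (sin b2))) +
   iC R * (ofR (sin a2) * ofR (cos b2) + ofR (cos a2) * ofR (sin b2)))); last by ring.
by rewrite i2 mulN1r.
Qed.

Lemma cexp0 : cexp 0 = 1 :> C.
Proof.
rewrite /cexp /= expR0 cos0 sin0.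
by rewrite -[ofR 1]/(1 : C) -[ofR 0]/(0 : C) mul1r mulr0 addr0.
Qed.

Lemma mag_cexp (a : C) : mag (cexp a) = expR (complex.Re a).
Proof.
rewrite /cexp magM mag_ofR ger0_norm ?expR_ge0 // mag_sqrt.
have -> : ofR (cos (complex.Im a)) + iC R * ofR (sin (complex.Im a)) =
    Complex (cos (complex.Im a)) (sin (complex.Im a)) :> C.
  by rewrite [RHS](complexE (Complex _ _)).
by rewrite /= cos2Dsin2 sqrtr1 mulr1.
Qed.

Lemma e2piiD (a b : C) : e2pii (a + b) = e2pii a * e2pii b.
Proof. by rewrite /e2pii mulrDr cexpD. Qed.

Lemma e2pii0 : e2pii 0 = 1 :> C.
Proof. by rewrite /e2pii mulr0 cexp0. Qed.

Lemma e2piiMn (a : C) n : e2pii (a *+ n) = e2pii a ^+ n.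
Proof. by elim: n => [|n IHn]; rewrite ?e2pii0 // mulrS e2piiD IHn exprS. Qed.

Lemma mag_e2pii (t : R) (z : C) : mag (e2pii (ofR t * z)) =
  expR (- (2 * pi * complex.Im z) * t).
Proof.
rewrite /e2pii mag_cexp; congr expR.
have -> : 2 * ofR pi * iC R * (ofR t * z) = ofR (2 * pi * t) * (z * 'i%C).
  by rewrite !ofRM ofR_nat /iC; ring.
by case: z => a b; rewrite /ofR /=; ring.
Qed.

Lemma e2pii_half : e2pii 2^-1 = -1 :> C.
Proof.
have -> : (2^-1 : C) = ofR 2^-1 by rewrite ofRV ofR_nat.
have -> : e2pii (ofR 2^-1) = cexp (ofR pi * iC R).
  by rewrite /e2pii ofRV ofR_nat; congr cexp; field.
have -> : ofR pi * iC R = Complex 0 pi by rewrite /ofR /iC; simpc.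
rewrite /cexp /= expR0 cospi sinpi -[ofR 0]/(0 : C) -[ofR 1]/(1 : C) ofRN.
by rewrite mulr0 addr0 mul1r.
Qed.

Definition sgn (n : int) : C := (-1) ^ n.

Lemma sgnE n : e2pii (n%:~R / 2) = sgn n.
Proof.
have posE (k : nat) : e2pii (k%:R / 2) = (-1) ^+ k :> C.
  by rewrite mulr_natl e2piiMn e2pii_half.
case: n => n; rewrite /sgn; first exact: posE.
apply: (@mulfI _ ((-1) ^+ n.+1)); first by rewrite signr_eq0.
have -> : (-1 : C) ^ Negz n = ((-1) ^+ n.+1)^-1 by [].
by rewrite -{1}posE -e2piiD NegzE mulrNz mulNr subrr e2pii0 mulfV ?signr_eq0.
Qed.

Lemma sgnD m n : sgn (m + n) = sgn m * sgn n.
Proof. by rewrite /sgn expfzDr // oppr_eq0 oner_eq0. Qed.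

Lemma sgnN n : sgn (- n) = sgn n.
Proof.
have posE (k : nat) : sgn (- k%:Z) = sgn k%:Z by rewrite /sgn -exprnN invr_sign.
by case: n => n; rewrite ?posE // NegzE opprK -posE.
Qed.

Lemma sgn1 : sgn 1 = -1.
Proof. by rewrite /sgn expr1z. Qed.

Lemma sgn_sqr n : sgn n * sgn n = 1.
Proof. by rewrite -[X in X * _]sgnN -sgnD addNr /sgn expr0z. Qed.

Lemma mag_sgn n : mag (sgn n) = 1.
Proof.
have -> : sgn n = e2pii (ofR (n%:~R / 2) * 1) by rewrite mulr1 ofRM ofRV ofR_nat ofR_int sgnE.
by rewrite mag_e2pii /= mulr0 oppr0 mul0r expR0.
Qed.

Lemma geometric_bound (rho : R) : 0 <= rho < 1 ->
  bounded_sums (fun n : int => rho ^+ absz n).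
Proof.
move=> /andP[r0 r1]; have r1' : 0 < 1 - rho by rewrite subr_gt0.
have nat_bound (B : seq nat) : uniq B -> \sum_(k <- B) rho ^+ k <= (1 - rho)^-1.
  move=> Bu; have [N hN] : exists N, forall a, a \in B -> (a < N)%N.
    elim: (B) => [|b l [N hN]]; first by exists 0%N.
    exists (maxn b.+1 N) => a; rewrite inE leq_max => /orP[/eqP ->|/hN ->].
      by rewrite leqnn.
    by rewrite orbT.
  have BN : {subset B <= iota 0 N} by move=> a /hN aN; rewrite mem_iota.
  apply: le_trans (ler_sum_subset (fun i => exprn_ge0 i r0) (iota_uniq 0 N) Bu BN) _.
  have -> : \sum_(i <- iota 0 N) rho ^+ i = \sum_(i < N) rho ^+ i.
    by rewrite -(big_mkord xpredT (fun k => rho ^+ k)) /index_iota subn0.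
  rewrite -[X in _ <= X]mul1r ler_pdivlMr //.
  have := subrX1 rho N; have := exprn_ge0 N r0; set S := \sum_(i < N) _.
  by move=> h1 h2; nra.
exists ((1 - rho)^-1 + (1 - rho)^-1) => B Bu.
rewrite (bigID (fun n : int => 0 <= n)) /=; apply: lerD.
  rewrite -big_filter -(big_map absz xpredT (fun k => rho ^+ k)); apply: nat_bound.
  rewrite map_inj_in_uniq ?filter_uniq // => m n.
  by rewrite !mem_filter => /andP[m0 _] /andP[n0 _]; lia.
rewrite -big_filter -(big_map absz xpredT (fun k => rho ^+ k)); apply: nat_bound.
rewrite map_inj_in_uniq ?filter_uniq // => m n.
by rewrite !mem_filter => /andP[m0 _] /andP[n0 _]; lia.
Qed.

Lemma expRXn (x : R) n : expR x ^+ n = expR (x * n%:R).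
Proof.
elim: n => [|n IHn]; first by rewrite mulr0 expR0.
by rewrite exprS IHn -expRD -natr1 mulrDr mulr1 addrC.
Qed.

(** From $(an+b)^2=\frac12a^2n^2+\frac12(an+2b)^2-b^2$ and $n^2\ge|n|$, the terms are at most
    $e^{cb^2}\rho^{|n|}$ with $\rho=e^{-ca^2/2}$. *)
Lemma gaussian_bound (c a b : R) : 0 < c -> a != 0 ->
  bounded_sums (fun n : int => expR (- c * (a * n%:~R + b) ^+ 2)).
Proof.
move=> c0 a0; have a2 : 0 < a ^+ 2 by rewrite exprn_even_gt0.
pose rho := expR (- (c * a ^+ 2 / 2)).
have rho1 : 0 <= rho < 1 by rewrite expR_ge0 /= expR_lt1 oppr_lt0 divr_gt0 // mulr_gt0.
have [M hM] := geometric_bound rho1; exists (expR (c * b ^+ 2) * M) => B Bu.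
apply: le_trans (ler_wpM2l (expR_ge0 _) (hM B Bu)).
rewrite mulr_sumr; apply: ler_sum => n _; rewrite expRXn -expRD ler_expR.
have nn : (absz n)%:R <= (n%:~R : R) ^+ 2.
  have -> : (n%:~R : R) ^+ 2 = (absz n)%:R ^+ 2.
    by rewrite natr_absz intr_norm real_normK ?num_real.
  by rewrite -natrX ler_nat -mulnn; case: (absz n) => // k; exact: leq_pmulr.
have sq : 0 <= (a * n%:~R + 2 * b) ^+ 2 by rewrite sqr_ge0.
set m := n%:~R in nn sq *; set N := (absz n)%:R in nn *.
have h1 : 0 <= c * (a * m + 2 * b) ^+ 2 by rewrite mulr_ge0 // ltW.
have h2 : 0 <= c * a ^+ 2 * (m ^+ 2 - N) by rewrite mulr_ge0 ?subr_ge0 // ltW // mulr_gt0.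
by nra.
Qed.

Variable z : C.
Hypothesis z_gt0 : 0 < complex.Im z.

Definition Q (t : R) : C := e2pii (ofR t * z).

Lemma QD s t : Q (s + t) = Q s * Q t.
Proof. by rewrite /Q ofRD mulrDl e2piiD. Qed.

Definition eterm (r n : int) : C := sgn n * Q ((13 * n%:~R + (13 / 2 - r%:~R)) ^+ 2 / 26).
(** For $A=13m+\frac{13}2-(i+j)$ and $B=13n+\frac{13}2-(i-j)$ one has
    $(A^2+B^2)/26=((A+B)^2+(A-B)^2)/52$. If $m+n=2u$ and $m-n=2v$, then $A+B$ and $A-B$ are the
    bases in [Oterm i u] and [Eterm j v]. *)
Definition Oterm (i u : int) : C := Q ((26 * u%:~R + (13 - 2 * i%:~R)) ^+ 2 / 52).
Definition Eterm (j v : int) : C := Q ((26 * v%:~R + - (2 * j%:~R)) ^+ 2 / 52).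
Definition eval_e r := sumZ (eterm r).
Definition eval_O i := sumZ (Oterm i).
Definition eval_E j := sumZ (Eterm j).

Lemma Q_bounded (a b d : R) : a != 0 -> 0 < d ->
  bounded_sums (fun n : int => mag (Q ((a * n%:~R + b) ^+ 2 / d))).
Proof.
move=> a0 d0; have c0 : 0 < 2 * pi * complex.Im z / d.
  by rewrite divr_gt0 // mulr_gt0 // mulr_gt0 // pi_gt0.
have [M hM] := gaussian_bound b c0 a0; exists M => B Bu.
apply: le_trans (hM B Bu); apply: ler_sum => n _.
by rewrite /Q mag_e2pii ler_expR le_eqVlt; apply/orP; left; apply/eqP; field; rewrite gt_eqF.
Qed.

Lemma eterm_bounded r : bounded_sums (fun n => mag (eterm r n)).
Proof.
have n13 : (13 : R) != 0 by rewrite pnatr_eq0.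
have p26 : 0 < (26 : R) by rewrite ltr0n.
have [M hM] := Q_bounded (13 / 2 - r%:~R) n13 p26.
exists M => B /hM; congr (_ <= _); apply: eq_bigr => n _.
by rewrite [RHS](magM (sgn n)) mag_sgn mul1r.
Qed.

Lemma eterm_hsum r : hsum (eterm r) (eval_e r).
Proof. exact: hsum_sumZ (eterm_bounded r). Qed.
Lemma Oterm_bounded i : bounded_sums (fun n => mag (Oterm i n)).
Proof. exact: (@Q_bounded 26 (13 - 2 * i%:~R) 52). Qed.
Lemma Eterm_bounded i : bounded_sums (fun n => mag (Eterm i n)).
Proof. exact: (@Q_bounded 26 (- (2 * i%:~R)) 52). Qed.

Lemma eval_e_opp r : eval_e (- r) = - eval_e r.
Proof.
(* Under $n\mapsto-1-n$ the number $13n+\frac{13}2+r$ becomes $-(13n+\frac{13}2-r)$, while the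
   parity of $n$ flips; this produces the sign. *)
have g_inj : injective (fun n : int => -1 - n) by move=> m n /=; lia.
have g_surj (n : int) : exists m : int, -1 - m = n by exists (-1 - n); lia.
apply: hsum_unique (hsum_reindex g_inj g_surj (eterm_hsum (- r))) _.
rewrite -[- eval_e r]mulN1r; apply: eq_hsum (hsumZ (-1) (eterm_hsum r)) => n /=.
have sE : sgn (-1 - n) = - sgn n.
  by rewrite sgnD (sgnN 1 : sgn (-1) = _) sgn1 mulN1r sgnN.
rewrite mulN1r /eterm sE mulNr.
by congr (- (_ * Q _)); rewrite !(rmorphD, rmorphN, rmorph1) /=; field.
Qed.

Lemma eval_e_refl r : eval_e (13 - r) = eval_e r.
Proof.
have g_surj (n : int) : exists m : int, - m = n by exists (- n); lia.
apply: hsum_unique (hsum_reindex (@oppr_inj int) g_surj (eterm_hsum (13 - r))) _.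
apply: eq_hsum (eterm_hsum r) => n /=; rewrite /eterm sgnN.
by congr (_ * Q _); rewrite !(rmorphD, rmorphN) /=; field.
Qed.

(** A bijection: the two summands parametrise the pairs of equal and of different parity. *)
Definition parity_map (x : (int * int) + (int * int)) : int * int :=
  match x with
  | inl p => (p.1 + p.2, p.1 - p.2)
  | inr p => (p.1 + p.2 + 1, p.1 - p.2)
  end.

(* Rotating the lattice by [(m, n) -> (m + n, m - n)] decouples the two sums. *)
Lemma eval_e_prod i j : eval_e (i + j) * eval_e (i - j) =
  eval_O i * eval_E j - eval_O j * eval_E i.
Proof.
have abs_sum r : exists s, hsum (fun n => `|eterm r n|) s.
  by case: (hsum_exists (eterm_bounded r)).
have [s' hs'] := abs_sum (i + j); have [t' ht'] := abs_sum (i - j).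
have hprod := hsum_prod (eterm_hsum (i + j)) (eterm_hsum (i - j)) hs' ht'.
have OE k l : hsum (fun p => Oterm k p.1 * Eterm l p.2) (eval_O k * eval_E l).
  have [_ [s1 h1]] := hsum_exists (Oterm_bounded k).
  have [_ [s2 h2]] := hsum_exists (Eterm_bounded l).
  exact: hsum_prod (hsum_sumZ (Oterm_bounded k)) (hsum_sumZ (Eterm_bounded l)) h1 h2.
(* When $m+n=2u+1$ and $m-n=2v+1$, $A+B=26(u+1)-2i$ and $A-B=26v+13-2j$: the roles of [O] and [E]
   are exchanged, the index of [E] is shifted by one, and $(-1)^{m+n}=-1$. *)
have OE' : hsum (fun p : int * int => -1 * (Oterm j p.2 * Eterm i (p.1 + 1)))
    (-1 * (eval_O j * eval_E i)).
  apply: (hsumZ (-1)).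
  apply: (hsum_reindex (g := fun p : int * int => (p.2, p.1 + 1)) _ _ (OE j i)).
    by move=> [a b] [c d] /= [-> h]; congr (_, _); lia.
  by move=> [a b]; exists (b - 1, a); rewrite /= subrK.
rewrite -[- (eval_O j * _)]mulN1r.
apply: hsum_unique (hsum_reindex (g := parity_map) _ _ hprod) _.
- move=> [[a b]|[a b]] [[c d]|[c d]] /= [] h1 h2; try (exfalso; lia).
    by congr (inl (_, _)); lia.
  by congr (inr (_, _)); lia.
- move=> [m n]; pose u := ((m + n) %/ 2)%Z; have uE := divz_eq (m + n) 2.
  have r2 : 0 <= ((m + n) %% 2)%Z < 2 by rewrite modz_ge0 // ltz_pmod.
  have [r0|r1] : ((m + n) %% 2)%Z = 0 \/ ((m + n) %% 2)%Z = 1 by lia.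
    by exists (inl (u, m - u)); rewrite /= /u; congr (_, _); lia.
  by exists (inr (u, m - 1 - u)); rewrite /= /u; congr (_, _); lia.
apply: hsum_sum.
  apply: eq_hsum (OE i j) => -[u v] /=; rewrite /eterm /Oterm /Eterm -QD.
  rewrite mulrACA -sgnD (_ : u + v + (u - v) = u + u); last by lia.
  rewrite sgnD sgn_sqr mul1r -QD; congr Q.
  by rewrite !(rmorphD, rmorphN) /=; field.
apply: eq_hsum OE' => -[u v] /=; rewrite /eterm /Oterm /Eterm -QD.
rewrite mulrACA -sgnD (_ : u + v + 1 + (u - v) = u + u + 1); last by lia.
rewrite sgnD sgnD sgn_sqr sgn1 mul1r -QD; congr (_ * Q _).
by rewrite !(rmorphD, rmorphN) /=; field.
Qed.

(* [theta13 c] is normalised so that its terms are [(-1)^n q^((13n + c/2)^2/26)]. *)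
Lemma theta13E (r : int) : theta13 (13 - 2 * r%:~R) z = eval_e r.
Proof.
set c : R := 13 - 2 * r%:~R; rewrite /theta13 /theta.
set pre := cexp _; set f := fun n : int => e2pii _.
have fE n : pre * f n = eterm r n.
  have -> : pre = e2pii (ofR (- (c / 52))).
    rewrite /pre /e2pii; congr cexp; rewrite !(ofRN, ofRM, ofRV, ofR_nat).
    by field.
  rewrite /f -e2piiD /eterm -sgnE /Q -e2piiD; congr e2pii.
  rewrite /c !(ofRD, ofRN, ofRM, ofRV, ofR_nat, ofR_int, expr2) -[ofR 1]/(1 : C).
  by field.
have pre0 : pre != 0.
  have : pre * cexp (ofR (c * pi / 26) * iC R) = 1.
    by rewrite /pre -cexpD mulNr addNr cexp0.
  by apply: contra_eq_neq => ->; rewrite mul0r eq_sym oner_eq0.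
have fb : bounded_sums (fun n => mag (f n)).
  have [M hM] := eterm_bounded r; exists ((mag pre)^-1 * M) => B Bu.
  have mp : 0 < mag pre.
    rewrite lt_neqAle mag_ge0 andbT eq_sym; apply: contra pre0 => /eqP m0.
    by rewrite -normr_eq0 magE m0.
  rewrite mulrC ler_pdivlMr // mulrC mulr_sumr; apply: le_trans (hM B Bu).
  by under eq_bigr do rewrite -magM fE.
apply: hsum_unique (eterm_hsum r); apply: eq_hsum fE _.
exact: hsumZ (hsum_sumZ fb).
Qed.

End Theta.

(** * The theorem *)

Section Values.
Variable R : realType.
Local Notation C := (Cx R).
Local Notation zeta := (zeta R).

Lemma zeta_exp n : zeta ^+ n = e2pii (n%:R / 13).
Proof. by rewrite /Defs.zeta -e2piiMn mulr_natl. Qed.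

Lemma zeta13 : zeta ^+ 13 = 1.
Proof.
rewrite zeta_exp mulfV ?pnatr_eq0 //.
have -> : (1 : C) = 2^-1 + 2^-1 by field.
by rewrite e2piiD e2pii_half mulrNN mulr1; field.
Qed.

Lemma zeta_neq1' : zeta != 1.
Proof.
apply/eqP => /(congr1 (fun a : C => complex.Im a)).
have -> : zeta = cexp (ofR (2 * pi / 13) * iC R).
  by rewrite /Defs.zeta /e2pii; congr cexp; rewrite !(ofRM, ofRV, ofR_nat); ring.
have -> : ofR (2 * pi / 13) * iC R = Complex 0 (2 * pi / 13) by rewrite /ofR /iC; simpc.
rewrite /cexp /= expR0 /ofR /iC; simpc => /= /eqP; rewrite gt_eqF // sin_gt0_pi //.
have := pi_gt0 R; lra.
Qed.

Lemma zeta_sum : \sum_(i < 13) zeta ^+ i = 0.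
Proof.
have := subrX1 zeta 13; rewrite zeta13 subrr => /esym/eqP.
by rewrite mulf_eq0 subr_eq0 (negbTE zeta_neq1') => /eqP.
Qed.

Definition coords (v : 'cV[C]_6) : seq C := [seq v (inord i) 0 | i <- iota 0 6].

Lemma size_coords v : size (coords v) = 6%N.
Proof. by rewrite size_map size_iota. Qed.

Lemma nth_coords v (i : 'I_6) : (coords v)`_i = v i 0.
Proof. by rewrite (nth_map 0%N) ?size_iota // nth_iota // inord_val. Qed.

(** The leading 0 fills the place of $\zeta$. *)
Definition zvars : seq (poly6 R) := 0 :: [seq zvar R (inord i) | i <- iota 0 6].

Lemma peval_eeval v e : peval (eeval zvars e) v = eeval (0 :: coords v) e.
Proof.
rewrite /peval (eeval_morph (meval _)) /zvars /coords map_cons rmorph0 -map_comp.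
by congr (eeval (0 :: _) e); apply: eq_map => i /=; rewrite mevalXU.
Qed.

Definition Dpolys : seq (poly6 R) := [seq eeval zvars e | e <- Dforms].

Lemma peval_Dvals v e : peval (eeval Dpolys e) v = eeval (Dvals (0 :: coords v)) e.
Proof.
rewrite /peval (eeval_morph (meval _)) -map_comp.
by congr (eeval _ e); apply: eq_map => d; rewrite /= -[LHS]/(peval _ _) peval_eeval.
Qed.

Lemma peval_G k v : (k < 13)%N -> peval (formG R k) v = Gval (zeta :: coords v) k.
Proof.
move=> k13; rewrite (Gval_head _ 0) // -[RHS]peval_Dvals; congr (peval _ v).
by move: k k13; do 13?case.
Qed.

Lemma peval_A v : [/\ peval (formA0 R) v = Aval (zeta :: coords v) 0,
  peval (formA1 R) v = Aval (zeta :: coords v) 1,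
  peval (formA2 R) v = Aval (zeta :: coords v) 2,
  peval (formA3 R) v = Aval (zeta :: coords v) 3 &
  [/\ peval (formA4 R) v = Aval (zeta :: coords v) 4,
  peval (formA5 R) v = Aval (zeta :: coords v) 5 &
  peval (formA6 R) v = Aval (zeta :: coords v) 6]].
Proof. by do !split; rewrite (Aval_head _ 0) // /Aval -peval_eeval. Qed.

Lemma peval_delta nu v : peval (delta R nu) v = deltaform zeta nu (coords v).
Proof.
rewrite /delta /deltaform -(peval_G v (isT : (0 < 13)%N)) /peval.
rewrite rmorphD rmorphM rmorphN rmorph_nat rmorph_sum /=; congr (_ + _).
by apply: eq_big_nat => k /andP[_ k13]; rewrite mevalZ -peval_G.
Qed.

Lemma peval_delta_inf v : peval (delta_inf R) v = deltainf zeta (coords v).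
Proof.
by rewrite /deltainf -(peval_G v (isT : (0 < 13)%N)) /peval rmorphM rmorphXn rmorph_nat.
Qed.

Lemma peval_square (p0 p1 p2 p3 p4 p5 p6 : poly6 R) c1 c2 c3 c4 c5 c6 v :
  peval ((p0 + c1 *: p1 + c2 *: p2 + c3 *: p3 + c4 *: p4 + c5 *: p5 + c6 *: p6) ^+ 2) v =
  (peval p0 v + c1 * peval p1 v + c2 * peval p2 v + c3 * peval p3 v
   + c4 * peval p4 v + c5 * peval p5 v + c6 * peval p6 v) ^+ 2.
Proof. by rewrite /peval rmorphXn !rmorphD /= !mevalZ. Qed.

Lemma peval_w nu v : peval (w R nu) v = wform zeta nu (coords v).
Proof.
have [e0 e1 e2 e3 [e4 e5 e6]] := peval_A v.
rewrite /wform -e0 -e1 -e2 -e3 -e4 -e5 -e6; exact: peval_square.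
Qed.

Lemma peval_w_inf v : peval (w_inf R) v = winf zeta (coords v).
Proof.
have [e0 _ _ _ _] := peval_A v.
by rewrite /winf -e0 /peval /w_inf rmorphM rmorphXn rmorph_nat.
Qed.

Lemma peval_psum (p : nat -> poly6 R) P (q : nat -> seq C -> C) Q' v c k :
  (forall nu, peval (p nu) v = q nu (coords v)) -> peval P v = Q' (coords v) ->
  peval (c *: (\sum_(nu < 13) p nu ^+ k + P ^+ k)) v = c * psum q Q' k (coords v).
Proof.
move=> pq PQ; rewrite /peval mevalZ rmorphD rmorphXn rmorph_sum /= -/(peval _ _) PQ.
congr (_ * (_ + _)).
rewrite -[iota 0 13]/(index_iota 0 13) big_mkord; apply: eq_bigr => nu _.
by rewrite rmorphXn /= -pq.
Qed.

Lemma peval_Phi v : [/\ peval (Phi12 R) v = Phi12val zeta (coords v),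
  peval (Phi18 R) v = Phi18val zeta (coords v),
  peval (Phi20 R) v = Phi20val zeta (coords v) &
  peval (Phi30 R) v = Phi30val zeta (coords v)].
Proof.
have d k c := peval_psum c k (fun nu => peval_delta nu v) (peval_delta_inf v).
have ww c k := peval_psum c k (fun nu => peval_w nu v) (peval_w_inf v).
by split; [exact: d | exact: d | exact: ww | exact: d].
Qed.

End Values.

(** * Invariance under the generators of the group *)

Section Invariance.
Variable R : realType.
Local Notation C := (Cx R).
Local Notation zeta := (zeta R).

Lemma coords_T (v : 'cV[C]_6) : coords (Tmx R *m v) = zact zeta (coords v) (Tex 1).
Proof.
apply: (@eq_from_nth _ 0); rewrite ?size_zact ?size_coords // => i i6.
have := nth_coords (Tmx R *m v) (Ordinal i6); rewrite /= => ->.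
rewrite mul_diag_mx !mxE -(nth_coords v (Ordinal i6)) /=.
by move: i i6; do 6?case.
Qed.

Lemma coords_S (v : 'cV[C]_6) : coords (Smx R *m v) =
  [seq - (ofR (Num.sqrt 13))^-1 * a | a <- zact zeta (coords v) Mex].
Proof.
apply: (@eq_from_nth _ 0); rewrite ?size_map ?size_iota // => i i6.
apply: (etrans (nth_coords (Smx R *m v) (Ordinal i6))).
rewrite /Smx -scalemxAl mxE.
rewrite (nth_map 0) ?size_zact //; congr (_ * _); rewrite mxE.
transitivity (\sum_(j < 6) (let: (a, b) := nth (0, 0)%N (nth [::] M_exponents i) j in
    zeta ^+ a - zeta ^+ b) * (coords v)`_j).
  by apply: eq_bigr => j _; rewrite mxE nth_coords.
rewrite !big_ord_recl big_ord0 /=.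
by move: i i6; do 6?case.
Qed.

Lemma sqrt13 : (- (ofR (Num.sqrt 13))^-1) ^+ 2 * 13%:R = 1 :> C.
Proof.
rewrite sqrrN exprVn -[ofR _ ^+ 2]/(ofR _ * ofR _) -ofRM -expr2 sqr_sqrtr ?ler0n //.
by rewrite ofR_nat mulVf // pnatr_eq0.
Qed.

Lemma nz13 : 13%:R != 0 :> C.
Proof. by rewrite pnatr_eq0. Qed.

Lemma deltapsum_S k v : deltapsum zeta k (coords (Smx R *m v)) = deltapsum zeta k (coords v).
Proof.
have z13 := zeta13 R; have z0 := zeta_sum R.
rewrite coords_S; apply: (psum_S z13 z0 nz13 (m := 3)) => //.
- exact: deltainf_M.
- exact: deltainf_T.
- exact: deltaform_T.
- by move=> z nu z6 nu13; rewrite /deltainf (G0_H z13 z0).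
- exact: deltainf_scale.
- exact: deltaform_scale.
- exact: sqrt13.
Qed.

Lemma wpsum_S k v : wpsum zeta k (coords (Smx R *m v)) = wpsum zeta k (coords v).
Proof.
have z13 := zeta13 R; have z0 := zeta_sum R.
rewrite coords_S; apply: (psum_S z13 z0 nz13 (m := 2)) => //.
- exact: winf_M.
- exact: winf_T.
- exact: wform_T.
- by move=> z nu z6 nu13; rewrite /winf (A0_H z13 z0).
- exact: winf_scale.
- exact: wform_scale.
- exact: sqrt13.
Qed.

Lemma deltapsum_T k v : deltapsum zeta k (coords (Tmx R *m v)) = deltapsum zeta k (coords v).
Proof.
rewrite coords_T; apply: psum_T (size_coords v).
  exact: deltainf_T (zeta13 R).
exact: deltaform_T (zeta13 R).
Qed.

Lemma wpsum_T k v : wpsum zeta k (coords (Tmx R *m v)) = wpsum zeta k (coords v).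
Proof.
rewrite coords_T; apply: psum_T (size_coords v).
  exact: winf_T (zeta13 R).
exact: wform_T (zeta13 R).
Qed.

(* If [g] is not a unit, then [invmx g = g]. *)
Lemma Ginvariant_generators (p : poly6 R) :
  (forall v, peval p (Smx R *m v) = peval p v) ->
  (forall v, peval p (Tmx R *m v) = peval p v) -> Ginvariant p.
Proof.
move=> pS pT g hg; elim: {g} hg => [||v|g h _ IHg _ IHh v|g _ IHg v].
- exact: pS.
- exact: pT.
- by rewrite mul1mx.
- by rewrite -mulmxA IHg IHh.
have [gu|gu] := boolP (g \in unitmx); last by rewrite /invmx (negbTE gu) IHg.
by rewrite -[RHS](congr1 (peval p) (mulKVmx gu v)) IHg.
Qed.

End Invariance.

(** * The point $(x_1(z),\dots,x_6(z))$ as a multiple of the theta vector *)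

Section OnTheCurve.
Variable R : realType.
Local Notation C := (Cx R).
Local Notation zeta := (zeta R).

Lemma coords_xvec (z : C) : upper_half_plane z ->
  coords (xvec z) = [seq Defs.eta z * a | a <- theta_vec (eval_e z)].
Proof.
move=> z0; apply: (@eq_from_nth _ 0); rewrite ?size_map ?size_iota // => i i6.
apply: (etrans (nth_coords (xvec z) (Ordinal i6))).
rewrite mxE (nth_map 0) //; congr (_ * _).
have thE (r : int) (c : R) : c = 13 - 2 * r%:~R -> theta13 c z = eval_e z r.
  by move=> ->; exact: theta13E.
rewrite /a1 /a2 /a3 /a4 /a5 /a6.
rewrite (thE 1 11) ?(thE 3 7) ?(thE 4 5) ?(thE 5 3) ?(thE 2 9) ?(thE 6 1).
  by move: i i6; do 6?case.
all: by rewrite ?(rmorph1, rmorph_nat) -?pmulrn; ring.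
Qed.

Lemma Phi_relations_xvec (z : C) : upper_half_plane z ->
  Phi_relations zeta (coords (xvec z)).
Proof.
move=> z0; rewrite (coords_xvec z0); apply: Phi_scale => //.
apply: (@Phi_theta_vec _ (eval_e z) (eval_O z) (eval_E z)).
- exact: eval_e_prod.
- exact: eval_e_opp.
- exact: eval_e_refl.
- exact: zeta13.
- exact: zeta_sum.
Qed.

End OnTheCurve.

Theorem theorem1p1 (R : realType) :
  [/\ Ginvariant (Phi12 R), Ginvariant (Phi18 R),
      Ginvariant (Phi20 R) & Ginvariant (Phi30 R)] /\
  forall z : Cx R, upper_half_plane z ->
    let P12 := peval (Phi12 R) (xvec z) in
    let P18 := peval (Phi18 R) (xvec z) in
    let P20 := peval (Phi20 R) (xvec z) in
    let P30 := peval (Phi30 R) (xvec z) in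
    P20 ^+ 3 - P30 ^+ 2 = 1728 * P12 ^+ 5 /\
    P20 ^+ 3 - P12 ^+ 2 * P18 ^+ 2 = 1728 * P12 ^+ 5.
Proof.
split=> [|z z0 P12 P18 P20 P30]; last first.
  have main p12 p18 p20 p30 : p12 = Phi12val (zeta R) (coords (xvec z)) ->
      p18 = Phi18val (zeta R) (coords (xvec z)) ->
      p20 = Phi20val (zeta R) (coords (xvec z)) ->
      p30 = Phi30val (zeta R) (coords (xvec z)) ->
      p20 ^+ 3 - p30 ^+ 2 = 1728 * p12 ^+ 5 /\
      p20 ^+ 3 - p12 ^+ 2 * p18 ^+ 2 = 1728 * p12 ^+ 5.
    by move=> -> -> -> ->; exact: Phi_relations_xvec z0.
  have [e12 e18 e20 e30] := peval_Phi (xvec z).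
  exact: main e12 e18 e20 e30.
split; apply: Ginvariant_generators => v.
- have [e _ _ _] := peval_Phi (Smx R *m v); have [e' _ _ _] := peval_Phi v.
  by rewrite e e' /Phi12val deltapsum_S.
- have [e _ _ _] := peval_Phi (Tmx R *m v); have [e' _ _ _] := peval_Phi v.
  by rewrite e e' /Phi12val deltapsum_T.
- have [_ e _ _] := peval_Phi (Smx R *m v); have [_ e' _ _] := peval_Phi v.
  by rewrite e e' /Phi18val deltapsum_S.
- have [_ e _ _] := peval_Phi (Tmx R *m v); have [_ e' _ _] := peval_Phi v.
  by rewrite e e' /Phi18val deltapsum_T.
- have [_ _ e _] := peval_Phi (Smx R *m v); have [_ _ e' _] := peval_Phi v.
  by rewrite e e' /Phi20val wpsum_S.
- have [_ _ e _] := peval_Phi (Tmx R *m v); have [_ _ e' _] := peval_Phi v.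
  by rewrite e e' /Phi20val wpsum_T.
- have [_ _ _ e] := peval_Phi (Smx R *m v); have [_ _ _ e'] := peval_Phi v.
  by rewrite e e' /Phi30val deltapsum_S.
- have [_ _ _ e] := peval_Phi (Tmx R *m v); have [_ _ _ e'] := peval_Phi v.
  by rewrite e e' /Phi30val deltapsum_T.
Qed.
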